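(* If $\alpha \geq 0$, there exists $p_\alpha > 2 \max\left\{1, \frac{1}{B\left(\frac12,\alpha+1\right)}\right\}$ such that \[ \| f \|_{A^p_\alpha} \leq \| f \|_{\mathcal{B}}, \quad \forall f \in \mathcal{B}, \] for any $p \in (0, p_\alpha]$.
   Context: $\mathbb{D}$ is the open unit disk of $\mathbb{C}$ and $dA(z) = \frac{1}{\pi}\,dx\,dy$. For $\alpha>-1$, $d\mu_\alpha(z) := (\alpha+1)(1-|z|^2)^\alpha\,dA(z)$, and for $p>0$ and $f$ analytic in $\mathbb{D}$, $\|f\|_{A^p_\alpha} := \left(\int_{\mathbb{D}} |f|^p\,d\mu_\alpha\right)^{1/p}$. The Bloch space $\mathcal{B}$ is the set of analytic $f$ in $\mathbb{D}$ with $\rho_{\mathcal{B}}(f) := \sup_{z\in\mathbb{D}} |f'(z)|(1-|z|^2)<\infty$, normed by $\|f\|_{\mathcal{B}} := |f(0)| + \rho_{\mathcal{B}}(f)$. $B(x,y) := \int_0^1 t^{x-1}(1-t)^{y-1}\,dt$, $x,y>0$, is the Euler Beta function. *)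

(* Defs.v *)
From HB Require Import structures.
From mathcomp Require Import all_boot all_order all_algebra.
From mathcomp Require Import complex.
From mathcomp Require Import all_classical all_reals all_analysis.

Set Implicit Arguments.
Unset Strict Implicit.
Unset Printing Implicit Defensive.

Import Order.TTheory GRing.Theory Num.Theory.
Import numFieldNormedType.Exports.

Local Open Scope classical_set_scope.
Local Open Scope ring_scope.
Local Open Scope complex_scope.

Definition unit_disk (R : realType) : set R[i] := [set z | Normc.normc z < 1].

(* R[i]^o is R[i] as a normed space over itself, so derivability in the
   direction 1 and [derive1] are complex differentiability and the complex
   derivative. A function on the disk is a total function on R[i] whose values
   off the disk are never used: the disk is open, so the derivatives at its
   points depend only on the values inside. *)
Definition analytic_in_disk (R : realType) (f : R[i]^o -> R[i]^o) : Prop :=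
  forall z : R[i]^o, unit_disk z -> derivable f z 1.

Definition bloch_seminorm (R : realType) (f : R[i]^o -> R[i]^o) : \bar R :=
  ereal_sup [set (Normc.normc (derive1 f z) * (1 - Normc.normc z ^+ 2))%:E
            | z in @unit_disk R].

Definition bloch (R : realType) (f : R[i]^o -> R[i]^o) : Prop :=
  analytic_in_disk f /\ (bloch_seminorm f < +oo)%E.

Definition bloch_norm (R : realType) (f : R[i]^o -> R[i]^o) : \bar R :=
  ((Normc.normc (f 0))%:E + bloch_seminorm f)%E.

(* The integral of g against mu_alpha over the disk; the plane is R * R with
   its product Lebesgue measure, and pi^-1 comes from dA = dx dy / pi. *)
Definition disk_integral (R : realType) (alpha : R) (g : R[i] -> R) : \bar R :=
  (\int[lebesgue_measure \x lebesgue_measure]_(u in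
       [set u : R * R | unit_disk (u.1 +i* u.2)])
     (g (u.1 +i* u.2) *
      ((alpha + 1) * (1 - Normc.normc (u.1 +i* u.2) ^+ 2) `^ alpha * pi^-1))%:E)%E.

Definition bergman_norm (R : realType) (alpha p : R) (f : R[i]^o -> R[i]^o) :
    \bar R :=
  (disk_integral alpha (fun z => (Normc.normc (f z) `^ p)%R) `^ p^-1)%E.

(* The library's [beta_fun] only takes natural arguments. *)
Definition Beta (R : realType) (x y : R) : R :=
  \int[lebesgue_measure]_(t in `]0, 1[) (t `^ (x - 1) * (1 - t) `^ (y - 1)).

(* Main.v *)
Require Import Defs.
From HB Require Import structures.
From mathcomp Require Import all_boot all_order all_algebra.
From mathcomp Require Import complex.
From mathcomp Require cyclic separable cyclotomic.
From mathcomp Require Import all_classical all_reals all_analysis.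
From mathcomp Require Import measurable_realfun.
From mathcomp Require Import ring lra.
Import Order.TTheory GRing.Theory Num.Theory.
Import numFieldNormedType.Exports.
Local Open Scope classical_set_scope.
Local Open Scope ring_scope.
Local Open Scope complex_scope.
Set Implicit Arguments.
Unset Strict Implicit.
Unset Printing Implicit Defensive.

(* Write rho for the Bloch seminorm of f, X for |f - f(0)| / rho and t for |z|^2.
   If the integral of X^q is at most 1 for some q >= 1, then the bound holds for
   all p <= q: convexity of x^q gives
   ((|f(0)| + rho X) / (|f(0)| + rho))^q <= (|f(0)| + rho X^q) / (|f(0)| + rho),
   and x^p <= (p/q) x^q + 1 - p/q. So it is enough to treat q = p_alpha.
   Integration of |f'| along rays gives X^2 <= t / (1 - t), and
   X <= 4 (1 - t)^(-1/8).
   For alpha > 1 take p_alpha = 2 alpha: the first growth bound yields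
   X^(2 alpha) (alpha + 1) (1 - t)^alpha <= (alpha + 1) t^alpha, whose integral is 1,
   while B = B(1/2, alpha + 1) has 1/B <= sqrt alpha < alpha by Bernoulli's inequality.
   For alpha <= 1, 1/B <= 1, and it is enough to exceed 2 slightly. By Parseval the
   integral of X^2 is at most sum_(n >= 1) |c_n|^2 / ((n + 1) rho^2). Parseval for f'
   on circles bounds this sum by 1, and Bessel's inequality for (1 + lam z) z f'
   excludes the coefficients that would give equality, so the sum is at most 1 - delta
   with an absolute delta > 0. Interpolating X^(2 + e) between X^2 and X^4, where
   X^4 <= 256 (1 - t)^(-1/2) is integrable, gives p_alpha = 2 + e. *)

(** The obstacle is the range [alpha <= 1]. There p_alpha has to exceed 2, while integrating
    Parseval's bound for f' over all radii yields only the bound 1 for the integral of X^2, so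
    nothing is left to move the exponent. The gain must be uniform in f. Since 1 / (1 - t)^2 is the
    sum of (k + 1) t^k, equality at all radii would force |c_1| = 1 and 2 |c_2| = sqrt 2 for rho =
    1. Moduli of coefficients cannot exclude this pair, so phases must enter: a factor 1 + lam z
    with lam aligning c_1 and c_2 makes their moduli add, which is too much on the circle of radius
    1/4. The exponent alpha leaves the Parseval step because the n-th moment of the radial weight is
    at most 1 / (n + 1) for every alpha >= 0. Polar coordinates are avoided: orthogonality of
    monomials comes from averages over roots of unity, on circles as well as on the plane, and area
    is carried to the line by |z|^2. Taylor expansions come from differentiability alone. Cauchy's
    formula is proved for a function with bounded, possibly discontinuous derivative on the closed
    disk; it is applied to dilates f(r z), and Fatou's lemma lets r tend to 1. *)

Section ComplexDerivative.
Variable R : realType.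
Implicit Types (z v d : R[i]) (f : R[i] -> R[i]).
Local Notation normc := (@Normc.normc R).
Local Notation cRe := (@complex.Re R).
Local Notation cIm := (@complex.Im R).

(** * Moduli, complex derivatives as estimates, mean value inequalities *)

Lemma normcD_le (x y : R[i]) : normc (x + y) <= normc x + normc y.
Proof. exact: (le_normcD x y). Qed.

Lemma normcN (x : R[i]) : normc (- x) = normc x.
Proof. exact: (complex.normcN x). Qed.

Lemma normcB (x y : R[i]) : normc (x - y) = normc (y - x).
Proof. by rewrite -opprB normcN. Qed.

Lemma normcB_le (x y : R[i]) : normc (x - y) <= normc x + normc y.
Proof. by rewrite -[normc y]normcN normcD_le. Qed.

Lemma normc_ge0 (x : R[i]) : 0 <= normc x.
Proof. by case: x => a b; apply: sqrtr_ge0. Qed.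

Lemma normcX (x : R[i]) n : normc (x ^+ n) = normc x ^+ n.
Proof.
elim: n => [|n IH]; first by rewrite !expr0 Normc.normc1.
by rewrite !exprS Normc.normcM IH.
Qed.

Lemma normc_sum (I : Type) (s : seq I) (F : I -> R[i]) :
  normc (\sum_(i <- s) F i) <= \sum_(i <- s) normc (F i).
Proof.
elim: s => [|i s IH]; first by rewrite !big_nil Normc.normc0.
rewrite !big_cons; apply: le_trans (normcD_le _ _) _.
by rewrite lerD2l.
Qed.

Lemma normc_sqr z : normc z ^+ 2 = cRe z ^+ 2 + cIm z ^+ 2.
Proof. by case: z => a b; rewrite /= sqr_sqrtr// addr_ge0// sqr_ge0. Qed.

Lemma normc_real (x : R) : normc x%:C = `|x|.
Proof. by rewrite /= expr0n /= addr0 sqrtr_sqr. Qed.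

Lemma normc_Re z : `|cRe z| <= normc z.
Proof.
rewrite -(@ler_pXn2r _ 2) ?nnegrE ?normc_ge0 ?normr_ge0//.
by rewrite normc_sqr real_normK ?num_real// lerDl sqr_ge0.
Qed.

Lemma normc_Im z : `|cIm z| <= normc z.
Proof.
rewrite -(@ler_pXn2r _ 2) ?nnegrE ?normc_ge0 ?normr_ge0//.
by rewrite normc_sqr real_normK ?num_real// lerDr sqr_ge0.
Qed.

Lemma normc_eq0 z : (normc z == 0) = (z == 0).
Proof.
apply/eqP/eqP => [/Normc.eq0_normc //|->]; exact: Normc.normc0.
Qed.

Lemma normc_gt0 z : (0 < normc z) = (z != 0).
Proof. by rewrite lt_def normc_ge0 andbT normc_eq0. Qed.

Lemma normcE_alg z : `|z| = (normc z)%:C.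
Proof. by []. Qed.

Lemma mulc_conj z : z * conjc z = (normc z ^+ 2)%:C.
Proof. by rewrite -sqr_normc normcE_alg rmorphXn. Qed.

(** The non-strict estimate also covers [h = 0], so chain rules along real curves and dilations need
    no punctured limits. *)
Definition cderiv f z d := forall e, 0 < e ->
  exists2 r, 0 < r & forall h, normc h <= r ->
    normc (f (z + h) - f z - h * d) <= e * normc h.

Lemma derivable_cderiv (f : R[i]^o -> R[i]^o) (z : R[i]^o) :
  derivable f z 1 -> cderiv f z (derive1 f z).
Proof.
move=> fz e e0.
have H : h^-1 *: ((f \o shift z) (h *: (1 : R[i]^o)) - f z)
    @[h --> (0 : R[i]^o)^'] --> derive1 f z by rewrite derive1E; exact: fz.
move/cvgrPdist_le : H => /(_ e%:C); rewrite ltcR => /(_ e0).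
rewrite /dnbhs near_withinE /= => H.
have [r /= r0 Hr] := (@nbhs_ballP _ _ (0 : R[i]^o) _).1 H.
have r'E : r = (cRe r)%:C by rewrite RRe_real// gtr0_real.
exists (cRe r / 2).
  by rewrite divr_gt0// -ltcR -r'E.
move=> h hr; have [->|h0] := eqVneq h 0.
  by rewrite addr0 subrr mul0r subr0 Normc.normc0 mulr0.
have {}Hr := Hr h.
have : `|derive1 f z - h^-1 * (f (z + h) - f z)| <= e%:C.
  have -> : z + h = h * 1 + z by rewrite mulr1 addrC.
  apply: Hr => //.
  rewrite /ball /= sub0r normrN normcE_alg r'E ltcR.
  rewrite (le_lt_trans hr)// ltr_pdivrMr// ltr_pMr ?ltr1n//.
  by rewrite -ltcR -r'E.
rewrite normcE_alg lecR => {}Hr.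
have -> : f (z + h) - f z - h * derive1 f z =
   - (h * (derive1 f z - h^-1 * (f (z + h) - f z))).
  by rewrite mulrBr mulrA divff// mul1r opprB.
by rewrite normcN Normc.normcM mulrC ler_wpM2r// normc_ge0.
Qed.

Lemma is_derive_eps (g : R -> R) (x l : R) :
  (forall e, 0 < e -> exists2 r, 0 < r & forall h, `|h| <= r ->
    `|g (x + h) - g x - h * l| <= e * `|h|) -> is_derive x 1 g l.
Proof.
move=> H.
have K : h^-1 *: ((g \o shift x) (h *: (1 : R^o)) - g x) @[h --> (0 : R)^'] --> l.
  apply/cvgrPdist_le => e e0; have [r r0 Hr] := H e e0.
  near=> h.
  have h0 : h != 0 by near: h; exact: nbhs_dnbhs_neq.
  have hr : `|h| <= r by near: h; apply: dnbhs0_le.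
  have := Hr h hr.
  rewrite -ler_pdivrMr ?normr_gt0// -normf_div.
  rewrite /= -[_ *: 1]/(h * 1) mulr1 addrC -[_ *: _]/(_ * _).
  rewrite -normrN; congr (`|_| <= _); first rewrite (addrC h x).
  by field.
apply: DeriveDef; last exact/cvg_lim.
by apply/cvg_ex; exists l.
Unshelve. all: by end_near. Qed.

Lemma cderiv_line f (u a v d : R[i]) (s : R) : cderiv f (a + s%:C * v) d ->
  is_derive s 1 (fun s => cRe (u * f (a + s%:C * v))) (cRe (u * (d * v))).
Proof.
move=> fd; apply: is_derive_eps => e e0.
pose M := normc u * normc v + 1.
have M0 : 0 < M by rewrite ltr_wpDl// mulr_ge0 ?normc_ge0.
have [r r0 Hr] := fd (e / M) (divr_gt0 e0 M0).
exists (r / (normc v + 1)); first by rewrite divr_gt0// ltr_wpDl// normc_ge0.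
move=> h hr.
have nhv : normc (h%:C * v) = `|h| * normc v by rewrite Normc.normcM normc_real.
have : normc (h%:C * v) <= r.
  rewrite nhv; move: hr; rewrite ler_pdivlMr ?ltr_wpDl ?normc_ge0// => hr.
  by apply: le_trans hr; rewrite ler_wpM2l// lerDl.
move=> /Hr {}Hr.
have -> : a + (s + h)%:C * v = a + s%:C * v + h%:C * v.
  by rewrite rmorphD mulrDl addrA.
set F1 := f (_ + _ + _) in Hr *; set F0 := f _ in Hr *.
have -> : cRe (u * F1) - cRe (u * F0) - h * cRe (u * (d * v)) =
    cRe (u * (F1 - F0 - h%:C * v * d)).

  case: (u) (F1) (F0) (d) (v) => [u1 u2] [x1 x2] [y1 y2] [d1 d2] [v1 v2].
  by simpc => /=; ring.
apply: le_trans (normc_Re _) _; rewrite Normc.normcM.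
apply: le_trans (ler_wpM2l (normc_ge0 u) Hr) _.
rewrite nhv.
have -> : normc u * (e / M * (`|h| * normc v)) =
  (e * `|h|) * ((normc u * normc v) / M) by ring.
apply: ler_piMr; first by rewrite mulr_ge0 ?(ltW e0).
by rewrite ler_pdivrMr// mul1r lerDl.
Qed.

(** The factor [u] turns the increment onto the positive real axis, and the real mean value theorem
    applies to Re(u f) - phi along the segment. The majorant [dphi] may vary with s because growth
    along rays is compared with a function that blows up at the circle. *)
Lemma mean_value_ineq f (a v : R[i]) (d : R -> R[i]) (phi dphi : R -> R) :
  (forall s : R, 0 <= s <= 1 -> cderiv f (a + s%:C * v) (d s)) ->
  (forall s : R, 0 < s < 1 -> normc (d s * v) <= dphi s) ->
  (forall s : R, 0 <= s <= 1 -> is_derive s 1 phi (dphi s)) ->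
  normc (f (a + v) - f a) <= phi 1 - phi 0.
Proof.
move=> fd dle phid.
set D := f (a + v) - f a.
pose u := if D == 0 then 0 else conjc D / (normc D)%:C.
have nu : normc u <= 1.
  rewrite /u; case: ifPn => [_|D0]; first by rewrite Normc.normc0.
  rewrite Normc.normcM Normc.normcV normc_real ger0_norm ?normc_ge0//.
  have -> : normc (conjc D) = normc D by case: (D) => x y /=; rewrite sqrrN.
  by rewrite divff// normc_eq0.
have uD : cRe (u * D) = normc D.
  rewrite /u; case: ifPn => [/eqP ->|D0]; first by rewrite mul0r Normc.normc0.
  rewrite mulrAC [conjc D * D]mulrC mulc_conj -rmorphV ?unitfE ?normc_eq0//.
  by rewrite -rmorphM /= expr2 mulfK// normc_eq0.
pose g (s : R) := cRe (u * f (a + s%:C * v)).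
have gd (s : R) : 0 <= s <= 1 ->
    is_derive s 1 (g \- phi) (cRe (u * (d s * v)) - dphi s).
  move=> s01; apply: is_deriveB; last exact: phid.
  by apply: cderiv_line; exact: fd.
have [] := @MVT _ (g \- phi) (fun s => cRe (u * (d s * v)) - dphi s) 0 1 ltr01.
- by move=> x; rewrite in_itv/= => /andP[x0 x1]; apply: gd; rewrite !ltW.
- apply: derivable_within_continuous => x; rewrite in_itv/= => /gd.
  by case.
move=> c; rewrite in_itv/= => c01; rewrite subr0 mulr1 /= => E.
have : g 1 - phi 1 - (g 0 - phi 0) <= 0.
  rewrite E subr_le0; apply: le_trans (dle c c01).
  apply: le_trans (ler_norm _) _; apply: le_trans (normc_Re _) _.
  by rewrite Normc.normcM ler_piMl ?normc_ge0.
have -> : normc D = g 1 - g 0.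
  rewrite -uD /g /D mul1r mul0r addr0 mulrBr.
  by case: (u * _) (u * _) => [? ?] [? ?].
lra.
Qed.

Lemma lipschitz_segment f (a b : R[i]) (d : R[i] -> R[i]) L :
  (forall s : R, 0 <= s <= 1 -> cderiv f (a + s%:C * (b - a)) (d (a + s%:C * (b - a)))) ->
  (forall s : R, 0 <= s <= 1 -> normc (d (a + s%:C * (b - a))) <= L) ->
  normc (f b - f a) <= L * normc (b - a).
Proof.
move=> fd dL.
have := @mean_value_ineq f a (b - a) (fun s : R => d (a + s%:C * (b - a)))
  (fun s : R => L * normc (b - a) * s) (fun=> L * normc (b - a)).
rewrite addrCA subrr addr0 mulr1 mulr0 subr0; apply => //.
- move=> s /andP[s0 s1]; rewrite Normc.normcM ler_wpM2r ?normc_ge0//.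
  by apply: dL; rewrite !ltW.
- move=> s _; apply: is_derive_eq.
  by rewrite -[_ *: _]/(_ * _) mulr1.
Qed.

End ComplexDerivative.

(** * Roots of unity and finite Parseval identities *)

Section RootsOfUnity.
Variable R : realType.
Local Notation normc := (@Normc.normc R).

(** The polynomial ['X^N - 1] splits into distinct linear factors, and N distinct N-th roots of
    unity in a field include a primitive one. *)
Lemma complex_prim_root N : (0 < N)%N -> exists w : R[i], N.-primitive_root w.
Proof.
move=> N_gt0; pose p : {poly R[i]} := 'X^N - 1.
have [r Dp] := closed_field_poly_normal p.
move: Dp; rewrite (monicP _) ?monicXnsubC// scale1r => Dp.
have rn1 : all N.-unity_root r.
  by apply/allP => z; rewrite -root_prod_XsubC -Dp.
have sz_r : (N < (size r).+1)%N.
  by rewrite -(size_prod_XsubC r id) -Dp size_XnsubC.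
have [|w] := hasP (cyclic.has_prim_root N_gt0 rn1 _ sz_r); last by exists w.
rewrite -separable.separable_prod_XsubC -Dp cyclotomic.separable_Xn_sub_1 ?pnatr_eq0 -?lt0n//.
Qed.

Lemma normc_unity_root N (w : R[i]) : (0 < N)%N -> w ^+ N = 1 -> normc w = 1.
Proof.
move=> N0 wN; have : normc w ^+ N = 1 by rewrite -normcX wN Normc.normc1.
by move/eqP; rewrite -(expr1n _ N) eqrXn2 ?normc_ge0 ?ler01 ?expr1n// => /eqP.
Qed.

Lemma conjc_inv_unit (w : R[i]) : normc w = 1 -> conjc w = w^-1.
Proof.
move=> nw; have w0 : w != 0 by rewrite -normc_gt0 nw.
by apply: (mulfI w0); rewrite mulc_conj nw expr1n divff.
Qed.

Lemma sum_unity_root N (x : R[i]) : x ^+ N = 1 -> x != 1 ->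
  \sum_(k < N) x ^+ k = 0.
Proof.
move=> xN x1; have := subrX1 x N; rewrite xN subrr => /esym/eqP.
by rewrite mulf_eq0 subr_eq0 (negPf x1) => /eqP.
Qed.

(** Orthogonality of characters: the cross term of n and m carries the sum over k of (w^n / w^m)^k,
    which vanishes since w^n and w^m differ. This finite average does the work of a circle
    integral. *)
Lemma discrete_parseval N (w : R[i]) (d : nat -> R[i]) : N.-primitive_root w ->
  \sum_(k < N) normc (\sum_(n < N) d n * (w ^+ k) ^+ n) ^+ 2 =
  N%:R * \sum_(n < N) normc (d n) ^+ 2.
Proof.
move=> wN; have N0 := prim_order_gt0 wN.
have nw : normc w = 1 by apply: (normc_unity_root N0); exact: prim_expr_order wN.
have w0 : w != 0 by rewrite -normc_gt0 nw.
apply: complexI; rewrite rmorph_sum rmorphM rmorph_sum rmorph_nat.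
under eq_bigr => k _ do rewrite /= -mulc_conj.
have T (k n m : 'I_N) : d n * (w ^+ k) ^+ n * conjc (d m * (w ^+ k) ^+ m) =
    (d n * conjc (d m)) * (w ^+ n / w ^+ m) ^+ k.
  have -> : conjc (d m * (w ^+ k) ^+ m) = conjc (d m) * (w^-1 ^+ k) ^+ m.
    by rewrite -conjc_inv_unit// rmorphM !rmorphXn.
  rewrite expr_div_n -!exprM exprVn [(m * k)%N]mulnC [(n * k)%N]mulnC; ring.
under eq_bigr => k _.
  rewrite rmorph_sum mulr_suml.
  under eq_bigr => n _.
    rewrite mulr_sumr.
    under eq_bigr => m _ do rewrite T.
    over.
  over.
rewrite exchange_big mulr_sumr; apply: eq_bigr => n _ /=.
rewrite exchange_big (bigD1 n)//= [X in _ + X]big1 ?addr0.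
  rewrite divff ?expf_neq0//.
  under eq_bigr do rewrite expr1n mulr1.
  by rewrite mulc_conj sumr_const card_ord mulr_natl.
move=> m mn; rewrite -mulr_sumr sum_unity_root ?mulr0//.
  by rewrite expr_div_n -!exprM ![(_ * N)%N]mulnC !exprM (prim_expr_order wN) !expr1n divr1.
rewrite -(inj_eq (mulIf (expf_neq0 m w0))) mul1r divfK ?expf_neq0//.
rewrite (eq_prim_root_expr wN) !modn_small//.
by apply: contra mn => /eqP nm; apply/eqP/val_inj.
Qed.

(** N nodes separate N coefficients, so the mean of the squared modulus over the N-th roots of unity
    is exactly the coefficient sum. *)
Lemma bessel_circle N (d : nat -> R[i]) S :
  (forall x : R[i], normc x = 1 -> normc (\sum_(n < N) d n * x ^+ n) <= S) ->
  \sum_(n < N) normc (d n) ^+ 2 <= S ^+ 2.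
Proof.
case: N => [|N] dS; first by rewrite big_ord0 sqr_ge0.
have [w wN] := @complex_prim_root N.+1 isT.
have nw : normc w = 1 by exact: normc_unity_root (prim_expr_order wN).
have := discrete_parseval d wN; set T := \sum_(n < _) _ => E.
rewrite -(@ler_pM2l _ N.+1%:R) ?ltr0n// -E.
have -> : N.+1%:R * S ^+ 2 = \sum_(k < N.+1) S ^+ 2.
  by rewrite sumr_const card_ord mulr_natl.
apply: ler_sum => k _; apply: lerXn2r; rewrite ?nnegrE ?normc_ge0//.
  by apply: le_trans (normc_ge0 _) (dS 1 _); rewrite Normc.normc1.
by apply: dS; rewrite normcX nw expr1n.
Qed.

(* The factor 1 + lam x couples consecutive coefficients; two of the terms of
   Parseval's identity for the product are kept. *)
Lemma bessel_circle_mul N (d : nat -> R[i]) (lam : R[i]) S : (2 < N)%N ->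
  (forall x : R[i], normc x = 1 -> normc (\sum_(n < N) d n * x ^+ n) <= S) ->
  normc (d 1%N + lam * d 0%N) ^+ 2 + normc (d 2 + lam * d 1%N) ^+ 2 <=
    S ^+ 2 * (1 + normc lam ^+ 2).
Proof.
move=> N2 dS.
have S0 : 0 <= S by apply: le_trans (normc_ge0 _) (dS 1 _); rewrite Normc.normc1.
have [w wN] := @complex_prim_root N.+1 isT.
have nw : normc w = 1 by exact: normc_unity_root (prim_expr_order wN).
(* [e] and [l] are the coefficients of the product and of [1 + lam * x]. The product has degree up
   to N, hence N + 1 nodes; the mean of |1 + lam x|^2 over them is exactly 1 + |lam|^2. *)
pose e n := (if (n < N)%N then d n else 0) + lam * (if n is m.+1 then d m else 0).
pose l n : R[i] := if n is 0%N then 1 else if n is 1%N then lam else 0.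
have eE (x : R[i]) : \sum_(n < N.+1) e n * x ^+ n =
    (\sum_(n < N) d n * x ^+ n) * (1 + lam * x).
  under eq_bigr do rewrite mulrDl.
  rewrite big_split big_ord_recr/= ltnn mul0r addr0 big_ord_recl/= mulr0 mul0r add0r.
  rewrite mulrDr mulr1; congr (_ + _); first by apply: eq_bigr => i _; rewrite ltn_ord.
  by rewrite mulr_suml; apply: eq_bigr => i _; rewrite /bump/= add1n exprS; ring.
have lE (x : R[i]) : \sum_(n < N.+1) l n * x ^+ n = 1 + lam * x.
  case: (N) N2 => [//|M] _; rewrite !big_ord_recl /= big1 ?addr0.
    by rewrite expr0 expr1 mulr1.
  by move=> i _; rewrite mul0r.
have Ee := discrete_parseval e wN; have El := discrete_parseval l wN.
have {El} El : \sum_(k < N.+1) normc (1 + lam * w ^+ k) ^+ 2 =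
    N.+1%:R * (1 + normc lam ^+ 2).
  under eq_bigr do rewrite -lE.
  rewrite El; congr (_ * _); case: (N) N2 => [//|M] _.
  rewrite 2!big_ord_recl big1 ?addr0.
    by rewrite -[LHS]/(normc 1 ^+ 2 + normc lam ^+ 2) Normc.normc1 expr1n.
  by move=> i _; rewrite -[LHS]/(normc 0 ^+ 2) Normc.normc0 expr0n.
have : N.+1%:R * \sum_(n < N.+1) normc (e n) ^+ 2 <=
    N.+1%:R * (S ^+ 2 * (1 + normc lam ^+ 2)).
  rewrite -Ee mulrCA -El mulr_sumr; apply: ler_sum => k _.
  rewrite eE Normc.normcM exprMn ler_wpM2r ?sqr_ge0//.
  by apply: lerXn2r; rewrite ?nnegrE ?normc_ge0//; apply: dS; rewrite normcX nw expr1n.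
rewrite ler_pM2l ?ltr0n//; apply: le_trans.
have e1 : e 1%N = d 1%N + lam * d 0%N by rewrite /e (ltn_trans _ N2).
have e2 : e 2 = d 2 + lam * d 1%N by rewrite /e N2.
rewrite -e1 -e2; case: (N) N2 => [//|[//|[//|M]]] _; rewrite 3!big_ord_recl.
rewrite -[leRHS]/(normc (e 0%N) ^+ 2 + (normc (e 1%N) ^+ 2 + (normc (e 2) ^+ 2 +
  \sum_(i < M.+1) normc (e (lift ord0 (lift ord0 (lift ord0 i)))) ^+ 2))).
rewrite addrA -addrA addrCA lerD2l.
by rewrite addrCA lerDl addr_ge0 ?sqr_ge0 ?sumr_ge0// => i _; rewrite sqr_ge0.
Qed.

End RootsOfUnity.

(** * Derivatives of complex-valued curves of a real variable *)

Section CurveDerivative.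
Variable R : realType.
Implicit Types (F G : R -> R[i]) (x h : R) (u z d : R[i]).
Local Notation normc := (@Normc.normc R).
Local Notation cRe := (@complex.Re R).
Local Notation cIm := (@complex.Im R).

Lemma is_derive_epsP (g : R -> R) x (l : R) : is_derive x 1 g l ->
  forall e, 0 < e -> exists2 r, 0 < r & forall h, `|h| <= r ->
    `|g (x + h) - g x - h * l| <= e * `|h|.
Proof.
move=> [gx gl] e e0; have [r r0 Hr] : exists2 r, 0 < r & forall h, h != 0 -> `|h| <= r ->
    `|l - h^-1 * (g (x + h) - g x)| <= e.
  have : h^-1 *: ((g \o shift x) (h *: (1 : R^o)) - g x) @[h --> (0 : R)^'] --> l.
    by rewrite -gl; exact: gx.
  move/cvgrPdist_le => /(_ e e0); rewrite /dnbhs near_withinE /= => H.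
  have [r /= r0 Hr] := (@nbhs_ballP _ _ (0 : R) _).1 H.
  exists (r / 2); first by rewrite divr_gt0.
  move=> h h0 hr; have := Hr h.
  rewrite /ball /= sub0r normrN -[h *: _]/(h * 1) mulr1 [h + x]addrC; apply => //.
  by rewrite (le_lt_trans hr)// ltr_pdivrMr// ltr_pMr ?ltr1n.
exists r => // h hr; have [->|h0] := eqVneq h 0.
  by rewrite addr0 subrr mul0r subr0 normr0 mulr0.
have -> : g (x + h) - g x - h * l = - (h * (l - h^-1 * (g (x + h) - g x))).
  by field.
by rewrite normrN normrM mulrC ler_wpM2r// Hr.
Qed.

Definition rderiv F x d :=
  is_derive x 1 (cRe \o F) (cRe d) /\ is_derive x 1 (cIm \o F) (cIm d).

Lemma normc_le_ReIm z : normc z <= `|cRe z| + `|cIm z|.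
Proof.
rewrite {1}(_ : z = (cRe z)%:C + (cIm z)%:C * 'i); last first.
  by case: z => a b; simpc.
apply: le_trans (normcD_le _ _) _; rewrite Normc.normcM !normc_real.
by rewrite [normc 'i](_ : _ = 1) ?mulr1//= expr0n expr1n add0r sqrtr1.
Qed.

Lemma rderiv_epsP F x d : rderiv F x d ->
  forall e, 0 < e -> exists2 r, 0 < r & forall h, `|h| <= r ->
    normc (F (x + h) - F x - h%:C * d) <= e * `|h|.
Proof.
move=> [dr di] e e0; have e20 : 0 < e / 2 by rewrite divr_gt0.
have [r r0 Hr] := is_derive_epsP dr e20.
have [s s0 Hs] := is_derive_epsP di e20.
exists (Num.min r s); first by rewrite lt_min r0.
move=> h; rewrite le_min => /andP[hr hs].
apply: le_trans (normc_le_ReIm _) _.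
have := Hr h hr; have := Hs h hs; rewrite /=.
have -> : e * `|h| = e / 2 * `|h| + e / 2 * `|h| by field.
move: (F (x + h)) (F x) d {dr di Hr Hs} => [a b] [a' b'] [d1 d2] /= H1 H2.
apply: lerD; [move: H2|move: H1]; congr (`|_| <= _); ring.
Qed.

Lemma rderiv_Re F x d u : rderiv F x d ->
  is_derive x 1 (fun t => cRe (u * F t)) (cRe (u * d)).
Proof.
move=> [dr di].
have -> : (fun t => cRe (u * F t)) = cRe u \*o (cRe \o F) \- cIm u \*o (cIm \o F).
  by apply/funext => t /=; case: (u) (F t) => [? ?] [? ?].
apply: is_derive_eq; rewrite -![_ *: _]/(_ * _).
by case: (u) (d) => [? ?] [? ?].
Qed.

Lemma rderiv_cst u x : rderiv (fun=> u) x 0.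
Proof. by split; exact: is_derive_cst. Qed.

Lemma rderivD F G x d d' : rderiv F x d -> rderiv G x d' ->
  rderiv (fun t => F t + G t) x (d + d').
Proof.
move=> [dr di] [dr' di']; split.
  have -> : cRe \o (fun t => F t + G t) = (cRe \o F) + (cRe \o G).
    by apply/funext => t /=; rewrite !fctE /=; case: (F t) (G t) => [? ?] [? ?].
  by apply: is_derive_eq; case: (d) (d') => [? ?] [? ?].
have -> : cIm \o (fun t => F t + G t) = (cIm \o F) + (cIm \o G).
  by apply/funext => t /=; rewrite !fctE /=; case: (F t) (G t) => [? ?] [? ?].
by apply: is_derive_eq; case: (d) (d') => [? ?] [? ?].
Qed.

Lemma rderivM F G x d d' : rderiv F x d -> rderiv G x d' ->
  rderiv (fun t => F t * G t) x (d * G x + F x * d').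
Proof.
move=> [dr di] [dr' di']; split.
  have -> : cRe \o (fun t => F t * G t) =
      (cRe \o F) * (cRe \o G) - (cIm \o F) * (cIm \o G).
    by apply/funext => t; rewrite !fctE /=; case: (F t) (G t) => [? ?] [? ?].
  apply: is_derive_eq; rewrite -![_ *: _]/(_ * _) /=.
  by case: (d) (d') (F x) (G x) => [? ?] [? ?] [? ?] [? ?] /=; ring.
have -> : cIm \o (fun t => F t * G t) =
    (cRe \o F) * (cIm \o G) + (cIm \o F) * (cRe \o G).
  by apply/funext => t; rewrite !fctE /=; case: (F t) (G t) => [? ?] [? ?].
apply: is_derive_eq; rewrite -![_ *: _]/(_ * _) /=.
by case: (d) (d') (F x) (G x) => [? ?] [? ?] [? ?] [? ?] /=; ring.
Qed.

Lemma rderivZ c F x d : rderiv F x d -> rderiv (fun t => c * F t) x (c * d).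
Proof.
by move=> dF; have := rderivM (rderiv_cst c x) dF; rewrite mul0r add0r.
Qed.

Lemma rderiv_comp F (g : R -> R) x (l : R) d : is_derive x 1 g l ->
  rderiv F (g x) d -> rderiv (F \o g) x (d * l%:C).
Proof.
move=> dg [dr di]; split.
  have -> : cRe (d * l%:C) = cRe d * l by case: (d) => ? ? /=; ring.
  exact: (is_derive1_comp dr dg).
have -> : cIm (d * l%:C) = cIm d * l by case: (d) => ? ? /=; ring.
exact: (is_derive1_comp di dg).
Qed.

Lemma cderiv_comp (f : R[i] -> R[i]) F x d d' :
  cderiv f (F x) d -> rderiv F x d' -> rderiv (f \o F) x (d * d').
Proof.
move=> df dF.
have K e : 0 < e -> exists2 r, 0 < r & forall h, `|h| <= r ->
    normc (f (F (x + h)) - f (F x) - h%:C * (d * d')) <= e * `|h|.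
  move=> e0.
  pose M := normc d' + 1; pose D := normc d + 1.
  have M0 : 0 < M by rewrite ltr_wpDl ?normc_ge0.
  have D0 : 0 < D by rewrite ltr_wpDl ?normc_ge0.
  have [r r0 Hr] := df (e / 2 / M) (divr_gt0 (divr_gt0 e0 (@ltr0n _ 2)) M0).
  have [s s0 Hs] := rderiv_epsP dF ltr01.
  have [q q0 Hq] := rderiv_epsP dF (divr_gt0 (divr_gt0 e0 (@ltr0n _ 2)) D0).
  exists (Num.min (Num.min s q) (r / M)).
    by rewrite !lt_min s0 q0 divr_gt0.
  move=> h; rewrite !le_min => /andP[/andP[hs hq] hr].
  pose k := F (x + h) - F x.
  have nk : normc k <= M * `|h|.
have -> : k = (F (x + h) - F x - h%:C * d') + h%:C * d'.
      by rewrite /k; ring.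
    apply: le_trans (normcD_le _ _) _.
    rewrite Normc.normcM normc_real /M mulrDl addrC mul1r [_ * `|h|]mulrC lerD2l.
    by have := Hs h hs; rewrite mul1r.
  have : normc k <= r.
    by apply: le_trans nk _; rewrite mulrC -ler_pdivlMr.
  move=> /Hr; rewrite (_ : F x + k = F (x + h)); last by rewrite /k; ring.
  rewrite /k => H1.
  have H2 := Hq h hq.
  have -> : f (F (x + h)) - f (F x) - h%:C * (d * d') =
    (f (F (x + h)) - f (F x) - (F (x + h) - F x) * d) +
    (F (x + h) - F x - h%:C * d') * d by ring.
  apply: le_trans (normcD_le _ _) _.
  have -> : e * `|h| = e / 2 * `|h| + e / 2 * `|h| by field.
  apply: lerD.
    apply: le_trans H1 _.
    rewrite -[leRHS](_ : e / 2 / M * (M * `|h|) = _); last by field; rewrite gt_eqF.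
    by rewrite ler_wpM2l// !divr_ge0// ltW.
  rewrite Normc.normcM.
  have : normc d <= D by rewrite lerDl.
  move/(ler_pM (normc_ge0 _) (normc_ge0 _) H2)/le_trans; apply.
  by rewrite le_eqVlt; apply/orP; left; apply/eqP; field; rewrite gt_eqF.
split; apply: is_derive_eps => e /K[r r0 Hr]; exists r => // h /Hr; apply: le_trans.
  apply: le_trans (normc_Re _); rewrite le_eqVlt; apply/orP; left; apply/eqP.
  congr `|_| => /=.
  by case: (f (F (x + h))) (f (F x)) (d * d') => [? ?] [? ?] [? ?] /=; ring.
apply: le_trans (normc_Im _); rewrite le_eqVlt; apply/orP; left; apply/eqP.
congr `|_| => /=.
by case: (f (F (x + h))) (f (F x)) (d * d') => [? ?] [? ?] [? ?] /=; ring.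
Qed.

Lemma cderiv_inv_affine (a b z : R[i]) : a + b * z != 0 ->
  cderiv (fun w => (a + b * w)^-1) z (- b / (a + b * z) ^+ 2).
Proof.
set A := a + b * z => A0 e e0.
have nA : 0 < normc A by rewrite normc_gt0.
have nb := normc_ge0 b.
(* [r1] keeps |A + b h| above |A| / 2; [r2] then makes the quadratic remainder b^2 h^2 / (A^2 (A + b
   h)) at most e |h|. *)
pose r1 := normc A / 2 / (normc b + 1).
pose r2 := e * normc A ^+ 3 / (2 * normc b ^+ 2 + 1).
have b1 : 0 < normc b + 1 by rewrite ltr_wpDl.
have b2 : 0 < 2 * normc b ^+ 2 + 1 by rewrite ltr_wpDl// mulr_ge0// sqr_ge0.
exists (Num.min r1 r2).
  by rewrite lt_min !divr_gt0// mulr_gt0// exprn_gt0.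
move=> h; rewrite le_min => /andP[h1 h2].
have hb : normc (b * h) <= normc A / 2.
  rewrite Normc.normcM; move: h1; rewrite ler_pdivlMr// mulrC; apply: le_trans.
  by rewrite ler_wpM2r ?normc_ge0// lerDl.
have nAh : normc A / 2 <= normc (A + b * h).
  have : normc A <= normc (A + b * h) + normc (b * h).
    by rewrite -{1}[A](addrK (b * h)); exact: normcB_le.
  lra.
have Ah0 : A + b * h != 0 by rewrite -normc_gt0 (lt_le_trans _ nAh)// divr_gt0.
have -> : a + b * (z + h) = A + b * h by rewrite /A; ring.
have -> : (A + b * h)^-1 - A^-1 - h * (- b / A ^+ 2) =
    b ^+ 2 * h ^+ 2 / (A ^+ 2 * (A + b * h)) by field; rewrite ?A0 ?Ah0.
rewrite Normc.normcM Normc.normcV (Normc.normcM (b ^+ 2)) (Normc.normcM (A ^+ 2)) !normcX.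
rewrite ler_pdivrMr ?mulr_gt0 ?exprn_gt0 ?normc_gt0//.
apply: (@le_trans _ _ (e * normc h * (normc A ^+ 2 * (normc A / 2)))); last first.
  by rewrite ler_wpM2l ?mulr_ge0 ?normc_ge0 ?(ltW e0)// ler_wpM2l ?sqr_ge0.
have : normc h * (2 * normc b ^+ 2) <= e * normc A ^+ 3.
  move: h2; rewrite ler_pdivlMr//; apply: le_trans.
  by rewrite ler_wpM2l ?normc_ge0// lerDl.
move/(ler_wpM2l (normc_ge0 h)) => H.
have -> : normc b ^+ 2 * normc h ^+ 2 =
   normc h * (normc h * (2 * normc b ^+ 2)) / 2 by field.
rewrite ler_pdivrMr//; apply: le_trans H _.
by rewrite le_eqVlt; apply/orP; left; apply/eqP; field.
Qed.

Definition cis x : R[i] := cos x +i* sin x.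

Lemma normc_cis x : normc (cis x) = 1.
Proof. by rewrite /= cos2Dsin2 sqrtr1. Qed.

Lemma cis_neq0 x : cis x != 0.
Proof. by rewrite -normc_gt0 normc_cis. Qed.

Lemma cis_periodic x : cis (x + 2 * pi) = cis x.
Proof.
by rewrite /cis mulr_natl cosD2pi sinD2pi.
Qed.

Lemma rderiv_cis x : rderiv cis x ('i * cis x).
Proof.
split.
  have -> : cRe ('i * cis x) = - sin x by simpc => /=; ring.
  exact: is_derive_cos.
have -> : cIm ('i * cis x) = cos x by simpc => /=; ring.
exact: is_derive_sin.
Qed.

End CurveDerivative.

(** * Integrals over a period *)

Section CircleIntegral.
Variable R : realType.
Implicit Types (F : R -> R[i]) (x h : R) (u z d : R[i]).
Local Notation normc := (@Normc.normc R).
Local Notation cRe := (@complex.Re R).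
Local Notation cIm := (@complex.Im R).
Local Notation mu := (@lebesgue_measure R).
Local Notation circ := (`[0, 2 * pi]%classic : set R).

Lemma continuous_integrable (f : R -> R) a b : continuous f ->
  mu.-integrable `[a, b] (EFin \o f).
Proof.
move=> cf; apply: continuous_compact_integrable; first exact: segment_compact.
by apply: continuous_subspaceT.
Qed.

Lemma derive0_cst (g : R -> R) a b : a <= b ->
  (forall x, a <= x <= b -> is_derive x 1 g 0) -> g b = g a.
Proof.
move=> ab dg; have [||c _] := @MVT_segment _ g (fun=> 0) a b ab.
- by move=> x; rewrite in_itv/= => /andP[? ?]; apply: dg; rewrite !ltW.
- by apply: derivable_within_continuous => x; rewrite in_itv/= => /dg[].
by rewrite mul0r => /eqP; rewrite subr_eq0 => /eqP.
Qed.

(** The shifted integral is F(2 pi + h) - F(h) for a primitive F of f, and its derivative f(2 pi +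
    h) - f(h) in h vanishes. *)
Lemma Rintegral_periodic_shift (f : R -> R) h : continuous f ->
  (forall x, f (x + 2 * pi) = f x) -> `|h| <= 1 ->
  \int[mu]_(x in circ) f (x + h) = \int[mu]_(x in circ) f x.
Proof.
move=> cf pf h1; have pi0 := pi_gt0 R.
(* The base point -3 leaves room on the left: all arguments used lie between -1 and 2 pi + 1. *)
pose F x := \int[mu]_(t in `[(-3), x]) f t.
have dF x : -2 <= x <= 2 * pi + 2 -> is_derive x 1 F (f x).
  move=> x2; have xl : (-3 < x)%R by lra.
  have xr : x < 2 * pi + 3 by lra.
  have [d1 d2] := continuous_FTC1_closed xr (continuous_integrable (-3) (2 * pi + 3) cf) xl (cf x).
  by apply: DeriveDef; [exact: d1 | rewrite -derive1E].
have FTC k : `|k| <= 1 ->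
    \int[mu]_(x in circ) f (x + k) = F (2 * pi + k) - F k.
  rewrite ler_norml => k1; rewrite /Rintegral.
  have dG x : 0 <= x <= 2 * pi -> is_derive x 1 (F \o (fun y => y + k)) (f (x + k)).
    move=> x0; rewrite -[f _]mulr1; apply: is_derive1_comp.
      by apply: dF; lra.
    by apply: is_derive_eq; rewrite addr0.
  rewrite (@continuous_FTC2 _ _ (F \o (fun y => y + k))) /= ?add0r//.
  - by rewrite mulr_gt0.
  - apply: continuous_subspaceT => x.
    apply: (@continuous_comp _ _ _ (fun y => y + k) f); last exact: cf.
    by apply: continuousD; [exact: cvg_id | exact: cst_continuous].
  - have C x : 0 <= x <= 2 * pi -> {for x, continuous (F \o (fun y => y + k))}.
      by move=> /dG[? _]; exact/differentiable_continuous/derivable1_diffP.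
    split.
    + by move=> x; rewrite in_itv/= => /andP[? ?]; case: (dG x); rewrite ?ltW.
    + by apply: cvg_at_right_filter; apply: C; lra.
    + by apply: cvg_at_left_filter; apply: C; lra.
  - move=> x; rewrite in_itv/= => /andP[? ?]; rewrite derive1E.
    by case: (dG x); rewrite ?ltW.
transitivity (\int[mu]_(x in circ) f (x + 0)); last first.
  by apply: eq_Rintegral => x _; rewrite addr0.
rewrite !FTC ?normr0 ?ler01//.
have dD x : -1 <= x <= 1 -> is_derive x 1 (fun k => F (2 * pi + k) - F k) 0.
  move=> x1.
  have -> : 0 = f (2 * pi + x) * 1 - f x by rewrite [2 * pi + x]addrC pf mulr1 subrr.
  apply: is_deriveB; last by apply: dF; lra.
  apply: (@is_derive1_comp _ F (fun k => 2 * pi + k)).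
    by apply: dF; lra.
  by apply: is_derive_eq; rewrite add0r mulr1.
move: h1; rewrite ler_norml => h1.
have [h0|h0] := leP 0 h.
  by apply: (@derive0_cst (fun k => F (2 * pi + k) - F k)) => // x x0; apply: dD; lra.
by apply/esym/(@derive0_cst (fun k => F (2 * pi + k) - F k)) => [|x x0];
  [lra | apply: dD; lra].
Qed.

Lemma rderiv_continuous F (d : R -> R[i]) u : (forall x, rderiv F x (d x)) ->
  continuous (fun t => cRe (u * F t)).
Proof.
move=> dF x; have [? _] := rderiv_Re u (dF x).
exact/differentiable_continuous/derivable1_diffP.
Qed.

Lemma circle_integral_cst (c : R) : \int[mu]_(x in circ) c = 2 * pi * c.
Proof.
rewrite Rintegral_cst// mulrC; congr (_ * _).
transitivity (fine (2 * pi : R)%:E) => //; congr fine.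
rewrite [LHS](lebesgue_measure_itv `[0, 2 * pi])/= lte_fin mulr_gt0 ?pi_gt0//.
by rewrite -EFinB subr0.
Qed.

Lemma le_circle_integral (f : R -> R) M : continuous f ->
  (forall x, `|f x| <= M) -> `|\int[mu]_(x in circ) f x| <= 2 * pi * M.
Proof.
move=> cf fM; have pi0 := pi_gt0 R.
apply: (le_trans (le_normr_Rintegral _ _)) => //.
  exact: continuous_integrable.
rewrite -circle_integral_cst; apply: le_Rintegral => //.
- apply: continuous_integrable => x.
  by apply: (@continuous_comp _ _ _ f Num.norm); [exact: cf | exact: norm_continuous].
- by apply: continuous_integrable; exact: cst_continuous.
Qed.

End CircleIntegral.

(** * Cauchy's integral formula and Taylor series *)

Section CauchyFormula.
Variable R : realType.
Implicit Types (u z a b : R[i]) (s t h lam : R).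
Local Notation normc := (@Normc.normc R).
Local Notation cRe := (@complex.Re R).
Local Notation cIm := (@complex.Im R).
Local Notation mu := (@lebesgue_measure R).
Local Notation circ := (`[0, 2 * pi]%classic : set R).

Lemma normc_convex a b s r : normc a <= r -> normc b <= r -> 0 <= s <= 1 ->
  normc (a + s%:C * (b - a)) <= r.
Proof.
move=> ar br /andP[s0 s1].
have -> : a + s%:C * (b - a) = (1 - s)%:C * a + s%:C * b.
  by rewrite rmorphB; ring.
apply: le_trans (normcD_le _ _) _; rewrite !Normc.normcM !normc_real.
have := ler_wpM2l (normr_ge0 (1 - s)) ar; have := ler_wpM2l (normr_ge0 s) br.
by rewrite !ger0_norm ?subr_ge0//; lra.
Qed.

Lemma is_derive_addl (c x : R) : is_derive x 1 (fun y => c + y) 1.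
Proof.
have := is_deriveD (is_derive_cst c x 1) (is_derive_id x 1).
by rewrite add0r.
Qed.

(** As s decreases from 1 to 0 this contracts the unit circle to z along segments. *)
Definition chord z s t : R[i] := z + s%:C * (cis t - z).

Lemma chord_le1 z s t : normc z <= 1 -> 0 <= s <= 1 -> normc (chord z s t) <= 1.
Proof. by move=> z1 s01; apply: normc_convex => //; rewrite normc_cis. Qed.

Lemma rderiv_chord_angle z s t :
  rderiv (chord z s) t (s%:C * ('i * cis t)).
Proof.
have := rderivD (rderiv_cst z t) (rderivZ s%:C (rderivD (rderiv_cis t) (rderiv_cst (- z) t))).
by rewrite add0r addr0.
Qed.

Lemma rderiv_real (s : R) : rderiv (fun s => s%:C) s 1.
Proof. by split; [exact: is_derive_id | exact: is_derive_cst]. Qed.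

Lemma rderiv_chord_radius z s t : rderiv (fun s => chord z s t) s (cis t - z).
Proof.
have := rderivD (rderiv_cst z s) (rderivM (rderiv_real s) (rderiv_cst (cis t - z) s)).
by rewrite add0r mulr0 addr0 mul1r.
Qed.

(** With zeta = cis t this is the density in t of d zeta / (i (zeta - z)). The denominator has the
    shape [a + b * w] of [cderiv_inv_affine]. *)
Definition cauchy_kernel z t : R[i] := cis t * (- z + 1 * cis t)^-1.

Lemma cis_sub_neq0 z t : normc z < 1 -> - z + 1 * cis t != 0.
Proof.
move=> z1; rewrite mul1r addrC subr_eq0; apply: contraTneq z1 => <-.
by rewrite normc_cis ltxx.
Qed.

Lemma cauchy_kernel_chord z t : normc z < 1 ->
  cauchy_kernel z t * (cis t - z) = cis t.
Proof.
move=> z1; rewrite /cauchy_kernel -[cis t - z](_ : - z + 1 * cis t = _).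
  by rewrite mulfVK// cis_sub_neq0.
by rewrite mul1r addrC.
Qed.

Lemma rderiv_cauchy_kernel z : normc z < 1 ->
  forall t, exists d, rderiv (cauchy_kernel z) t d.
Proof.
move=> z1 t; eexists; apply: rderivM; first exact: rderiv_cis.
apply: (@cderiv_comp _ (fun w => (- z + 1 * w)^-1)); last exact: rderiv_cis.
exact: cderiv_inv_affine (cis_sub_neq0 _ z1).
Qed.

Lemma normc_cauchy_kernel z t : normc z < 1 ->
  normc (cauchy_kernel z t) <= (1 - normc z)^-1.
Proof.
move=> z1; rewrite /cauchy_kernel Normc.normcM normc_cis mul1r Normc.normcV.
rewrite lef_pV2 ?posrE ?subr_gt0 ?normc_gt0 ?cis_sub_neq0//.
have := normcB_le (- z + 1 * cis t) (- z).
by rewrite opprK addrAC addNr add0r mul1r normc_cis normcN; lra.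
Qed.

Section OnDisk.
Variables (g dg : R[i] -> R[i]) (L : R).
Hypothesis gd : forall z, normc z <= 1 -> cderiv g z (dg z).
Hypothesis gL : forall z, normc z <= 1 -> normc (dg z) <= L.

Let L0 : 0 <= L.
Proof. by apply: le_trans (normc_ge0 (dg 0)) (gL _); rewrite Normc.normc0. Qed.

Lemma disk_lipschitz a b : normc a <= 1 -> normc b <= 1 ->
  normc (g b - g a) <= L * normc (b - a).
Proof.
move=> a1 b1; apply: (@lipschitz_segment _ g a b dg) => s s01.
  by apply: gd; exact: normc_convex.
by apply: gL; exact: normc_convex.
Qed.

Let Gu u z s := \int[mu]_(t in circ) cRe (u * (cauchy_kernel z t * g (chord z s t))).

Let rderiv_g_chord z s t : normc z <= 1 -> 0 <= s <= 1 ->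
  rderiv (fun t => g (chord z s t)) t (dg (chord z s t) * (s%:C * ('i * cis t))).
Proof.
move=> z1 s01; apply: (cderiv_comp (gd (chord_le1 t z1 s01))).
exact: rderiv_chord_angle.
Qed.

Let cont_kernel u z s : normc z < 1 -> 0 <= s <= 1 ->
  continuous (fun t => cRe (u * (cauchy_kernel z t * g (chord z s t)))).
Proof.
move=> z1 s01.
have /choice[d Hd] : forall t, exists d,
    rderiv (fun t => cauchy_kernel z t * g (chord z s t)) t d.
  move=> t; have [k Hk] := rderiv_cauchy_kernel z1 t; eexists.
  exact: (rderivM Hk (rderiv_g_chord t (ltW z1) s01)).
exact: rderiv_continuous Hd.
Qed.

Let cont_angle u z s h : normc z <= 1 -> 0 <= s <= 1 ->
  continuous (fun t => cRe (u * g (chord z s (t + h)))).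
Proof.
move=> z1 s01 t.
apply: (@continuous_comp _ _ _ (fun t => t + h) (fun t => cRe (u * g (chord z s t)))).
  by apply: continuousD; [exact: cvg_id | exact: cst_continuous].
exact: (@rderiv_continuous _ (fun t => g (chord z s t)) _ u (fun t => rderiv_g_chord t z1 s01)).
Qed.

(** For the integrand, lam times its derivative in s at lam is the real part of - i u times the
    t-derivative of g(chord z lam t), whose integral over a period should vanish. As the derivative
    of g is bounded but not known to be continuous, that t-derivative is not integrated directly.
    Instead [K] adds, to lam times the integrand at radius lam + h, the term Re(u i g) with the
    angle shifted by h. The h-derivative of [K] vanishes pointwise at 0, the integral of the shifted
    term does not depend on h, and differentiation under the integral asks only for the bound
    [M]. *)
Lemma cauchy_integral_derive0 u z lam : normc z < 1 -> 0 < lam < 1 ->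
  is_derive lam 1 (Gu u z) 0.
Proof.
move=> z1 /andP[l0 l1].
pose del := Num.min lam (1 - lam).
have del0 : 0 < del by rewrite lt_min l0 subr_gt0.
have delP h : h \in `](- del), del[ -> 0 <= lam + h <= 1.
  rewrite in_itv/= => /andP[h1 h2].
  have : del <= lam by rewrite ge_min lexx.
  have : del <= 1 - lam by rewrite ge_min lexx orbT.
  lra.
have l01 : 0 <= lam <= 1 by rewrite !ltW.
pose K h t := lam * cRe (u * (cauchy_kernel z t * g (chord z (lam + h) t))) +
  cRe (u * 'i * g (chord z lam (t + h))).
pose dK h t := lam *
  cRe (u * cauchy_kernel z t * (dg (chord z (lam + h) t) * (cis t - z))) +
  cRe (u * 'i * (dg (chord z lam (t + h)) * (lam%:C * ('i * cis (t + h))))).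
have Kd h t : h \in `](- del), del[ -> is_derive h 1 (K ^~ t) (dK h t).
  move=> hd; apply: is_deriveD.
    have -> : (fun h => lam * cRe (u * (cauchy_kernel z t * g (chord z (lam + h) t)))) =
       (lam *: fun h => cRe (u * cauchy_kernel z t * g (chord z (lam + h) t))).
      by apply/funext => k; rewrite mulrA.
    apply: is_deriveZ; apply: rderiv_Re.
    have := @rderiv_comp _ (fun s => g (chord z s t)) (fun h => lam + h) h 1
      (dg (chord z (lam + h) t) * (cis t - z)).
    rewrite mulr1; apply; first exact: is_derive_addl.
    apply: (@cderiv_comp _ g (fun s => chord z s t)).
      exact: gd (chord_le1 t (ltW z1) (delP _ hd)).
    exact: rderiv_chord_radius.
  apply: rderiv_Re.
  have := @rderiv_comp _ (fun t => g (chord z lam t)) (fun h => t + h) h 1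
    (dg (chord z lam (t + h)) * (lam%:C * ('i * cis (t + h)))).
  rewrite mulr1; apply; first exact: is_derive_addl.
  exact: rderiv_g_chord (ltW z1) l01.
have KE h t : h \in `](- del), del[ -> partial1of2 K h t = dK h t.
  by move=> hd; have [_ <-] := Kd h t hd; rewrite partial1of2E.
have n'i : normc 'i = 1 by rewrite /= expr0n expr1n add0r sqrtr1.
pose M := 2 * normc u * L.
have M0 : 0 <= M by rewrite !mulr_ge0 ?normc_ge0.
have dKM h t : h \in `](- del), del[ -> `|dK h t| <= M.
  move=> hd; apply: le_trans (ler_normD _ _) _.
  have -> : M = normc u * L + normc u * L by rewrite /M; ring.
  apply: lerD.
    rewrite normrM (ger0_norm (ltW l0)).
    apply: le_trans (_ : normc u * L <= _) => //.
    apply: le_trans (ler_piMl (normr_ge0 _) (ltW l1)) _.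
    apply: le_trans (normc_Re _) _.
    rewrite -[X in normc X](_ : u * (dg (chord z (lam + h) t) *
       (cauchy_kernel z t * (cis t - z))) = _); last by ring.
    rewrite cauchy_kernel_chord// !Normc.normcM normc_cis mulr1.
    by rewrite ler_wpM2l ?normc_ge0// gL// chord_le1 ?(ltW z1)// delP.
  apply: le_trans (normc_Re _) _.
  rewrite !Normc.normcM normc_cis n'i normc_real !mulr1 (ger0_norm (ltW l0)).
  rewrite ler_wpM2l ?normc_ge0//.
  apply: le_trans (ler_piMr (normc_ge0 _) (ltW l1)) _.
  by rewrite gL// chord_le1 ?(ltW z1).
have contZ h : h \in `](- del), del[ ->
    continuous (fun t => lam * cRe (u * (cauchy_kernel z t * g (chord z (lam + h) t)))).
  move=> hd t; apply: (@continuousM _ _ (fun=> lam)); first exact: cst_continuous.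
  exact: cont_kernel z1 (delP h hd) t.
have contK h : h \in `](- del), del[ -> continuous (K h).
  move=> hd t; apply: (@continuousD _ _ _
    (fun t => lam * cRe (u * (cauchy_kernel z t * g (chord z (lam + h) t))))
    (fun t => cRe (u * 'i * g (chord z lam (t + h))))); last exact: (@cont_angle (u * 'i) z lam h (ltW z1) l01 t).
  exact: contZ.
have FE h : h \in `](- del), del[ -> \int[mu]_(t in circ) K h t =
    lam * Gu u z (lam + h) + \int[mu]_(t in circ) cRe (u * 'i * g (chord z lam t)).
  move=> hd; rewrite /K RintegralD//; last 2 first.
  - by apply: continuous_integrable; exact: contZ.
  - by apply: continuous_integrable; exact: (@cont_angle (u * 'i) z lam h (ltW z1) l01).
  rewrite RintegralZl//; last by apply: continuous_integrable; exact: cont_kernel z1 (delP h hd).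
  congr (_ + _).
  apply: (@Rintegral_periodic_shift _ (fun t => cRe (u * 'i * g (chord z lam t)))).
  - exact: (@rderiv_continuous _ (fun t => g (chord z lam t)) _ (u * 'i) (fun t => rderiv_g_chord t (ltW z1) l01)).
  - by move=> t; rewrite /chord cis_periodic.
  - move: hd; rewrite in_itv/= => /andP[h1 h2]; rewrite ler_norml.
    have : del <= lam by rewrite ge_min lexx.
    lra.
have d00 : (0 : R) \in `](- del), del[ by rewrite in_itv/= oppr_lt0 del0.
have lim0 : h^-1 *: (Gu u z (h + lam) - Gu u z lam) @[h --> (0:R)^'] --> (0 : R).
  have H := @cvg_differentiation_under_integral R _ _ mu K circ _ 0 (- del) del _ _ _
    (fun=> M) _ _ _.
  have {}H : h^-1 *: ((fun x' : R => \int[mu]_(y in circ) K x' y) (h + 0) -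
     (fun x' : R => \int[mu]_(y in circ) K x' y) 0) @[h --> 0^'] -->
     \int[mu]_(y in circ) partial1of2 K 0 y.
    apply: H => //.
    - by move=> h hd; apply: continuous_integrable; exact: contK.
    - by move=> h t hd _; have [] := Kd h t hd.
    - by apply: continuous_integrable; exact: cst_continuous.
    - by move=> h t hd _; rewrite KE// dKM.
  have I0 : \int[mu]_(y in circ) partial1of2 K 0 y = 0.
    rewrite -[RHS](mulr0 (2 * pi)) -circle_integral_cst.
    apply: eq_Rintegral => t _; rewrite KE// /dK !addr0.
    have -> : lam * cRe (u * cauchy_kernel z t * (dg (chord z lam t) * (cis t - z))) =
       cRe (lam%:C * (u * (dg (chord z lam t) * (cauchy_kernel z t * (cis t - z))))).
      rewrite [X in lam * cRe X](_ : _ = u * (dg (chord z lam t) *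
        (cauchy_kernel z t * (cis t - z)))); last by ring.
      by case: (u * _) => ? ? /=; ring.
    rewrite cauchy_kernel_chord//.
    have -> : u * 'i * (dg (chord z lam t) * (lam%:C * ('i * cis t))) =
      - (lam%:C * (u * (dg (chord z lam t) * cis t))).
      have := sqrCi R[i]; move: ('i%R : R[i]) => j j2.
      by rewrite -[RHS]mulN1r -j2; ring.
    by case: (lam%:C * _) => ? ? /=; rewrite subrr.
  rewrite I0 in H.
  have H2 : lam^-1 *: (h^-1 *: ((fun x' : R => \int[mu]_(y in circ) K x' y) (h + 0) -
     (fun x' : R => \int[mu]_(y in circ) K x' y) 0)) @[h --> (0 : R)^'] --> lam^-1 *: (0 : R).
    by apply: cvgZr => //; exact: cvg_cst.
  rewrite scaler0 in H2.
  apply: cvg_trans H2; apply: near_eq_cvg; near=> h.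
  have hd : h \in `](- del), del[.
    rewrite in_itv/= -ltr_norml; near: h; exact: dnbhs0_lt.
  rewrite /= addr0 !FE// addr0 [h + lam]addrC -![_ *: _]/(_ * _).
  have h0 : h != 0 by near: h; exact: nbhs_dnbhs_neq.
  by field; rewrite h0 gt_eqF.
have lim1 : h^-1 *: ((Gu u z \o shift lam) (h *: (1 : R^o)) - Gu u z lam)
    @[h --> (0 : R)^'] --> (0 : R).
  apply: cvg_trans lim0; apply: near_eq_cvg; near=> h.
  by rewrite /= -[_ *: 1]/(h * 1) mulr1.
apply: DeriveDef; last exact/cvg_lim.
by apply/cvg_ex; exists 0.
Unshelve. all: by end_near. Qed.

(* The circle integral of the kernel against g at the chord point
   z + s (cis t - z) does not depend on s; compare s = 1 with s = 0. *)
Lemma cauchy_integral u z : normc z < 1 ->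
  \int[mu]_(t in circ) cRe (u * (cauchy_kernel z t * g (cis t))) =
  \int[mu]_(t in circ) cRe (u * (cauchy_kernel z t * g z)).
Proof.
move=> z1; have z1' := ltW z1.
have -> : \int[mu]_(t in circ) cRe (u * (cauchy_kernel z t * g (cis t))) = Gu u z 1.
  apply: eq_Rintegral => t _; congr (cRe (u * (_ * g _))).
  by rewrite /chord mul1r addrCA subrr addr0.
have -> : \int[mu]_(t in circ) cRe (u * (cauchy_kernel z t * g z)) = Gu u z 0.
  apply: eq_Rintegral => t _; congr (cRe (u * (_ * g _))).
  by rewrite /chord mul0r addr0.
pose C := 2 * pi * (normc u * ((1 - normc z)^-1 * (L * 2))).
(* The derivative is known to vanish only for 0 < s < 1; Lipschitz dependence on s carries constancy
   to both ends. *)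
have lipG s s' : 0 <= s <= 1 -> 0 <= s' <= 1 -> `|Gu u z s - Gu u z s'| <= C * `|s - s'|.
  move=> s1 s1'; rewrite /Gu -RintegralB//; last 2 first.
  - by apply: continuous_integrable; exact: cont_kernel.
  - by apply: continuous_integrable; exact: cont_kernel.
  rewrite /C -mulrA; apply: le_circle_integral => [t|t].
    apply: (@continuousB _ _ _ (fun t => cRe (u * (cauchy_kernel z t * g (chord z s t))))
     (fun t => cRe (u * (cauchy_kernel z t * g (chord z s' t))))); exact: cont_kernel.
  have -> : cRe (u * (cauchy_kernel z t * g (chord z s t))) -
     cRe (u * (cauchy_kernel z t * g (chord z s' t))) =
     cRe (u * (cauchy_kernel z t * (g (chord z s t) - g (chord z s' t)))).
    by rewrite !mulrBr; case: (u * _) (u * _) => [? ?] [? ?].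
  apply: le_trans (normc_Re _) _.
  rewrite (Normc.normcM u) (Normc.normcM (cauchy_kernel z t)) -!mulrA.
  apply: ler_wpM2l; first exact: normc_ge0.
  apply: ler_pM; rewrite ?normc_ge0 ?normc_cauchy_kernel//.
  apply: le_trans (disk_lipschitz _ _) _; rewrite ?chord_le1//.
  apply: ler_wpM2l => //.
  have -> : chord z s t - chord z s' t = (s - s')%:C * (cis t - z).
    by rewrite /chord rmorphB; ring.
  rewrite Normc.normcM normc_real mulrC ler_wpM2r//.
  by apply: le_trans (normcB_le _ _) _; rewrite normc_cis; lra.
have C0 : 0 <= C.
  by rewrite !mulr_ge0 ?normc_ge0 ?pi_ge0// invr_ge0 subr_ge0.
apply/eqP; rewrite -subr_eq0 -normr_le0; apply/ler_addgt0Pr => e e0.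
rewrite add0r.
pose del := Num.min (1 / 2) (e / (2 * (C + 1))).
have C1 : 0 < C + 1 by lra.
have del0 : 0 < del by rewrite lt_min !divr_gt0// mulr_gt0.
have del1 : del <= 1 / 2 by rewrite ge_min lexx.
have dele : 2 * (C * del) <= e.
  have : del <= e / (2 * (C + 1)) by rewrite ge_min lexx orbT.
  rewrite ler_pdivlMr ?mulr_gt0// => H; apply: le_trans H.
  have -> : del * (2 * (C + 1)) = 2 * (C * del) + 2 * del by ring.
  by rewrite lerDl mulr_ge0// ltW.
have E : Gu u z (1 - del) = Gu u z del.
  apply: derive0_cst; first by lra.
  by move=> x x1; apply: cauchy_integral_derive0 => //; lra.
have -> : Gu u z 1 - Gu u z 0 =
  (Gu u z 1 - Gu u z (1 - del)) + (Gu u z del - Gu u z 0) by rewrite E; ring.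
apply: le_trans (ler_normD _ _) _; apply: le_trans dele.
rewrite mulr2n mulrDl mul1r; apply: lerD.
  apply: le_trans (lipG _ _ _ _) _; [lra|lra|].
  by rewrite opprB addrC subrK ger0_norm// ltW.
apply: le_trans (lipG _ _ _ _) _; [lra|lra|].
by rewrite subr0 ger0_norm// ltW.
Qed.

End OnDisk.

(** On the circle the kernel is the conjugate of 1 / (1 - conj(z) cis t). The function 1 / (1 -
    conj(z) a) of a is differentiable on the closed disk with value 1 at 0, so Cauchy's formula at
    the point 0 evaluates the integral. *)
Lemma cauchy_kernel_integral u z : normc z < 1 ->
  \int[mu]_(t in circ) cRe (u * cauchy_kernel z t) = 2 * pi * cRe u.
Proof.
move=> z1; have nz := normc_ge0 z.
pose w := conjc z.
have nw : normc w = normc z by rewrite /w; case: (z) => x y /=; rewrite sqrrN.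
have nz0 a : normc a <= 1 -> 1 - normc z <= normc (1 + (- w) * a).
  move=> a1; have := normcB_le (1 + (- w) * a) (- w * a).
  rewrite addrK Normc.normc1 Normc.normcM normcN nw.
  by have := ler_wpM2l nz a1; lra.
have neq0 a : normc a <= 1 -> 1 + (- w) * a != 0.
  by move=> /nz0 H; rewrite -normc_gt0 (lt_le_trans _ H)// subr_gt0.
have gd a : normc a <= 1 -> cderiv (fun a => (1 + (- w) * a)^-1) a
    (- - w / (1 + (- w) * a) ^+ 2).
  by move=> a1; apply: cderiv_inv_affine; exact: neq0.
have gL a : normc a <= 1 -> normc (- - w / (1 + (- w) * a) ^+ 2) <= normc z / (1 - normc z) ^+ 2.
  move=> a1; rewrite opprK Normc.normcM Normc.normcV normcX nw ler_wpM2l//.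
  have z1' : 0 < 1 - normc z by rewrite subr_gt0.
  rewrite lef_pV2 ?posrE ?exprn_gt0 ?(lt_le_trans z1')// ?nz0//.
  by apply: lerXn2r; rewrite ?nnegrE ?(ltW z1') ?normc_ge0// nz0.
have : \int[mu]_(t in circ) cRe (conjc u * (cauchy_kernel 0 t * (1 - w * cis t)^-1)) =
    \int[mu]_(t in circ) cRe (conjc u * (cauchy_kernel 0 t * (1 - w * 0)^-1)).
  rewrite -mulNr; under eq_Rintegral do rewrite -mulNr.
  by apply: (cauchy_integral gd gL); rewrite Normc.normc0.
have k0 t : cauchy_kernel 0 t = 1.
  by rewrite /cauchy_kernel oppr0 add0r mul1r divff// cis_neq0.
have -> : \int[mu]_(t in circ) cRe (conjc u * (cauchy_kernel 0 t * (1 - w * 0)^-1)) =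
    2 * pi * cRe u.
  rewrite -circle_integral_cst; apply: eq_Rintegral => t _.
  by rewrite k0 mulr0 subr0 invr1 !mulr1; case: (u).
move=> <-; apply: eq_Rintegral => t _; rewrite k0 mul1r.
have -> : cauchy_kernel z t = conjc ((1 - w * cis t)^-1).
  have -> : conjc ((1 - w * cis t)^-1) = (1 - conjc w * conjc (cis t))^-1.
    rewrite rmorphV ?unitfE; last first.
      by have := neq0 (cis t); rewrite mulNr; apply; rewrite normc_cis.
    by rewrite rmorphB rmorph1 rmorphM.
  rewrite /w conjcK conjc_inv_unit ?normc_cis// /cauchy_kernel.
  have c0 := cis_neq0 t; have z0 := @cis_sub_neq0 z t z1; rewrite mul1r in z0 *.
  have -> : 1 - z / cis t = (- z + cis t) / cis t by field.
  by rewrite invf_div.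
by case: (u) ((1 - w * cis t)^-1) => [? ?] [? ?] /=; ring.
Qed.

Definition smooth_curve (F : R -> R[i]) := forall t, exists d, rderiv F t d.

Lemma smooth_continuous u F : smooth_curve F -> continuous (fun t => cRe (u * F t)).
Proof. by move=> /choice[d Hd]; exact: rderiv_continuous Hd. Qed.

Lemma smoothM F G : smooth_curve F -> smooth_curve G ->
  smooth_curve (fun t => F t * G t).
Proof.
by move=> sF sG t; have [d Hd] := sF t; have [e He] := sG t;
  eexists; exact: rderivM Hd He.
Qed.

Lemma smoothX F n : smooth_curve F -> smooth_curve (fun t => F t ^+ n).
Proof.
move=> sF; elim: n => [|n IH].
  by move=> t; eexists; under eq_fun do rewrite expr0; exact: rderiv_cst.
by under eq_fun do rewrite exprS; exact: smoothM.
Qed.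

Lemma smooth_cst u : smooth_curve (fun=> u).
Proof. by move=> t; eexists; exact: rderiv_cst. Qed.

Lemma smooth_cisV : smooth_curve (fun t => (cis t)^-1).
Proof.
move=> t; eexists.
have -> : (fun t => (cis t)^-1) = (fun w : R[i] => (0 + 1 * w)^-1) \o @cis R.
  by apply/funext => s /=; rewrite add0r mul1r.
apply: cderiv_comp; last exact: rderiv_cis.
by apply: cderiv_inv_affine; rewrite add0r mul1r cis_neq0.
Qed.

Lemma normc_dual d : exists2 u : R[i], normc u <= 1 & cRe (u * d) = normc d.
Proof.
have [->|d0] := eqVneq d 0.
  by exists 0; rewrite ?mul0r Normc.normc0.
exists (conjc d / (normc d)%:C).
  rewrite Normc.normcM Normc.normcV normc_real ger0_norm ?normc_ge0//.
  have -> : normc (conjc d) = normc d by case: (d) => x y /=; rewrite sqrrN.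
  by rewrite divff// normc_eq0.
rewrite mulrAC [conjc d * d]mulrC mulc_conj -rmorphV ?unitfE ?normc_eq0//.
by rewrite -rmorphM /= expr2 mulfK// normc_eq0.
Qed.

(** The kernel zeta / (zeta - z) is a finite geometric sum in z / zeta plus (z / zeta)^N times the
    kernel; the last summand gives the remainder. The modulus of the remainder is reached through
    real integrals with a dual factor u. *)
Lemma cauchy_power_series (g dg : R[i] -> R[i]) (L : R) :
  (forall z, normc z <= 1 -> cderiv g z (dg z)) ->
  (forall z, normc z <= 1 -> normc (dg z) <= L) ->
  exists c : nat -> R[i], exists2 M : R, 0 <= M &
    forall z N, normc z < 1 ->
      normc (g z - \sum_(n < N) c n * z ^+ n) <= M * (1 - normc z)^-1 * normc z ^+ N.
Proof.
move=> gd gL.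
have pi2 : 2 * pi != 0 :> R by rewrite mulf_neq0 ?gt_eqF ?pi_gt0.
have sg : smooth_curve (fun t => g (cis t)).
  move=> t; eexists; apply: (@cderiv_comp _ g (@cis R)); last exact: rderiv_cis.
  by apply: gd; rewrite normc_cis.
pose e n t := g (cis t) * (cis t)^-1 ^+ n.
have se n : smooth_curve (e n) by apply: smoothM => //; apply: smoothX; exact: smooth_cisV.
pose I n u := \int[mu]_(t in circ) cRe (u * e n t).
(* Since Im x = Re(- i x), both parts of the coefficient are values of the real integral [I]. *)
pose c n : R[i] := (2 * pi)^-1%:C * (I n 1 +i* I n (- 'i%C)).
have cE n u : I n u = 2 * pi * cRe (u * c n).
  have -> : I n u = cRe u * I n 1 + - cIm u * I n (- 'i%C).
    have ci v : mu.-integrable circ (EFin \o (fun t => cRe (v * e n t))).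
      by apply: continuous_integrable; exact: smooth_continuous.
    rewrite /I -!RintegralZl// -RintegralD//.
    + apply: eq_Rintegral => t _; case: (u) (e n t) => [x y] [x' y'].
      by simpc => /=; ring.
    + rewrite (_ : _ \o _ = EFin \o (fun t => cRe ((cRe u)%:C * e n t))).
        exact: ci.
      by apply/funext => t /=; rewrite mul1r; case: (e n t) => [x y] /=; congr EFin; ring.
    + rewrite (_ : _ \o _ = EFin \o (fun t => cRe (((- cIm u)%:C * - 'i%C) * e n t))).
        exact: ci.
      apply/funext => t /=; rewrite -mulrA; congr EFin.
      by case: (- 'i%C * e n t) => [x y] /=; ring.
  have := mulfV pi2; rewrite /c; move: (I n 1) (I n _) (2 * pi) ((2 * pi)^-1).
  move=> I1 I2 P k Pk; case: (u) => [x y] /=.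
  by rewrite -[LHS]mul1r -Pk; ring.
have sker z : normc z < 1 -> smooth_curve (cauchy_kernel z).
  by move=> z1; exact: rderiv_cauchy_kernel.
(* [J 0] is the whole Cauchy integral and [J N] what remains of it after N Taylor terms. *)
pose J N u z := \int[mu]_(t in circ)
   cRe (u * ((z / cis t) ^+ N * (cauchy_kernel z t * g (cis t)))).
have szc z N : smooth_curve (fun t => (z / cis t) ^+ N).
  by apply: smoothX; apply: smoothM; [exact: smooth_cst | exact: smooth_cisV].
have JE N u z : normc z < 1 ->
    J 0%N u z = 2 * pi * cRe (u * \sum_(n < N) c n * z ^+ n) + J N u z.
  move=> z1; elim: N => [|N IH].
    by rewrite big_ord0 mulr0 /= mulr0 add0r.
  rewrite IH big_ord_recr /=; set S := \sum_(n < N) _.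
  rewrite (_ : u * (S + c N * z ^+ N) = u * S + u * z ^+ N * c N); last by ring.
  have -> : cRe (u * S + u * z ^+ N * c N) = cRe (u * S) + cRe (u * z ^+ N * c N).
    by case: (u * S) (u * _ * _) => [? ?] [? ?].
  rewrite (mulrDr (2 * pi)) -(cE N) -addrA; congr (_ + _).
  rewrite /J /I -RintegralD//; last 2 first.
  - by apply: continuous_integrable; exact: smooth_continuous.
  - apply: continuous_integrable; apply: smooth_continuous.
    by apply: smoothM => //; apply: smoothM => //; exact: sker.
  apply: eq_Rintegral => t _.
  set X := u * z ^+ N * e N t; set Y := u * _; set Z := u * _.
  have -> : Y = X + Z.
    rewrite /Y /X /Z /e exprS expr_div_n -exprVn /cauchy_kernel.
    have c0 := cis_neq0 t; have z0 := @cis_sub_neq0 z t z1; rewrite mul1r in z0 *.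
    rewrite exprVn; field; rewrite z0 c0 /=.
    by rewrite expf_neq0.
  by case: (X) (Z) => [? ?] [? ?].
exists c.
pose M := normc (g 0) + L.
have L0 : 0 <= L by apply: le_trans (normc_ge0 (dg 0)) (gL _ _); rewrite Normc.normc0.
have M0 : 0 <= M by rewrite addr_ge0 ?normc_ge0.
exists M => // z N z1.
have gM t : normc (g (cis t)) <= M.
  rewrite -[g (cis t)](subrK (g 0)) addrC; apply: le_trans (normcD_le _ _) _.
  rewrite lerD2l; apply: le_trans (disk_lipschitz gd gL _ _) _.
  - by rewrite Normc.normc0.
  - by rewrite normc_cis.
  - by rewrite subr0 normc_cis mulr1.
have [u u1 <-] := normc_dual (g z - \sum_(n < N) c n * z ^+ n).
have H0 : J 0%N u z = 2 * pi * cRe (u * g z).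
  rewrite -(@cauchy_kernel_integral (u * g z) z z1).
  transitivity (\int[mu]_(t in circ) cRe (u * (cauchy_kernel z t * g z))).
    rewrite -(cauchy_integral gd gL)//; apply: eq_Rintegral => t _.
    by rewrite expr0 mul1r.
  by apply: eq_Rintegral => t _; rewrite -mulrA [g z * _]mulrC.
have -> : cRe (u * (g z - \sum_(n < N) c n * z ^+ n)) = (2 * pi)^-1 * J N u z.
  rewrite mulrBr.
  have -> : cRe (u * g z - u * \sum_(n < N) c n * z ^+ n) =
     cRe (u * g z) - cRe (u * \sum_(n < N) c n * z ^+ n).
    by case: (u * _) (u * _) => [? ?] [? ?].
  have := JE N u z z1; rewrite H0; move: (J N u z) => j E.
  apply: (mulfI pi2); rewrite mulrA divff// mul1r mulrBr E; ring.
have zpos : 0 < 1 - normc z by rewrite subr_gt0.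
apply: le_trans (ler_norm _) _; rewrite normrM ger0_norm ?invr_ge0 ?mulr_ge0 ?pi_ge0//.
rewrite mulrC ler_pdivrMr ?mulr_gt0 ?pi_gt0// [leRHS]mulrC.
apply: le_circle_integral => [|t].
  by apply: smooth_continuous; apply: smoothM => //; apply: smoothM => //; exact: sker.
apply: le_trans (normc_Re _) _.
rewrite (Normc.normcM u) (Normc.normcM (_ ^+ N)) (Normc.normcM (cauchy_kernel z t)).
rewrite normcX (Normc.normcM z) Normc.normcV normc_cis invr1 mulr1.
apply: le_trans (ler_piMl _ u1) _; first by rewrite !mulr_ge0 ?exprn_ge0 ?normc_ge0.
rewrite [leLHS]mulrC; apply: ler_wpM2r; first by rewrite exprn_ge0 ?normc_ge0.
by rewrite mulrC; apply: ler_pM; rewrite ?normc_ge0// normc_cauchy_kernel.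
Qed.

End CauchyFormula.

(** * The weighted coefficient sum and its uniform gap below 1 *)

Section CoefficientSum.
Variable R : realType.
Implicit Types (a b s t : R).

Lemma le_increment (f g df dg : R -> R) a b : a <= b ->
  (forall t, a <= t <= b -> is_derive t 1 f (df t)) ->
  (forall t, a <= t <= b -> is_derive t 1 g (dg t)) ->
  (forall t, a < t < b -> df t <= dg t) -> f b - f a <= g b - g a.
Proof.
rewrite le_eqVlt => /orP[/eqP -> *|ab fd gd le]; first by rewrite !subrr.
have d t : a <= t <= b -> is_derive t 1 (f - g) (df t - dg t).
  by move=> tab; apply: is_deriveB; [exact: fd | exact: gd].
have [||c] := @MVT _ (f - g) (fun t => df t - dg t) a b ab.
- by move=> x; rewrite in_itv/= => /andP[? ?]; apply: d; rewrite !ltW.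
- by apply: derivable_within_continuous => x; rewrite in_itv/= => /d[].
rewrite in_itv/= !fctE => cab E.
have : (df c - dg c) * (b - a) <= 0.
  by rewrite mulr_le0_ge0 ?subr_le0 ?le// subr_ge0 ltW.
by rewrite -E; lra.
Qed.

Lemma is_derive_sum_fun n (h dh : 'I_n -> R -> R) t :
  (forall i, is_derive t 1 (h i) (dh i t)) ->
  is_derive t 1 (fun t => \sum_(i < n) h i t) (\sum_(i < n) dh i t).
Proof.
move=> H; have -> : (fun t => \sum_(i < n) h i t) = \sum_(i < n) h i.
  by apply/funext => s; rewrite fct_sumE.
exact: is_derive_sum.
Qed.

Lemma is_derive_monomial n t : is_derive t 1 (fun s => s ^+ n.+1) (n.+1%:R * t ^+ n).
Proof.
have -> : (fun s => s ^+ n.+1) = (id : R -> R) ^+ n.+1.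
  by apply/funext => s; rewrite exprfctE.
by apply: is_derive_eq; rewrite -[_ *: _]/(_ * _) mulr1.
Qed.

Lemma is_derive_scale (f : R -> R) (c t df : R) :
  is_derive t 1 f df -> is_derive t 1 (fun s => c * f s) (c * df).
Proof. by move=> fd; exact: (is_deriveZ c fd). Qed.

(* Equality would need b0^2 = 1 and b1^2 = 2. Either b0^2 <= 15/16, or b0 is
   close to 1 and then the mixed inequality forces b1 <= 9/10. *)
Lemma gap_numeric (b0 b1 T S : R) : 0 <= b0 -> 0 <= b1 ->
  2 * b0 ^+ 2 + 1 / 2 * (b0 * b1) + b1 ^+ 2 / 16 <= 2 * (16 / 15) ^+ 2 ->
  0 <= T -> b0 ^+ 2 + b1 ^+ 2 * (1 / 2) + T <= 4 ->
  b0 ^+ 2 + b1 ^+ 2 * (1 / 64 * (1 / 64)) <= (64 / 63 * (64 / 65)) ^+ 2 ->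
  S <= 1 / 64 * (1 / 48 * (1 / 64) * T) ->
  b0 ^+ 2 * (1 / 64) + 2 * (b1 ^+ 2 / 4) * (1 / 64) ^+ 2 + S <=
    64 / 63 - 1 - 1 / 64 * (1 / 128).
Proof.
move=> b00 b10 toep T0 H2 H3 HS.
have u0 := sqr_ge0 b0; have v0 := sqr_ge0 b1.
have [small|big] := leP (b0 ^+ 2) (15 / 16).
  move: (b0 ^+ 2) (b1 ^+ 2) u0 v0 H2 small HS T0 => u v u0 v0 H2 small HS T0.
  clear -u0 v0 H2 small HS T0; lra.
have b0l : 15 / 16 <= b0.
  rewrite leNgt; apply/negP => H.
  have n : 0 <= 15 / 16 :> R by clear; lra.
  have : b0 ^+ 2 <= (15 / 16) ^+ 2 by apply: lerXn2r; rewrite ?nnegrE ?n ?b00// ltW.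
  by clear -big; lra.
have n9 : 0 <= 9 / 10 :> R by clear; lra.
have n15 : 0 <= 15 / 16 :> R by clear; lra.
have b1s : b1 ^+ 2 <= (9 / 10) ^+ 2.
  apply: lerXn2r; rewrite ?nnegrE ?n9 ?b10// leNgt; apply/negP => H.
  have w : 15 / 16 * (9 / 10) <= b0 * b1 by exact: ler_pM n15 n9 b0l (ltW H).
  have v : (9 / 10) ^+ 2 <= b1 ^+ 2.
    by apply: lerXn2r; rewrite ?nnegrE ?n9 ?b10// ltW.
  move: (b0 ^+ 2) (b0 * b1) (b1 ^+ 2) toep w v big => u' w' v' toep w v big.
  by clear -toep w v big; lra.
move: (b0 ^+ 2) (b1 ^+ 2) u0 v0 H2 H3 b1s HS T0 => u v u0 v0 H2 H3 b1s HS T0.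
by clear -u0 v0 H2 H3 b1s HS T0; lra.
Qed.

Section Estimate.
(* For a function with Bloch seminorm 1 and Taylor coefficients c_k, y k stands
   for |c_(k+1)|^2, b0 for |c_1| and b1 for 2|c_2|; [bessel] is Parseval's
   inequality for the derivative on the circle of radius sqrt t, and [toeplitz]
   is [bessel_circle_mul] on the circle of radius 1/4. *)
Variables (m : nat) (y : nat -> R) (b0 b1 : R).
Hypothesis m2 : (1 < m)%N.
Hypothesis y0 : forall k, 0 <= y k.
Hypothesis b0_ge0 : 0 <= b0.
Hypothesis b1_ge0 : 0 <= b1.
Hypothesis b0E : b0 ^+ 2 = y 0%N.
Hypothesis b1E : b1 ^+ 2 = 4 * y 1%N.
Hypothesis bessel : forall t, 0 < t < 1 ->
  \sum_(k < m) k.+1%:R ^+ 2 * y k * t ^+ k <= (1 - t) ^- 2.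
Hypothesis toeplitz : 2 * b0 ^+ 2 + 1 / 2 * (b0 * b1) + b1 ^+ 2 / 16 <= 2 * (16 / 15) ^+ 2.

(** [dP] is the Bessel sum and [P] its primitive vanishing at 0; integrating [bessel] gives P(t) <=
    t / (1 - t). *)
Let P t := \sum_(k < m) k.+1%:R * y k * t ^+ k.+1.
Let dP t := \sum_(k < m) k.+1%:R ^+ 2 * y k * t ^+ k.

Let P_derive t : is_derive t 1 P (dP t).
Proof.
apply: (@is_derive_sum_fun m (fun k t => k.+1%:R * y k * t ^+ k.+1)
  (fun k t => k.+1%:R ^+ 2 * y k * t ^+ k)) => k.
have -> : k.+1%:R ^+ 2 * y k * t ^+ k = k.+1%:R * y k * (k.+1%:R * t ^+ k) by ring.
by apply: is_derive_scale; exact: is_derive_monomial.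
Qed.

Let geom_derive t : t < 1 -> is_derive t 1 (fun s => (1 - s)^-1) ((1 - t) ^- 2).
Proof.
move=> t1; have n0 : 1 - t != 0 by rewrite gt_eqF// subr_gt0.
have d : is_derive t 1 (fun s => 1 - s) (- 1).
  have := is_deriveB (is_derive_cst (1 : R) t 1) (is_derive_id t 1).
  by rewrite sub0r.
by have := @is_deriveV _ (fun s => 1 - s) _ _ _ n0 d; rewrite scaleNr scalerN opprK -[_ *: _]/(_ * _) mulr1.
Qed.

Let P0 : P 0 = 0.
Proof. by rewrite /P big1// => k _; rewrite expr0n /= mulr0. Qed.

Let P_increment a b : 0 <= a -> a <= b -> b < 1 ->
  P b - P a <= (1 - b)^-1 - (1 - a)^-1.
Proof.
move=> a0 ab b1'; apply: (@le_increment P (fun s => (1 - s)^-1) dP (fun t => (1 - t) ^- 2)) => //.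
- by move=> t /andP[_ tb]; apply: geom_derive; apply: le_lt_trans b1'.
- by move=> t /andP[ta tb]; apply: bessel; rewrite (le_lt_trans a0 ta) (lt_trans tb).
Qed.

Let P_split t : P t = y 0%N * t + 2 * y 1%N * t ^+ 2 +
  \sum_(k < m | (1 < k)%N) k.+1%:R * y k * t ^+ k.+1.
Proof.
rewrite /P; case: (m) m2 => [//|[//|M]] _.
rewrite [LHS](bigID (fun k : 'I_M.+2 => (1 < k)%N)) /= addrC; congr (_ + _).
rewrite big_mkcond 2!big_ord_recl /= big1 ?addr0.
  by rewrite mul1r expr1.
by move=> i _; rewrite /bump.
Qed.

Let dP_split t : dP t = b0 ^+ 2 + b1 ^+ 2 * t +
  \sum_(k < m | (1 < k)%N) k.+1%:R ^+ 2 * y k * t ^+ k.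
Proof.
rewrite /dP; case: (m) m2 => [//|[//|M]] _.
rewrite [LHS](bigID (fun k : 'I_M.+2 => (1 < k)%N)) /= addrC; congr (_ + _).
rewrite big_mkcond 2!big_ord_recl /= big1 ?addr0.
  by rewrite b0E b1E (_ : bump 0 0 = 1%N)// expr1 expr0 expr1n; ring.
by move=> i _; rewrite /bump.
Qed.

Let tail_ge0 t : 0 <= t -> 0 <= \sum_(k < m | (1 < k)%N) k.+1%:R ^+ 2 * y k * t ^+ k.
Proof.
by move=> t0; apply: sumr_ge0 => k _; rewrite !mulr_ge0 ?sqr_ge0 ?exprn_ge0.
Qed.

(** Without the last term this is the integrated Bessel inequality. The gain combines Bessel at t =
    1/2, which controls the terms with k >= 2, Bessel at t = 1/64^2, which keeps b0^2 barely above 1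
    at most, and [toeplitz], which prevents b0 and b1 from both being large. At t = 1/64 the linear
    term of P dominates. *)
Let P_gap : P (1 / 64) <= (1 - 1 / 64)^-1 - 1 - 1 / 64 * (1 / 128).
Proof.
have h2 : 0 < (1 / 2 : R) < 1 by lra.
have := bessel h2; rewrite -/(dP _) dP_split => H2.
have : b0 ^+ 2 + b1 ^+ 2 * (1 / 64 * (1 / 64)) <= (1 - 1 / 64 * (1 / 64)) ^- 2.
  have h : 0 < (1 / 64 * (1 / 64) : R) < 1 by lra.
  apply: le_trans (bessel h); rewrite -/(dP _) dP_split lerDl; apply: tail_ge0; lra.
have -> : (1 - 1 / 64 * (1 / 64)) ^- 2 = (64 / 63 * (64 / 65)) ^+ 2 :> R by field.
move=> H3.
pose T := \sum_(k < m | (1 < k)%N) k.+1%:R ^+ 2 * y k * (1 / 2) ^+ k.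
have T0 : 0 <= T by apply: tail_ge0; lra.
(* For k >= 2 write (1/64)^k as (1/2)^k (1/32)^k, bound (1/32)^k by (1/32)^2, and use k + 1 <= (k +
   1)^2 / 3; the constant is 1/48 * 1/64 = 1/3 * (1/32)^2. *)
have tail : \sum_(k < m | (1 < k)%N) k.+1%:R * y k * (1 / 64) ^+ k.+1 <=
    1 / 64 * (1 / 48 * (1 / 64) * T).
  rewrite /T !mulr_sumr; apply: ler_sum => k k1.
  have -> : k.+1%:R * y k * (1 / 64) ^+ k.+1 =
     1 / 64 * (y k * (1 / 2) ^+ k * k.+1%:R * (1 / 32) ^+ k) :> R.
    rewrite exprS (_ : 1 / 64 = 1 / 2 * (1 / 32)) ?exprMn; last by field.
    ring.
  apply: ler_wpM2l; first by lra.
  have -> : 1 / 48 * (1 / 64) * (k.+1%:R ^+ 2 * y k * (1 / 2) ^+ k) =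
     y k * (1 / 2) ^+ k * k.+1%:R * (k.+1%:R / 3 * (1 / 32) ^+ 2) by field.
  apply: ler_wpM2l; first by rewrite !mulr_ge0 ?exprn_ge0// divr_ge0.
  have k3 : 1 <= k.+1%:R / 3 :> R by rewrite ler_pdivlMr// mul1r ler_nat.
  apply: le_trans (ler_peMl (exprn_ge0 2 _) k3); last by lra.
  by apply: ler_wiXn2l => //; lra.
rewrite P_split.
have E2 : (1 - 1 / 2) ^- 2 = 4 :> R by field.
rewrite E2 in H2.
have E64 : (1 - 1 / 64)^-1 = 64 / 63 :> R by field.
rewrite E64; move: tail; set S := \sum_(k < m | _) _ => tail.
rewrite -/T in H2.
have y1E : y 1%N = b1 ^+ 2 / 4 by rewrite b1E; field.
rewrite -b0E y1E.
exact: gap_numeric b0_ge0 b1_ge0 toeplitz T0 H2 H3 tail.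
Qed.

(** The integral of (k + 1) t^k (1 - t) over [0, 1] is 1 / (k + 2), so the sum is the integral of (1
    - t) P(t) / t, an integrand at most 1 with primitive [Z]. Beyond 1/64 the gap lowers the
    integrand by 1/64 * 1/128 * (1 - t), which saves more than 1/128 * 1/256 in total. *)
Lemma coefficient_sum_le : \sum_(k < m) y k / k.+2%:R <= 1 - 1 / 128 * (1 / 256).
Proof.
pose z (k : nat) t := y k * (t ^+ k.+1 - k.+1%:R / k.+2%:R * t ^+ k.+2).
pose Z t := \sum_(k < m) z k t.
pose dZ t := \sum_(k < m) k.+1%:R * y k * t ^+ k * (1 - t).
have Z_derive t : is_derive t 1 Z (dZ t).
  apply: (@is_derive_sum_fun m (fun k t => z k t)
    (fun k t => k.+1%:R * y k * t ^+ k * (1 - t))) => k.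
  have -> : k.+1%:R * y k * t ^+ k * (1 - t) =
      y k * (k.+1%:R * t ^+ k - k.+1%:R / k.+2%:R * (k.+2%:R * t ^+ k.+1)).
    by rewrite exprS; field; rewrite -natrD pnatr_eq0.
  apply: is_derive_scale; apply: is_deriveB; first exact: is_derive_monomial.
  by apply: is_derive_scale; exact: is_derive_monomial.
have dZE t : 0 < t -> dZ t = (1 - t) * P t / t.
  move=> t0; rewrite /dZ /P mulr_sumr mulr_suml; apply: eq_bigr => k _.
  by rewrite exprS; field; rewrite gt_eqF.
have PA t : 0 < t < 1 -> (1 - t) * P t <= t.
  move=> /andP[t0 t1]; have := P_increment (lexx 0) (ltW t0) t1.
  rewrite P0 subr0 => H; have t1' : 0 < 1 - t by rewrite subr_gt0.
  rewrite mulrC -ler_pdivlMr//; apply: le_trans H _.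
  by rewrite le_eqVlt; apply/orP; left; apply/eqP; field; rewrite gt_eqF.
(* The defect at 1/64 persists, because from there on P increases by no more than 1 / (1 - t)
   does. *)
have PB t : 1 / 64 <= t < 1 -> (1 - t) * P t <= t - 1 / 64 * (1 / 128) * (1 - t).
  move=> /andP[t0 t1].
  have h64 : 0 <= 1 / 64 :> R by lra.
  have := P_increment h64 t0 t1.
  have := P_gap => G H; have t1' : 0 < 1 - t by rewrite subr_gt0.
  have {G}H : P t <= (1 - t)^-1 - 1 - 1 / 64 * (1 / 128) by lra.
  apply: le_trans (ler_wpM2l (ltW t1') H) _.
  by rewrite le_eqVlt; apply/orP; left; apply/eqP; field; rewrite gt_eqF.
have Z0 : Z 0 = 0.
  by rewrite /Z big1// => k _; rewrite /z !expr0n /= mulr0 subrr mulr0.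
have Z1 : Z 1 = \sum_(k < m) y k / k.+2%:R.
  apply: eq_bigr => k _; rewrite /z !expr1n.
  by field; rewrite -natrD pnatr_eq0.
have I1 : Z (1 / 64) - Z 0 <= 1 / 64 - 0.
  apply: (@le_increment Z id dZ (fun=> 1)); first by lra.
  move=> t t0; rewrite dZE; last by lra.
  by rewrite ler_pdivrMr ?mul1r ?PA//; lra.
have I2 : Z 1 - Z (1 / 64) <= (1 - 1 / 64 * (1 / 128) * (1 - 1 ^+ 2 / 2)) -
   (1 / 64 - 1 / 64 * (1 / 128) * (1 / 64 - (1 / 64) ^+ 2 / 2)).
  apply: (@le_increment Z (fun t => t - 1 / 64 * (1 / 128) * (t - t ^+ 2 / 2)) dZ
    (fun t => 1 - 1 / 64 * (1 / 128) * (1 - t))); first by lra.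
  - move=> t _; apply: is_derive_eq.
    by rewrite -![_ *: _]/(_ * _) /=; field.
  - move=> t t0; have t0' : 0 < t by lra.
    rewrite (dZE t t0') (ler_pdivrMr _ _ t0'); apply: le_trans (PB t _) _; first by lra.
    have : 0 <= 1 / 64 * (1 / 128) * ((1 - t) * (1 - t)).
      by rewrite mulr_ge0 ?mulr_ge0 ?subr_ge0//; lra.
    lra.
rewrite -Z1; lra.
Qed.

End Estimate.
End CoefficientSum.

(** * From the Bloch bound to inequalities for Taylor coefficients *)

Section BlochCoefficients.
Variable R : realType.
Local Notation normc := (@Normc.normc R).

Lemma exists_expr_le (r e : R) (m : nat) : 0 <= r < 1 -> 0 < e ->
  exists2 N, (m <= N)%N & r ^+ N <= e.
Proof.
move=> /andP[r0 r1] e0.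
have := @cvg_expr R r; rewrite ger0_norm// => /(_ r1).
move/cvgrPdist_le => /(_ e e0) [N _ HN].
exists (maxn m N); first exact: leq_maxl.
by have := HN (maxn m N) (leq_maxr _ _); rewrite /= sub0r normrN normrX ger0_norm.
Qed.

(** The quotient of the conjugates 1 + it and 1 - it has modulus 1 and differs from 1 by 2it / (1 -
    it). *)
Lemma exists_unit_near1 (e : R) : 0 < e ->
  exists q : R[i], [/\ normc q = 1, q != 1 & normc (q - 1) <= e].
Proof.
move=> e0; pose t := e / 2; have t0 : 0 < t by rewrite divr_gt0.
pose a : R[i] := 1 +i* t; pose b : R[i] := 1 -i* t.
have ab : normc a = normc b by rewrite /a /b /= sqrrN.
have b1 : 1 <= normc b.
  by apply: le_trans (normc_Re b); rewrite /= normr1.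
have b0 : b != 0 by rewrite -normc_gt0 (lt_le_trans ltr01).
have qE : a / b - 1 = (0 +i* (2 * t)) / b.
  have -> : (0 +i* (2 * t)) = a - b by rewrite /a /b; simpc; congr (_ +i* _); ring.
  by rewrite mulrBl divff.
exists (a / b); split.
- by rewrite Normc.normcM Normc.normcV ab divff// normc_eq0.
- rewrite -subr_eq0 qE mulf_neq0 ?invr_eq0// eq_complex /= eqxx /=.
  by rewrite gt_eqF// mulr_gt0.
- rewrite qE Normc.normcM Normc.normcV ler_pdivrMr ?(lt_le_trans ltr01)//.
  rewrite [X in X <= _](_ : _ = 2 * t); last first.
    by rewrite /= expr0n add0r sqrtr_sqr ger0_norm// mulr_ge0// ltW.
  by rewrite /t mulrCA divff// mulr1 ler_peMr// ltW.
Qed.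

Lemma le_of_sqr_approx (A S : R) : 0 <= S ->
  (forall e, 0 < e -> A <= (S + e) ^+ 2) -> A <= S ^+ 2.
Proof.
move=> S0 H; have [A0|A0] := leP A 0; first by apply: le_trans A0 (sqr_ge0 _).
have : Num.sqrt A <= S.
  apply/ler_addgt0Pr => e e0.
  rewrite -[S + e]ger0_norm ?addr_ge0 ?(ltW e0)// -sqrtr_sqr ler_wsqrtr// H//.
by move=> h; rewrite -[A]sqr_sqrtr ?(ltW A0)// lerXn2r ?nnegrE ?sqrtr_ge0.
Qed.

Lemma le_of_scaled (A B : R) : 0 <= A ->
  (forall s, 0 < s < 1 -> (1 - s) ^+ 2 * A <= B) -> A <= B.
Proof.
move=> A0 H; apply/ler_addgt0Pr => e e0.
pose s := Num.min (1 / 2) (e / (2 * (A + 1))).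
have A1 : 0 < A + 1 by lra.
have s0 : 0 < s by rewrite lt_min !divr_gt0// mulr_gt0.
have s1 : s <= 1 / 2 by rewrite ge_min lexx.
have : s <= e / (2 * (A + 1)) by rewrite ge_min lexx orbT.
rewrite ler_pdivlMr ?mulr_gt0// => se.
have H1 : (1 - s) ^+ 2 * A <= B by apply: H; lra.
have : 0 <= s ^+ 2 * A by rewrite mulr_ge0// sqr_ge0.
lra.
Qed.

(** The q-integer (q^n - 1) / (q - 1), in a form that also makes sense at q = 1, where it equals
    n. *)
Definition qint (q : R[i]) n : R[i] := \sum_(j < n) q ^+ j.

Lemma qint_near q n : normc q = 1 -> n%:R - n%:R ^+ 2 * normc (q - 1) <= normc (qint q n).
Proof.
move=> q1.
have H j : normc (q ^+ j - 1) <= j%:R * normc (q - 1).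
  elim: j => [|j IH]; first by rewrite expr0 subrr Normc.normc0 mul0r.
  have -> : q ^+ j.+1 - 1 = q * (q ^+ j - 1) + (q - 1) by rewrite exprS; ring.
  apply: le_trans (normcD_le _ _) _; rewrite Normc.normcM q1 mul1r.
  by rewrite -natr1 mulrDl mul1r lerD2r.
have : normc (n%:R - qint q n) <= n%:R ^+ 2 * normc (q - 1).
  have -> : n%:R - qint q n = - \sum_(j < n) (q ^+ j - 1).
    by rewrite sumrB sumr_const card_ord opprB.
  rewrite normcN; apply: le_trans (normc_sum _ _) _.
  apply: (@le_trans _ _ (\sum_(j < n) n%:R * normc (q - 1))).
    apply: ler_sum => j _; apply: le_trans (H j) _.
    by rewrite ler_wpM2r ?normc_ge0// ler_nat ltnW.
  by rewrite sumr_const card_ord -[X in X <= _]mulr_natl expr2 mulrA.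
have : normc n%:R = n%:R.
  by rewrite -(rmorph_nat (real_complex R)) normc_real ger0_norm.
have := normcD_le (n%:R - qint q n) (qint q n); rewrite subrK.
lra.
Qed.

Section OnDisk.
Variables (g dg : R[i] -> R[i]) (c : nat -> R[i]) (M rho : R).
Hypothesis gd : forall z, normc z <= 1 -> cderiv g z (dg z).
Hypothesis M0 : 0 <= M.
Hypothesis rho0 : 0 < rho.
Hypothesis bl : forall z, normc z < 1 -> normc (dg z) * (1 - normc z ^+ 2) <= rho.
Hypothesis ps : forall z N, normc z < 1 ->
  normc (g z - \sum_(n < N) c n * z ^+ n) <= M * (1 - normc z)^-1 * normc z ^+ N.

(** The Bloch bound for |a g'(a)| on the circle |a| = r. *)
Let S r := rho * r / (1 - r ^+ 2).

(* The quotient (g (q a) - g a) / (q - 1) replaces a g'(a): its coefficients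
   c n * qint q n tend to n c n as q -> 1, and no power series of g' is needed. *)
Let truncated_bound r q e m : 0 < r < 1 -> normc q = 1 -> q != 1 -> 0 < e ->
  exists2 N, (m <= N)%N & forall x : R[i], normc x = 1 ->
    normc (\sum_(n < N) c n * r%:C ^+ n * qint q n * x ^+ n) <= S r + e.
Proof.
move=> /andP[r0 r1] q1 qn1 e0.
have r2 : 0 < 1 - r ^+ 2 by rewrite subr_gt0 expr_lt1// ltW.
have qp : 0 < normc (q - 1) by rewrite normc_gt0 subr_eq0.
have r1' : 0 < 1 - r by rewrite subr_gt0.
pose K := M * (1 - r)^-1.
have K0 : 0 <= K by rewrite mulr_ge0// invr_ge0 ltW.
have K1 : 0 < 2 * K + 1 by rewrite ltr_wpDl// mulr_ge0.
(* Both truncation errors are divided by |q - 1| in the end, so N is chosen after q. *)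
have [||N mN HN] := @exists_expr_le r (e * normc (q - 1) / (2 * K + 1)) m.
- by rewrite (ltW r0).
- by rewrite divr_gt0// mulr_gt0.
exists N => // x x1.
have nr : normc r%:C = r by rewrite normc_real gtr0_norm.
pose a := r%:C * x; pose b := q * a.
have na : normc a = r by rewrite Normc.normcM x1 mulr1.
have nb : normc b = r by rewrite Normc.normcM q1 mul1r.
rewrite -(@ler_pM2l _ (normc (q - 1)))// -Normc.normcM.
have -> : (q - 1) * (\sum_(n < N) c n * r%:C ^+ n * qint q n * x ^+ n) =
   (g b - g a) - (g b - \sum_(n < N) c n * b ^+ n) + (g a - \sum_(n < N) c n * a ^+ n).
  have -> : (q - 1) * (\sum_(n < N) c n * r%:C ^+ n * qint q n * x ^+ n) =
      \sum_(n < N) c n * b ^+ n - \sum_(n < N) c n * a ^+ n.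
    rewrite mulr_sumr -sumrB; apply: eq_bigr => n _.
    rewrite /b /a !exprMn.
    have := subrX1 q n; rewrite -/(qint q n) => E.
    have -> : (q - 1) * (c n * r%:C ^+ n * qint q n * x ^+ n) =
       ((q - 1) * qint q n) * (c n * r%:C ^+ n * x ^+ n) by ring.
    by rewrite -E; ring.
  by ring.
apply: le_trans (normcD_le _ _) _.
have Ha : normc (g a - \sum_(n < N) c n * a ^+ n) <= K * r ^+ N.
  by have := @ps a N; rewrite na; apply.
have Hb : normc (g b - \sum_(n < N) c n * b ^+ n) <= K * r ^+ N.
  by have := @ps b N; rewrite nb; apply.
have Hab : normc (g b - g a) <= rho / (1 - r ^+ 2) * normc (b - a).
  have conv s : 0 <= s <= 1 -> normc (a + s%:C * (b - a)) <= r.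
    by apply: normc_convex; rewrite ?na ?nb.
  apply: (@lipschitz_segment _ g a b dg) => s /conv sr.
    by apply: gd; exact: le_trans sr (ltW r1).
  rewrite ler_pdivlMr//; apply: le_trans (bl (le_lt_trans sr r1)).
  rewrite ler_wpM2l ?normc_ge0// lerD2l lerN2 lerXn2r ?nnegrE ?normc_ge0//.
  exact: ltW.
have ba : normc (b - a) = normc (q - 1) * r.
  by rewrite -na -Normc.normcM /b mulrBl mul1r.
have := normcB_le (g b - g a) (g b - \sum_(n < N) c n * b ^+ n).
move: HN; rewrite ler_pdivlMr// => HN.
rewrite ba in Hab.
have rN : 0 <= r ^+ N by rewrite exprn_ge0// ltW.
have -> : normc (q - 1) * (S r + e) =
    rho / (1 - r ^+ 2) * (normc (q - 1) * r) + e * normc (q - 1).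
  by rewrite /S; ring.
have : r ^+ N * (2 * K + 1) = 2 * (K * r ^+ N) + r ^+ N by ring.
move: (K * r ^+ N) Ha Hb HN rN => KN; move: (rho / _ * _) Hab => RR.
move=> Hab Ha Hb HN rN HE H; apply: le_trans (lerD H Ha) _.
apply: le_trans (lerD (lerD Hab Hb) (lexx KN)) _.
rewrite -addrA lerD2l; apply: le_trans HN.
by rewrite HE (mulr_natl KN 2) mulr2n lerDl.
Qed.

Let S_ge0 r : 0 < r < 1 -> 0 <= S r.
Proof.
move=> /andP[r0 r1]; rewrite divr_ge0 ?mulr_ge0 ?(ltW r0) ?(ltW rho0)//.
by rewrite subr_ge0 expr_le1// ltW.
Qed.

Let bessel_q r q m : 0 < r < 1 -> normc q = 1 -> q != 1 ->
  \sum_(n < m) normc (c n * r%:C ^+ n * qint q n) ^+ 2 <= S r ^+ 2.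
Proof.
move=> r01 q1 qn1; apply: le_of_sqr_approx; first exact: S_ge0.
move=> e e0; have [N mN HN] := @truncated_bound r q e m r01 q1 qn1 e0.
apply: le_trans (@bessel_circle _ N (fun n => c n * r%:C ^+ n * qint q n) _ HN).
rewrite -(subnKC mN) big_split_ord /= lerDl.
by apply: sumr_ge0 => i _; exact: sqr_ge0.
Qed.

Let coef_q r q n := c n * r%:C ^+ n * qint q n.

(** A factor lam of modulus 1 turns [lam * D 1] to the argument of [D 2], so that the moduli add.
    The coefficient [D 0] vanishes because [qint q 0] is an empty sum, hence the first of the two
    terms kept from the product is |D 1|. *)
Let toeplitz_q r q : 0 < r < 1 -> normc q = 1 -> q != 1 ->
  normc (coef_q r q 1) ^+ 2 + (normc (coef_q r q 1) + normc (coef_q r q 2)) ^+ 2 <=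
    2 * S r ^+ 2.
Proof.
move=> r01 q1 qn1; pose D := coef_q r q; pose d n := normc (D n).
rewrite -/D -/(d 1%N) -/(d 2).
have [lam l1 lE] : exists2 lam, normc lam = 1 & normc (D 2 + lam * D 1%N) = d 1%N + d 2.
  have [D1|D1] := eqVneq (D 1%N) 0.
    by exists 1; rewrite ?Normc.normc1// /d D1 mulr0 addr0 Normc.normc0 add0r.
  have [D2|D2] := eqVneq (D 2) 0.
    by exists 1; rewrite ?Normc.normc1// /d D2 mul1r add0r Normc.normc0 addr0.
  have n1 : normc (D 1%N) != 0 by rewrite normc_eq0.
  have n2 : normc (D 2) != 0 by rewrite normc_eq0.
  exists (D 2 / D 1%N * (normc (D 1%N) / normc (D 2))%:C).
    rewrite (Normc.normcM (D 2 / _)) (Normc.normcM (D 2)) Normc.normcV.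
    rewrite normc_real ger0_norm ?divr_ge0 ?normc_ge0//.
    by field; rewrite n1 n2.
  have -> : D 2 + D 2 / D 1%N * (normc (D 1%N) / normc (D 2))%:C * D 1%N =
     D 2 * (1 + normc (D 1%N) / normc (D 2))%:C.
    rewrite (_ : (1 + _)%:C = 1 + (normc (D 1%N) / normc (D 2))%:C); last first.
      by rewrite rmorphD rmorph1.
    by move: ((_ / _)%:C) => w; field.
  rewrite (Normc.normcM (D 2)) normc_real ger0_norm; last first.
    by rewrite addr_ge0// divr_ge0 ?normc_ge0.
  by rewrite /d; field.
suff : (d 1%N ^+ 2 + (d 1%N + d 2) ^+ 2) / 2 <= S r ^+ 2.
  by rewrite ler_pdivrMr// mulrC.
apply: le_of_sqr_approx; first exact: S_ge0.
move=> e e0; have [N mN HN] := @truncated_bound r q e 3 r01 q1 qn1 e0.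
have := @bessel_circle_mul _ N D lam _ mN HN.
rewrite lE l1 expr1n ler_pdivrMr//.
have -> : D 1%N + lam * D 0%N = D 1%N by rewrite /D /coef_q /qint big_ord0 !mulr0 addr0.
by [].
Qed.

Let qint_lower q n s m : normc q = 1 -> (n < m)%N -> normc (q - 1) * m%:R <= s -> s < 1 ->
  n%:R * (1 - s) <= normc (qint q n).
Proof.
move=> q1 nm qs s1; apply: le_trans (qint_near n q1).
have : normc (q - 1) * n%:R <= s.
  by apply: le_trans qs; rewrite ler_wpM2l ?normc_ge0// ler_nat ltnW.
move/(ler_wpM2l (@ler0n R n)) => H.
have -> : n%:R ^+ 2 * normc (q - 1) = n%:R * (normc (q - 1) * n%:R) by ring.
by rewrite mulrBr mulr1 lerD2l lerN2.
Qed.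

Let near_q m s : 0 < s -> exists q, [/\ normc q = 1, q != 1 & normc (q - 1) * m%:R <= s].
Proof.
move=> s0; have [q [q1 qn1 qs]] := @exists_unit_near1 (s / m.+1%:R) (divr_gt0 s0 (ltr0Sn _ _)).
exists q; split => //; move: qs; rewrite ler_pdivlMr//; apply: le_trans.
by rewrite ler_wpM2l ?normc_ge0// ler_nat.
Qed.

(** The limit q -> 1 is taken through inequalities: a q close to 1 costs a factor 1 - s per
    coefficient, with s > 0 arbitrary. *)
Let bessel_coef r m : 0 < r < 1 ->
  \sum_(n < m) n%:R ^+ 2 * normc (c n) ^+ 2 * r ^+ n ^+ 2 <= S r ^+ 2.
Proof.
move=> r01; have r0 : 0 <= r by case/andP: r01 => /ltW.
apply: le_of_scaled.
  by apply: sumr_ge0 => i _; rewrite -!exprMn sqr_ge0.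
move=> s /andP[s0 s1].
have [q [q1 qn1 qs]] := near_q m s0.
apply: le_trans (@bessel_q r q m r01 q1 qn1).
rewrite mulr_sumr; apply: ler_sum => n _.
have -> : (1 - s) ^+ 2 * (n%:R ^+ 2 * normc (c n) ^+ 2 * r ^+ n ^+ 2) =
   (normc (c n) * r ^+ n * (n%:R * (1 - s))) ^+ 2 by ring.
have qn := @qint_lower q n s m q1 (ltn_ord n) qs s1.
have s1' : 0 <= 1 - s by rewrite subr_ge0 ltW.
rewrite !Normc.normcM normcX normc_real (ger0_norm r0).
rewrite lerXn2r ?nnegrE ?mulr_ge0 ?normc_ge0 ?exprn_ge0//.
by rewrite ler_wpM2l ?mulr_ge0 ?normc_ge0 ?exprn_ge0.
Qed.

Let toeplitz_coef r : 0 < r < 1 ->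
  (normc (c 1%N) * r) ^+ 2 + (normc (c 1%N) * r + 2 * normc (c 2) * r ^+ 2) ^+ 2 <=
    2 * S r ^+ 2.
Proof.
move=> r01; have r0 : 0 <= r by case/andP: r01 => /ltW.
apply: le_of_scaled.
  by rewrite addr_ge0 ?sqr_ge0.
move=> s /andP[s0 s1].
have [q [q1 qn1 qs]] := near_q 3 s0.
have s1' : 0 <= 1 - s by rewrite subr_ge0 ltW.
apply: le_trans (@toeplitz_q r q r01 q1 qn1).
have H1 := @qint_lower q 1 s 3 q1 isT qs s1.
have H2 := @qint_lower q 2 s 3 q1 isT qs s1.
rewrite /coef_q !Normc.normcM !normcX normc_real (ger0_norm r0) expr1.
pose u := normc (c 1%N) * r; pose v := normc (c 2) * r ^+ 2.
have u0 : 0 <= u by rewrite mulr_ge0 ?normc_ge0.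
have v0 : 0 <= v by rewrite mulr_ge0 ?normc_ge0 ?exprn_ge0.
have -> : (1 - s) ^+ 2 * ((normc (c 1%N) * r) ^+ 2 +
    (normc (c 1%N) * r + 2 * normc (c 2) * r ^+ 2) ^+ 2) =
  (u * (1 * (1 - s))) ^+ 2 + (u * (1 * (1 - s)) + v * (2 * (1 - s))) ^+ 2.
  by rewrite /u /v; ring.
rewrite -/u -/v.
have h1 := ler_wpM2l u0 H1; have h2 := ler_wpM2l v0 H2.
have p1 : 0 <= u * (1 * (1 - s)) := mulr_ge0 u0 (mulr_ge0 ler01 s1').
have p2 : 0 <= v * (2 * (1 - s)) := mulr_ge0 v0 (mulr_ge0 (ler0n _ 2) s1').
apply: lerD; apply: lerXn2r; rewrite ?nnegrE//.
- exact: le_trans p1 h1.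
- exact: addr_ge0.
- by apply: addr_ge0; [exact: le_trans h1 | exact: le_trans h2].
- exact: lerD.
Qed.

Lemma bloch_coefficient_sum m :
  \sum_(k < m) normc (c k.+1) ^+ 2 / k.+2%:R <= (1 - 1 / 128 * (1 / 256)) * rho ^+ 2.
Proof.
wlog m2 : m / (1 < m)%N.
  move=> H; apply: le_trans (H (m + 2)%N _); last by rewrite addnC.
  rewrite big_split_ord /= lerDl; apply: sumr_ge0 => i _.
  by rewrite divr_ge0 ?sqr_ge0.
pose y k := (normc (c k.+1) / rho) ^+ 2.
have -> : \sum_(k < m) normc (c k.+1) ^+ 2 / k.+2%:R =
    (\sum_(k < m) y k / k.+2%:R) * rho ^+ 2.
  rewrite mulr_suml; apply: eq_bigr => k _; rewrite /y; field.
  by rewrite -natrD pnatr_eq0 (gt_eqF rho0).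
rewrite ler_wpM2r ?sqr_ge0//.
apply: (@coefficient_sum_le _ m y (normc (c 1%N) / rho) (2 * (normc (c 2) / rho))) => //.
- by move=> k; exact: sqr_ge0.
- by rewrite divr_ge0 ?normc_ge0 ?ltW.
- by rewrite mulr_ge0// divr_ge0 ?normc_ge0 ?ltW.
- by rewrite /y; ring.
- move=> t /andP[t0 t1].
  (* On the radius sqrt t the term n = 0 vanishes, and what remains is rho^2 t times the sum wanted,
     with the index shifted by one. *)
  have r01 : 0 < Num.sqrt t < 1.
    by rewrite sqrtr_gt0 t0 -[X in _ < X]sqrtr1 ltr_sqrt.
  have := @bessel_coef (Num.sqrt t) m.+1 r01.
  rewrite big_ord_recl /= expr0n /= !mul0r add0r.
  have t2 : Num.sqrt t ^+ 2 = t by rewrite sqr_sqrtr// ltW.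
  have -> : S (Num.sqrt t) ^+ 2 = (rho ^+ 2 * t) * (1 - t) ^- 2.
    by rewrite /S t2 -[X in _ = rho ^+ 2 * X * _]t2; field; rewrite gt_eqF ?subr_gt0.
  have -> : \sum_(i < m) (bump 0 i)%:R ^+ 2 * normc (c (bump 0 i)) ^+ 2 *
      Num.sqrt t ^+ bump 0 i ^+ 2 =
      (rho ^+ 2 * t) * \sum_(k < m) k.+1%:R ^+ 2 * y k * t ^+ k.
    rewrite mulr_sumr; apply: eq_bigr => k _.
    rewrite (_ : bump 0 k = k.+1)// -exprM mulnC exprM t2 (exprS t) /y; field.
    by rewrite gt_eqF.
  by rewrite ler_pM2l// mulr_gt0// exprn_gt0.
(* Radius 1/4 gives b0^2 + (b0 + b1 / 4)^2 <= 2 (16/15)^2, about 2.28; the extremal pair b0 = 1, b1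
   = sqrt 2 would give about 2.83. *)
- have h4 : 0 < (1 / 4 : R) < 1 by lra.
  have := toeplitz_coef h4.
  have -> : 2 * S (1 / 4) ^+ 2 = (rho / 4) ^+ 2 * (2 * (16 / 15) ^+ 2).
    by rewrite /S; field.
  set A := normc (c 1%N); set B := normc (c 2).
  have -> : (A * (1 / 4)) ^+ 2 + (A * (1 / 4) + 2 * B * (1 / 4) ^+ 2) ^+ 2 =
    (rho / 4) ^+ 2 * (2 * (A / rho) ^+ 2 + 1 / 2 * (A / rho * (2 * (B / rho))) +
    (2 * (B / rho)) ^+ 2 / 16).
    by field; rewrite gt_eqF.
  by rewrite ler_pM2l// exprn_gt0// divr_gt0.
Qed.

End OnDisk.
End BlochCoefficients.

(** * The area of a disk *)

Section RadialIntegration.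
Variable R : realType.
Local Notation leb := (@lebesgue_measure R).
Local Notation mu2 := (leb \x leb)%E.
Local Open Scope ereal_scope.

(** The integrand is the length of the vertical chord at x in the disk of radius s. Substituting x =
    s sin theta leaves 2 s^2 cos^2 theta, whose primitive is s^2 (theta + sin theta cos theta). *)
Lemma half_disk_integral (s : R) : (0 < s)%R ->
  \int[leb]_(x in `[(- s)%R, s]) (2 * Num.sqrt (s ^+ 2 - x ^+ 2))%:E = (pi * s ^+ 2)%:E.
Proof.
move=> s0; have pi0 := pi_gt0 R.
pose F (x : R) := (s * sin x)%R.
have Fd (x : R) : is_derive x 1%R F (s * cos x)%R.
  exact: is_derive_scale (is_derive_sin x).
have F'E : F^`()%classic = (fun x => s * cos x)%R.
  by apply/funext => x; rewrite derive1E; case: (Fd x).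
have Fc : continuous F.
  by move=> x; case: (Fd x) => ? _; exact/differentiable_continuous/derivable1_diffP.
have F'c : continuous (fun x : R => s * cos x)%R.
  move=> x; have [d _] := is_derive_scale s (is_derive_cos x).
  exact/differentiable_continuous/derivable1_diffP.
have sub := @integration_by_substitution_increasing R F
  (fun x => 2 * Num.sqrt (s ^+ 2 - x ^+ 2))%R (- (pi / 2))%R (pi / 2)%R.
have Fl : F (- (pi / 2))%R = (- s)%R by rewrite /F sinN sin_pihalf mulrN1.
have Fr : F (pi / 2)%R = s by rewrite /F sin_pihalf mulr1.
rewrite Fl Fr F'E in sub; rewrite {}sub; last first.
- apply: continuous_subspaceT => x.
  apply: (@continuousM _ _ (fun=> 2%R) (fun x : R => Num.sqrt (s ^+ 2 - x ^+ 2))%R); first exact: cst_continuous.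
  apply: (@continuous_comp R R R (fun x : R => s ^+ 2 - x ^+ 2)%R (fun y : R => Num.sqrt y)).
    apply: (@continuousB _ _ _ (fun=> s ^+ 2)%R (fun x : R => x ^+ 2)%R).
      exact: cst_continuous.
    by have [d _] := is_derive_monomial 1 x; exact/differentiable_continuous/derivable1_diffP.
  exact: sqrt_continuous.
- split.
  + by move=> x _; case: (Fd x).
  + by apply: cvg_at_right_filter; exact: Fc.
  + by apply: cvg_at_left_filter; exact: Fc.
- apply/cvg_ex; exists (s * cos (pi / 2))%R; apply: cvg_at_left_filter; exact: F'c.
- apply/cvg_ex; exists (s * cos (- (pi / 2)))%R; apply: cvg_at_right_filter; exact: F'c.
- by move=> x _; exact: F'c.
- move=> x y xi yi xy; rewrite /F ltr_pM2l//.
  by rewrite ltr_sin.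
- by lra.
pose g (x : R) := (2 * s ^+ 2 * (cos x * cos x))%R.
transitivity (\int[leb]_(x in `[(- (pi / 2))%R, (pi / 2)%R]) (g x)%:E).
  apply: eq_integral => x; rewrite inE/= in_itv/= => /andP[x1 x2].
  congr EFin; rewrite /g !fctE /= /F.
  have c0 : (0 <= cos x)%R by apply: cos_ge0_pihalf; rewrite x1.
  have -> : (s ^+ 2 - (s * sin x) ^+ 2 = (s * cos x) ^+ 2)%R.
    by rewrite -[X in (X - _)%R]mulr1 -(cos2Dsin2 x); ring.
  rewrite sqrtr_sqr ger0_norm ?mulr_ge0 ?(ltW s0)//; ring.
pose G (x : R) := (s ^+ 2 * (x + sin x * cos x))%R.
have Gd (x : R) : is_derive x 1%R G (g x).
  have -> : g x = (s ^+ 2 * (1 + (sin x * - sin x + cos x * cos x)))%R.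
    have -> : (1 + (sin x * - sin x + cos x * cos x) = 2 * (cos x * cos x) +
       (1 - (cos x ^+ 2 + sin x ^+ 2)))%R by ring.
    by rewrite cos2Dsin2 /g; ring.
  by apply: is_derive_scale; apply: is_deriveD.
rewrite (@continuous_FTC2 _ _ G).
- rewrite /G sinN cosN sin_pihalf cos_pihalf !mulr0 !addr0 -EFinB; congr EFin.
  by field.
- by lra.
- apply: continuous_subspaceT => x.
  apply: (@continuousM _ _ (fun=> (2 * s ^+ 2)%R) (fun x : R => cos x * cos x)%R).
    exact: cst_continuous.
  by apply: (@continuousM _ _ (@cos R) (@cos R)); exact: continuous_cos.
- have Gc : continuous G.
    by move=> x; case: (Gd x) => ? _; exact/differentiable_continuous/derivable1_diffP.
  split.
  + by move=> x _; case: (Gd x).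
  + by apply: cvg_at_right_filter; exact: Gc.
  + by apply: cvg_at_left_filter; exact: Gc.
- by move=> x _; rewrite derive1E; case: (Gd x).
Qed.

Definition normsq (u : R * R) : R := (u.1 ^+ 2 + u.2 ^+ 2)%R.

Lemma measurable_normsq : measurable_fun
  [set: measurableTypeR R * measurableTypeR R] (normsq : _ -> measurableTypeR R).
Proof.
by apply: measurable_funD; apply: measurable_funX; [exact: measurable_fst | exact: measurable_snd].
Qed.

Lemma measurable_disk_le (t : R) : measurable [set u : R * R | (normsq u <= t)%R].
Proof.
have := measurable_normsq measurableT (@measurable_itv _ `]-oo, t]).
rewrite setTI; congr measurable; apply/seteqP; split => u /=; rewrite in_itv/=//.
Qed.

Lemma disk_area (t : R) : (0 <= t)%R -> mu2 [set u | (normsq u <= t)%R] = (pi * t)%:E.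
Proof.
move=> t0; rewrite /product_measure1.
have E x : leb (xsection [set u : R * R | (normsq u <= t)%R] x) =
    (2 * Num.sqrt (t - x ^+ 2))%:E.
  have [xt|xt] := leP (x ^+ 2)%R t.
    have -> : xsection [set u : R * R | (normsq u <= t)%R] x =
        `[(- Num.sqrt (t - x ^+ 2))%R, Num.sqrt (t - x ^+ 2)%R]%classic.
      apply/seteqP; split => y.
        move/xsectionP; rewrite /normsq /= in_itv/= -ler_norml => H.
        rewrite -sqrtr_sqr ler_wsqrtr//; lra.
      rewrite /= in_itv/= -ler_norml => H; apply/xsectionP; rewrite /normsq /=.
      have : (`|y| ^+ 2 <= Num.sqrt (t - x ^+ 2) ^+ 2)%R.
        by apply: lerXn2r; rewrite ?nnegrE ?sqrtr_ge0.
      rewrite sqr_sqrtr ?subr_ge0// real_normK ?num_real//; lra.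
    rewrite lebesgue_measure_itv/= lte_fin.
    case: ltP => [_|H].
      by rewrite -EFinB; congr EFin; ring.
    have := sqrtr_ge0 (t - x ^+ 2); move: H; set r := Num.sqrt _ => H1 H2.
    by rewrite (_ : r = 0%R) ?mulr0//; lra.
  have -> : xsection [set u : R * R | (normsq u <= t)%R] x = set0.
    apply/seteqP; split => y //; move/xsectionP; rewrite /normsq /= => H.
    by have := sqr_ge0 y; lra.
  by rewrite measure0 ler0_sqrtr ?mulr0// subr_le0 ltW.
under eq_integral do rewrite /= E.
move: t0; rewrite le_eqVlt => /predU1P[<-|t0].
  rewrite mulr0; apply: integral0_eq => x _.
  by rewrite ler0_sqrtr ?mulr0// sub0r oppr_le0 sqr_ge0.
have s0 : (0 < Num.sqrt t)%R by rewrite sqrtr_gt0.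
have st : (Num.sqrt t ^+ 2 = t)%R by rewrite sqr_sqrtr// ltW.
rewrite -[in RHS]st -half_disk_integral// st.
rewrite [RHS]integral_mkcond; apply: eq_integral => x _.
rewrite patchE; case: ifPn => // /negP H.
have : (t < x ^+ 2)%R.
  rewrite ltNge; apply/negP => xt; apply: H; rewrite inE/= in_itv/= -ler_norml.
  by rewrite -sqrtr_sqr ler_wsqrtr.
by move=> xt; rewrite ler0_sqrtr ?mulr0// subr_le0 ltW.
Qed.

End RadialIntegration.

(** * Integrals of radial functions *)

Section RadialFormula.
Variable R : realType.
Local Notation leb := (@lebesgue_measure R).
Local Notation mu2 := (leb \x leb)%E.
Local Open Scope ereal_scope.

Let nu : {measure set (measurableTypeR R) -> \bar R} :=
  @measure_function_pushforward__canonical__measure_function_Measure _ _ _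
    (measurableTypeR R) _ [the measure _ _ of mu2] _ (@measurable_normsq R).

Let neg_measurable : measurable (`]-oo, 0%R[%classic : set (measurableTypeR R)).
Proof. exact: measurable_itv. Qed.

Let ipi_ge0 : (0 <= pi^-1 :> R)%R.
Proof. by rewrite invr_ge0 pi_ge0. Qed.

(** Since the disk [normsq u <= t] has area pi t, the image of area under [normsq], divided by pi,
    should be Lebesgue measure on the positive half-line. Lebesgue measure of the negative half-line
    is added so that the sum agrees with Lebesgue measure on every half-open interval, and
    uniqueness applies. *)
Let m : {measure set (measurableTypeR R) -> \bar R} :=
  measure_add (mscale (NngNum ipi_ge0) nu) (mrestr leb neg_measurable).

Let mE A : m A = pi^-1%:E * mu2 (@normsq R @^-1` A) + leb (A `&` `]-oo, 0%R[).
Proof. exact: measure_addE. Qed.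

Let normsq_ge0 (u : R * R) : (0 <= normsq u)%R.
Proof. by rewrite addr_ge0 ?sqr_ge0. Qed.

Let leb_itv (a b : R) : (a <= b)%R -> leb `]a, b] = (b - a)%:E.
Proof.
rewrite le_eqVlt => /predU1P[<-|ab]; first by rewrite set_itvoc0 measure0 subrr.
by rewrite lebesgue_measure_itv/= lte_fin ab.
Qed.

Let mu2_annulus (a b : R) : (0 <= a)%R -> (a <= b)%R ->
  mu2 (@normsq R @^-1` `]a, b]) = (pi * (b - a))%:E.
Proof.
move=> a0 ab.
have -> : @normsq R @^-1` `]a, b] =
    [set u | (normsq u <= b)%R] `\` [set u | (normsq u <= a)%R].
  apply/seteqP; split => u /=; rewrite in_itv/=.
    by move=> /andP[h1 h2]; split => //; apply/negP; rewrite -ltNge.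
  by move=> [h1 /negP]; rewrite -ltNge => h2; apply/andP.
have b0 := le_trans a0 ab.
rewrite measureD; last 3 first.
- exact: measurable_disk_le.
- exact: measurable_disk_le.
- by rewrite [ltLHS]disk_area// ltry.
have -> : [set u : R * R | (normsq u <= b)%R] `&` [set u | (normsq u <= a)%R] =
    [set u | (normsq u <= a)%R].
  by apply/seteqP; split => u /= => [[]//|ua]; split => //; exact: le_trans ab.
by rewrite [X in X - _]disk_area// [X in _ - X]disk_area// -EFinB mulrBr.
Qed.

Let lebE A : measurable A -> leb A = m A.
Proof.
apply: lebesgue_measure_unique => _ [[a b] _ <-] /=.
have pi0 := pi_gt0 R.
have [ba|ab] := leP b a; first by rewrite set_itv_ge ?bnd_simp -?leNgt// !measure0.
rewrite mE; have [a0|a0] := leP 0%R a.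
  rewrite mu2_annulus ?(ltW ab)// -EFinM mulKf ?gt_eqF//.
  have -> : `]a, b] `&` `]-oo, 0%R[ = set0 :> set R.
    apply/seteqP; split => x //= []; rewrite !in_itv/= => /andP[h1 h2] h3.
    by have := lt_trans h3 (le_lt_trans a0 h1); rewrite ltxx.
  by rewrite measure0 adde0 leb_itv// ltW.
have [b0|b0] := leP 0%R b.
  have -> : @normsq R @^-1` `]a, b] = [set u | (normsq u <= b)%R].
    apply/seteqP; split => u /=; rewrite in_itv/=; first by move=> /andP[].
    by move=> ->; rewrite andbT (lt_le_trans a0).
  rewrite [X in _ * X]disk_area// -EFinM mulKf ?gt_eqF//.
  have -> : `]a, b] `&` `]-oo, 0%R[ = `]a, 0%R[%classic :> set R.
    apply/seteqP; split => x /=; rewrite !in_itv/=.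
      by move=> [/andP[-> _] ->].
    by move=> /andP[-> h]; split => //=; exact: ltW (lt_le_trans h b0).
  rewrite leb_itv ?(ltW ab)// lebesgue_measure_itv/= lte_fin a0 -EFinB -EFinD.
  by rewrite sub0r addrC; congr EFin; ring.
have -> : @normsq R @^-1` `]a, b] = set0.
  apply/seteqP; split => u //=; rewrite in_itv/= => /andP[_ h].
  by have := le_lt_trans (le_trans (normsq_ge0 u) h) b0; rewrite ltxx.
rewrite measure0 mule0 add0e; congr (leb _).
apply/seteqP; split => x /=; rewrite !in_itv/=; last by move=> [].
by move=> /andP[-> h]; split => //; exact: le_lt_trans b0.
Qed.

Lemma radial_integral (phi : R -> R) : measurable_fun setT phi ->
  (forall t, (0 <= phi t)%R) ->
  \int[mu2]_(u in [set u : R * R | (normsq u < 1)%R]) (phi (normsq u))%:E =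
  pi%:E * \int[leb]_(t in `]0%R, 1%R[) (phi t)%:E.
Proof.
move=> mphi phi0.
have mE1 (D : set R) : measurable_fun D (fun t => (phi t)%:E).
  by apply/measurable_EFinP; exact: measurable_funTS.
rewrite integral_itv_obnd_cbnd; last exact: mE1.
have -> : \int[leb]_(t in `[0%R, 1%R[) (phi t)%:E = \int[m]_(t in `[0%R, 1%R[) (phi t)%:E.
  by apply: eq_measure_integral => A mA _; exact: lebE.
rewrite /m ge0_integral_measure_add; [|by []|by move=> x _; rewrite lee_fin|exact: mE1].
rewrite ge0_integral_mscale; [|by []|exact: mE1|by move=> x _; rewrite lee_fin].
rewrite [X in _ * (_ + X)]null_set_integral; [|by []|exact: mE1|]; last first.
  transitivity (leb (`[0%R, 1%R[%classic `&` `]-oo, 0%R[%classic)) => //.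
  rewrite (_ : _ `&` _ = set0) ?measure0//.
  apply/seteqP; split => x //= []; rewrite !in_itv/= => /andP[h1 _] h3.
  by have := le_lt_trans h1 h3; rewrite ltxx.
rewrite adde0 muleA -EFinM mulfV ?gt_eqF ?pi_gt0// mul1e.
transitivity (\int[mu2]_(u in @normsq R @^-1` `[0%R, 1%R[) (phi (normsq u))%:E); last first.
  have H := @ge0_integral_pushforward _ _ _ (measurableTypeR R) _ _
    (@measurable_normsq R) [the measure _ _ of mu2] `[0%R, 1%R[%classic
    (fun t => (phi t)%:E) (measurable_itv _) (mE1 _).
  by apply/esym/H => x _; rewrite lee_fin.
congr (integral _ _ _); apply/seteqP; split => u /=; rewrite in_itv/=.
  by move=> ->; rewrite normsq_ge0.
by move=> /andP[].
Qed.

End RadialFormula.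

(** * Invariance of plane measure under shears and rotations *)

Section RotationInvariance.
Variable R : realType.
Local Notation leb := (@lebesgue_measure R).
Local Notation mu2 := (leb \x leb)%E.
Local Notation T1 := (measurableTypeR R).
Local Notation T2 := (measurableTypeR R * measurableTypeR R)%type.
Local Open Scope ereal_scope.

Lemma measurable_addr (c : R) : measurable_fun [set: T1] ((fun x => (x + c)%R) : T1 -> T1).
Proof. by apply: measurable_funD => //; exact: measurable_cst. Qed.

Lemma integral_translate (c : R) (F : T1 -> \bar R) : measurable_fun setT F ->
  (forall x, 0 <= F x) -> \int[leb]_x F (x + c)%R = \int[leb]_x F x.
Proof.
move=> mF F0.
pose m : {measure set T1 -> \bar R} :=
  @measure_function_pushforward__canonical__measure_function_Measure
    _ _ _ T1 _ [the measure _ _ of leb] _ (measurable_addr c).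
have E A : measurable A -> leb A = m A.
  apply: (@lebesgue_measure_unique R m) => _ [[a b] _ <-] /=.
  rewrite [RHS](_ : _ = leb `](a - c)%R, (b - c)%R]%classic); last first.
    congr (leb _); apply/seteqP; split => x /=; rewrite !in_itv/= ltrBlDr lerBrDr//.
  rewrite !lebesgue_measure_itv/= !lte_fin ltrD2r.
  by case: ifP => // _; rewrite -!EFinB; congr EFin; ring.
have H := @ge0_integral_pushforward _ _ _ T1 _ _ (measurable_addr c)
  [the measure _ _ of leb] setT F measurableT mF.
have {}H := H (fun x _ => F0 x).
rewrite preimage_setT in H; rewrite -[LHS]H.
by apply: (@eq_measure_integral _ _ _ setT [the measure _ _ of leb] m) => A mA _;
  rewrite -E.
Qed.

(** By Tonelli's theorem a shear is a translation on each horizontal line. *)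
Lemma integral_shear_fst (c : R) (F : T2 -> \bar R) : measurable_fun setT F ->
  (forall x, 0 <= F x) -> \int[mu2]_u F ((u.1 + c * u.2)%R, u.2) = \int[mu2]_u F u.
Proof.
move=> mF F0; rewrite [RHS]fubini_tonelli2// [LHS]fubini_tonelli2//.
  apply: eq_integral => y _; rewrite /fubini_G /=.
  apply: (@integral_translate (c * y)%R (fun x => F (x, y))) => //.
  exact: measurable_fun_pair1.
apply: (measurableT_comp mF); apply: measurable_fun_pair; last exact: measurable_snd.
apply: measurable_funD; first exact: measurable_fst.
by apply: measurable_funM; [exact: measurable_cst | exact: measurable_snd].
Qed.

Lemma integral_shear_snd (c : R) (F : T2 -> \bar R) : measurable_fun setT F ->
  (forall x, 0 <= F x) -> \int[mu2]_u F (u.1, (u.2 + c * u.1)%R) = \int[mu2]_u F u.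
Proof.
move=> mF F0; rewrite [RHS]fubini_tonelli1// [LHS]fubini_tonelli1//.
  apply: eq_integral => x _; rewrite /fubini_F /=.
  apply: (@integral_translate (c * x)%R (fun y => F (x, y))) => //.
  exact: measurable_fun_pair2.
apply: (measurableT_comp mF); apply: measurable_fun_pair; first exact: measurable_fst.
apply: measurable_funD; first exact: measurable_snd.
by apply: measurable_funM; [exact: measurable_cst | exact: measurable_fst].
Qed.

Lemma measurable_linear2 (a b c d : R) : measurable_fun [set: T2]
  ((fun u => (a * u.1 + b * u.2, c * u.1 + d * u.2)%R) : T2 -> T2).
Proof.
by apply: measurable_fun_pair; apply: measurable_funD; apply: measurable_funM => //;
  exact: measurable_cst.
Qed.

(* A rotation with nonzero sine is a product of three shears. *)
Lemma integral_rotate (c s : R) (F : T2 -> \bar R) : (c ^+ 2 + s ^+ 2 = 1)%R -> s != 0%R ->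
  measurable_fun setT F -> (forall x, 0 <= F x) ->
  \int[mu2]_u F ((c * u.1 - s * u.2)%R, (s * u.1 + c * u.2)%R) = \int[mu2]_u F u.
Proof.
move=> cs s0 mF F0; pose a := ((c - 1) / s)%R.
pose F1 (u : T2) := F ((u.1 + a * u.2)%R, u.2).
pose F2 (u : T2) := F1 (u.1, (u.2 + s * u.1)%R).
have mF1 : measurable_fun setT F1.
  apply: (measurableT_comp mF).
  have := measurable_linear2 1 a 0 1; congr measurable_fun.
  by apply/funext => u; rewrite !mul1r mul0r add0r.
have mF2 : measurable_fun setT F2.
  apply: (measurableT_comp mF1).
  have := measurable_linear2 1 0 s 1; congr measurable_fun.
  by apply/funext => u; rewrite !mul1r mul0r addr0 addrC.
have F10 u : 0 <= F1 u by exact: F0.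
have F20 u : 0 <= F2 u by exact: F10.
rewrite -(@integral_shear_fst a F)// -(@integral_shear_snd s F1)//.
rewrite -(@integral_shear_fst a F2)//.
apply: eq_integral => u _; rewrite /F2 /F1 /=; congr (F (_, _)); rewrite /a.
  have -> : (s * u.2 = (1 - c ^+ 2) / s * u.2)%R by rewrite -cs; field.
  by field.
by field.
Qed.

End RotationInvariance.

(** * Parseval's identity on the plane for radial weights *)

Section DiskParseval.
Variable R : realType.
Local Notation leb := (@lebesgue_measure R).
Local Notation mu2 := (leb \x leb)%E.
Local Notation T1 := (measurableTypeR R).
Local Notation T2 := (measurableTypeR R * measurableTypeR R)%type.
Local Notation normc := (@Normc.normc R).
Local Notation cRe := (@complex.Re R).
Local Notation cIm := (@complex.Im R).
Implicit Types (D : set T2) (F G : T2 -> R[i]).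

Definition cmeasurable D F :=
  measurable_fun D (cRe \o F : T2 -> T1) /\ measurable_fun D (cIm \o F : T2 -> T1).

Lemma cmeasurable_cst D c : cmeasurable D (fun=> c).
Proof. by split; exact: measurable_cst. Qed.

Lemma cmeasurableD D F G : cmeasurable D F -> cmeasurable D G ->
  cmeasurable D (fun u => F u + G u).
Proof.
move=> [fr fi] [gr gi]; split.
  have -> : cRe \o (fun u => F u + G u) = (cRe \o F) \+ (cRe \o G).
    by apply/funext => u /=; case: (F u) (G u) => [? ?] [? ?].
  exact: measurable_funD.
have -> : cIm \o (fun u => F u + G u) = (cIm \o F) \+ (cIm \o G).
  by apply/funext => u /=; case: (F u) (G u) => [? ?] [? ?].
exact: measurable_funD.
Qed.

Lemma cmeasurableM D F G : cmeasurable D F -> cmeasurable D G ->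
  cmeasurable D (fun u => F u * G u).
Proof.
move=> [fr fi] [gr gi]; split.
  have -> : cRe \o (fun u => F u * G u) =
      ((cRe \o F) \* (cRe \o G)) \- ((cIm \o F) \* (cIm \o G)).
    by apply/funext => u /=; case: (F u) (G u) => [? ?] [? ?].
  by apply: measurable_funB; exact: measurable_funM.
have -> : cIm \o (fun u => F u * G u) =
    ((cRe \o F) \* (cIm \o G)) \+ ((cIm \o F) \* (cRe \o G)).
  by apply/funext => u /=; case: (F u) (G u) => [? ?] [? ?].
by apply: measurable_funD; exact: measurable_funM.
Qed.

Lemma cmeasurableX D F n : cmeasurable D F -> cmeasurable D (fun u => F u ^+ n).
Proof.
move=> mF; elim: n => [|n IH].
  by under eq_fun do rewrite expr0; exact: cmeasurable_cst.
by under eq_fun do rewrite exprS; exact: cmeasurableM.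
Qed.

Lemma cmeasurable_sum D n (F : nat -> T2 -> R[i]) : (forall i, cmeasurable D (F i)) ->
  cmeasurable D (fun u => \sum_(i < n) F i u).
Proof.
move=> mF; elim: n => [|n IH].
  by under eq_fun do rewrite big_ord0; exact: cmeasurable_cst.
by under eq_fun do rewrite big_ord_recr/=; exact: cmeasurableD.
Qed.

Lemma cmeasurable_normc_sqr D F : cmeasurable D F ->
  measurable_fun D ((fun u => normc (F u) ^+ 2) : T2 -> T1).
Proof.
move=> [fr fi].
have -> : (fun u => normc (F u) ^+ 2) = (fun u => (cRe \o F) u ^+ 2 + (cIm \o F) u ^+ 2).
  by apply/funext => u; rewrite normc_sqr.
by apply: measurable_funD; exact: measurable_funX.
Qed.

Definition cplx (u : T2) : R[i] := u.1 +i* u.2.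

Lemma cmeasurable_cplx D : cmeasurable D cplx.
Proof.
by split; apply: measurable_funTS; [exact: measurable_fst | exact: measurable_snd].
Qed.

Lemma cmeasurable_poly D (d : nat -> R[i]) (q : R[i]) n :
  cmeasurable D (fun u => \sum_(i < n) d i * (q * cplx u) ^+ i).
Proof.
apply: (@cmeasurable_sum D n (fun i u => d i * (q * cplx u) ^+ i)) => i.
apply: cmeasurableM; first exact: cmeasurable_cst.
apply: cmeasurableX; apply: cmeasurableM; first exact: cmeasurable_cst.
exact: cmeasurable_cplx.
Qed.

Lemma normc_cplx (u : T2) : normc (cplx u) ^+ 2 = normsq u.
Proof. by rewrite normc_sqr. Qed.

(** A real number of modulus 1 has square 1, which contradicts an order above 2. The nonzero
    imaginary part is what the shear decomposition of the rotation by w requires. *)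
Lemma Im_prim_root N (w : R[i]) : (2 < N)%N -> N.-primitive_root w -> cIm w != 0.
Proof.
move=> N2 wN; apply/eqP => Iw.
have nw : normc w = 1.
  exact: (normc_unity_root (prim_order_gt0 wN) (prim_expr_order wN)).
have w2 : w ^+ 2 = 1.
  have := normc_sqr w; rewrite nw Iw expr0n addr0 expr1n => E.
  have -> : w = (cRe w)%:C by case: (w) Iw => a b /= ->.
  by rewrite -rmorphXn -E.
have : (N %| 2)%N by rewrite (prim_order_dvd wN) w2.
by rewrite gtnNdvd.
Qed.

Local Open Scope ereal_scope.

(** Rotations preserve area and the radial weight, so the integral equals its average over the
    rotations by w^k. Under the integral, the finite Parseval identity with coefficients
    [d n * cplx u ^+ n] removes the cross terms at each point u. *)
Lemma plane_parseval N (d : nat -> R[i]) (v : T1 -> T1) : (2 < N)%N ->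
  measurable_fun setT v -> (forall t, (0 <= v t)%R) ->
  \int[mu2]_u (normc (\sum_(n < N) d n * cplx u ^+ n) ^+ 2 * v (normsq u))%:E =
  \sum_(n < N) (normc (d n) ^+ 2)%:E * \int[mu2]_u (normsq u ^+ n * v (normsq u))%:E.
Proof.
move=> N2 mv v0.
have [w wN] := @complex_prim_root R N (ltn_trans (isT : (0 < 2)%N) N2).
have nw : normc w = 1%R.
  exact: (normc_unity_root (prim_order_gt0 wN) (prim_expr_order wN)).
have Iw := Im_prim_root N2 wN.
have mvn : measurable_fun [set: T2] ((fun u => v (normsq u)) : T2 -> T1).
  exact: measurableT_comp mv (@measurable_normsq R).
pose F (q : R[i]) (u : T2) : \bar R :=
  (normc (\sum_(n < N) d n * (q * cplx u) ^+ n) ^+ 2 * v (normsq u))%:E.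
have F0 q u : 0 <= F q u by rewrite lee_fin mulr_ge0 ?sqr_ge0.
have mF q : measurable_fun setT (F q).
  apply/measurable_EFinP; apply: measurable_funM => //.
  apply: cmeasurable_normc_sqr; exact: cmeasurable_poly.
have rot q : \int[mu2]_u F (q * w)%R u = \int[mu2]_u F q u.
  have cs : (cRe w ^+ 2 + cIm w ^+ 2 = 1)%R by rewrite -normc_sqr nw expr1n.
  rewrite -(integral_rotate cs Iw (mF q) (F0 q)).
  apply: eq_integral => u _; rewrite /F; congr EFin.
  have E : (cplx (cRe w * u.1 - cIm w * u.2, cIm w * u.1 + cRe w * u.2) = w * cplx u)%R.
    by rewrite /cplx; case: (w) => a b; simpc => /=; congr (_ +i* _)%C; ring.
  congr (_ * v _)%R; first by rewrite E mulrA.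
  by rewrite -!normc_cplx E Normc.normcM nw mul1r.
have rotk k : \int[mu2]_u F (w ^+ k)%R u = \int[mu2]_u F 1%R u.
  by elim: k => [//|k IH]; rewrite exprSr rot.
have N0 : (N%:R != 0 :> R)%R by rewrite pnatr_eq0 -lt0n (ltn_trans _ N2).
have S : \sum_(k < N) \int[mu2]_u F (w ^+ k)%R u =
    N%:R%:E * \sum_(n < N) (normc (d n) ^+ 2)%:E * \int[mu2]_u (normsq u ^+ n * v (normsq u))%:E.
  rewrite -ge0_integral_sum//.
  have mG (n : 'I_N) : measurable_fun [set: T2] (fun u => (normsq u ^+ n * v (normsq u))%:E).
    apply/measurable_EFinP; apply: measurable_funM => //.
    apply: measurable_funX; exact: measurable_normsq.
  have G0 (n : 'I_N) (u : T2) : 0 <= (normsq u ^+ n * v (normsq u))%:E.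
    by rewrite lee_fin mulr_ge0 ?exprn_ge0// addr_ge0 ?sqr_ge0.
  transitivity (\int[mu2]_u (N%:R%:E *
      \sum_(n < N) (normc (d n) ^+ 2)%:E * (normsq u ^+ n * v (normsq u))%:E)).
    apply: eq_integral => u _; rewrite /F.
    under [in RHS]eq_bigr do rewrite -EFinM.
    rewrite !sumEFin -EFinM; congr EFin.
    rewrite -mulr_suml.
    have -> : (\sum_(k < N) normc (\sum_(n < N) d n * (w ^+ k * cplx u) ^+ n) ^+ 2 =
        \sum_(k < N) normc (\sum_(n < N) d n * cplx u ^+ n * (w ^+ k) ^+ n) ^+ 2 :> R)%R.
      apply: eq_bigr => k _; congr (normc _ ^+ 2)%R; apply: eq_bigr => n _.
      by rewrite exprMn; ring.
    rewrite (discrete_parseval (fun n => d n * cplx u ^+ n)%R wN).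
    rewrite -mulrA; congr (_ * _)%R; rewrite mulr_suml; apply: eq_bigr => n _.
    rewrite Normc.normcM normcX exprMn -(exprM (normc _)) mulnC exprM normc_cplx.
    by rewrite mulrA.
  rewrite ge0_integralZl//; last 2 first.
  - by apply: emeasurable_sum => n; apply: measurable_funeM.
  - by move=> u _; apply: sume_ge0 => n _; rewrite mule_ge0// lee_fin sqr_ge0.
  congr (_ * _); rewrite ge0_integral_sum//; last 2 first.
  - by move=> n; apply: measurable_funeM.
  - by move=> n u _; rewrite mule_ge0// lee_fin sqr_ge0.
  apply: eq_bigr => n _; rewrite ge0_integralZl// lee_fin sqr_ge0//.
move: S; under eq_bigr do rewrite rotk.
rewrite sumr_const card_ord => S.
have -> : \int[mu2]_u (normc (\sum_(n < N) d n * cplx u ^+ n) ^+ 2 * v (normsq u))%:E =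
    \int[mu2]_u F 1%R u.
  by apply: eq_integral => u _; rewrite /F; under [in RHS]eq_bigr do rewrite mul1r.
(* The integrals may be infinite; only the finite nonzero factor N is cancelled. *)
have cancel (x y : \bar R) : N%:R%:E * x = N%:R%:E * y -> x = y.
  move=> H; transitivity (N%:R^-1%:E * (N%:R%:E * x)).
    by rewrite muleA -EFinM mulVf// mul1e.
  by rewrite H muleA -EFinM mulVf// mul1e.
by apply: cancel; rewrite -S mule_natl.
Qed.

End DiskParseval.

(** * Improper integrals on (0, 1) and moments of the radial weight *)

Section RadialWeight.
Variable R : realType.
Local Notation leb := (@lebesgue_measure R).
Local Notation mu2 := (leb \x leb)%E.
Local Notation T1 := (measurableTypeR R).
Local Notation T2 := (measurableTypeR R * measurableTypeR R)%type.
Local Notation normc := (@Normc.normc R).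

(** The primitives in use fail to be differentiable at an endpoint. The fundamental theorem is
    applied on compact intervals exhausting (0, 1), and monotone convergence carries the bound to
    the limit. *)
Lemma integral_oo01_le (f g G : R -> R) (C : R) :
  measurable_fun [set: T1] (f : T1 -> T1) ->
  (forall t : R, 0 < t < 1 -> 0 <= f t <= g t) ->
  (forall t : R, 0 < t < 1 -> {for t, continuous g}) ->
  (forall t : R, 0 < t < 1 -> is_derive t 1 G (g t)) ->
  (forall a b, 0 < a -> a < b -> b < 1 -> G b - G a <= C) ->
  (\int[leb]_(t in `]0%R, 1%R[) (f t)%:E <= C%:E)%E.
Proof.
move=> mf fg cg dG GC.
(* Starting at 1/3 keeps e k below 1 - e k, so every interval is nondegenerate. *)
pose e (k : nat) : R := k.+3%:R^-1.
have e0 k : 0 < e k by rewrite invr_gt0 ltr0n.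
have e1 k : e k <= 1 / 3 by rewrite div1r lef_pV2 ?posrE ?ltr0n// ler_nat.
pose F k : set R := `[e k, 1 - e k]%classic.
have FP k t : F k t -> e k <= t <= 1 - e k by rewrite /F /= in_itv.
have F01 k t : F k t -> 0 < t < 1.
  move=> /FP/andP[t0 t1]; rewrite (lt_le_trans (e0 k) t0)/=.
  by apply: le_lt_trans t1 _; rewrite gtrBl.
have FE : `]0%R, 1%R[%classic = \bigcup_k F k.
  apply/seteqP; split => [t|t [k _ /F01]]; rewrite /= in_itv//=.
  move=> /andP[t0 t1].
  have m0 : 0 < Num.min t (1 - t) by rewrite lt_min t0 subr_gt0.
  have [k kt] : exists k, e k < Num.min t (1 - t).
    have [k Hk] := ltr_add_invr m0; exists k.
    apply: le_lt_trans Hk; rewrite add0r /e lef_pV2 ?posrE ?ltr0n// ler_nat.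
    by rewrite -addn2 leq_addr.
  exists k => //; rewrite /F /= in_itv/=.
  by move: kt; rewrite lt_min => /andP[k1 k2]; lra.
have cvg := @ge0_nondecreasing_set_cvg_integral _ T1 R F (fun t => (f t)%:E) leb.
have {}cvg : (\int[leb]_(x in F i) (f x)%:E @[i --> \oo] -->
    \int[leb]_(x in \bigcup_i F i) (f x)%:E)%E.
  apply: cvg.
  - move=> n m nm; rewrite subsetEset => t /FP/andP[h1 h2]; rewrite /F /= in_itv/=.
    have : e m <= e n by rewrite /e lef_pV2 ?posrE ?ltr0n// ler_nat.
    by lra.
  - by move=> k; exact: measurable_itv.
  - by move=> k; apply/measurable_EFinP; exact: measurable_funTS.
  - by move=> k t Ft; have t01 := F01 k t Ft; have /andP[f0 _] := fg t t01; rewrite lee_fin.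
rewrite FE -(cvg_lim _ cvg)//; apply: lime_le; first by apply/cvg_ex; eexists; exact: cvg.
apply: nearW => k.
have ek : e k < 1 - e k by have := e1 k; lra.
have cgk : {within F k, continuous g}.
  apply: continuous_in_subspaceT => t; rewrite inE => Ft; exact: (cg t (F01 k t Ft)).
apply: (@le_trans _ _ (\int[leb]_(t in F k) (g t)%:E)%E).
  apply: ge0_le_integral => //.
  - exact: measurable_itv.
  - by move=> t Ft; have t01 := F01 k t Ft; have /andP[f0 _] := fg t t01; rewrite lee_fin.
  - by apply/measurable_EFinP; exact: measurable_funTS.
  - apply/measurable_EFinP; apply: subspace_continuous_measurable_fun => //.
    exact: measurable_itv.
  - by move=> t Ft; have t01 := F01 k t Ft; have /andP[_ h] := fg t t01; rewrite lee_fin.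
have Gc t : 0 < t < 1 -> {for t, continuous G}.
  by move=> t01; have [? _] := dG t t01; exact/differentiable_continuous/derivable1_diffP.
have e0' := e0 k; have e1' := e1 k.
rewrite (@continuous_FTC2 _ _ G)//.
- by rewrite -EFinB lee_fin GC//; lra.
- split.
  + by move=> t; rewrite in_itv/= => /andP[? ?]; case: (dG t) => //; lra.
  + by apply: cvg_at_right_filter; apply: Gc; lra.
  + by apply: cvg_at_left_filter; apply: Gc; lra.
- by move=> t; rewrite in_itv/= => /andP[? ?]; rewrite derive1E; case: (dG t) => //; lra.
Qed.

Lemma is_derive_powR_compl (a t : R) : t < 1 ->
  is_derive t 1 (fun s : R => (1 - s) `^ a) (- (a * (1 - t) `^ (a - 1))).
Proof.
move=> t1; have d : is_derive t 1 (fun s : R => 1 - s) (- 1).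
  have := is_deriveB (is_derive_cst (1 : R) t 1) (is_derive_id t 1).
  by rewrite sub0r.
have p : 0 < 1 - t by rewrite subr_gt0.
have := @is_derive1_comp R (fun x : R => x `^ a) (fun s : R => 1 - s) t _ _ (is_derive1_powR a p) d.
by rewrite mulrN1.
Qed.

Lemma powR_compl_continuous (a t : R) : t < 1 -> {for t, continuous (fun s : R => (1 - s) `^ a)}.
Proof.
by move=> /(is_derive_powR_compl a)[? _]; exact/differentiable_continuous/derivable1_diffP.
Qed.

Lemma is_derive_expr n (t : R) : is_derive t 1 (fun s : R => s ^+ n) (n%:R * t ^+ n.-1).
Proof.
case: n => [|n]; last exact: is_derive_monomial.
have -> : (fun s : R => s ^+ 0) = cst 1 by apply/funext => s; rewrite expr0.
by rewrite mul0r; exact: is_derive_cst.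
Qed.

Lemma exprn_continuous n (t : R) : {for t, continuous (fun s : R => s ^+ n)}.
Proof.
by have [? _] := is_derive_expr n t; exact/differentiable_continuous/derivable1_diffP.
Qed.

(** The inequality of arithmetic and geometric means for 1 and n copies of b^(n+1). *)
Lemma amgm_power n (b : R) : 0 <= b <= 1 -> n.+1%:R * b ^+ n <= 1 + n%:R * b ^+ n.+1.
Proof.
move=> /andP[b0 b1]; elim: n => [|n IH]; first by rewrite expr0 mul0r mul1r addr0.
have := ler_wpM2l b0 IH.
have : 0 <= (1 - b) * (1 - b ^+ n.+1) by rewrite mulr_ge0 ?subr_ge0 ?exprn_ile1.
rewrite [b ^+ n.+2]exprS.
have E1 : b * (n.+1%:R * b ^+ n) = n.+1%:R * b ^+ n.+1 by rewrite exprS; ring.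
have E2 : n.+2%:R * b ^+ n.+1 = n.+1%:R * b ^+ n.+1 + b ^+ n.+1.
  by rewrite -(natr1 n.+1); ring.
have E3 : n.+1%:R * (b * b ^+ n.+1) = n%:R * (b * b ^+ n.+1) + b * b ^+ n.+1.
  by rewrite -(natr1 n); ring.
rewrite E1 E2 E3; lra.
Qed.

Variable alpha : R.
Hypothesis alpha_ge0 : 0 <= alpha.

Definition radial_weight (t : R) := (alpha + 1) * (1 - t) `^ alpha.

Lemma measurable_radial_weight : measurable_fun [set: T1] (radial_weight : T1 -> T1).
Proof.
apply: measurable_funM; first exact: measurable_cst.
apply: (@measurableT_comp _ _ _ T1 T1 T1 (fun x : R => x `^ alpha)).
  exact: measurable_powR.
by apply: measurable_funB; [exact: measurable_cst | exact: measurable_id].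
Qed.

Lemma radial_weight_ge0 t : 0 <= radial_weight t.
Proof. by rewrite mulr_ge0 ?powR_ge0 ?addr_ge0. Qed.

Lemma powR_compl_le (t : R) : 0 <= t <= 1 -> (1 - t) `^ (alpha + 1) <= 1 - t.
Proof.
move=> /andP[t0 t1]; have [->|t1'] := eqVneq t 1.
  by rewrite subrr powR0// gt_eqF// ltr_wpDl.
have p : 0 < 1 - t <= 1 by rewrite subr_gt0 lt_neqAle t1' t1 gerBl.
by apply: ge1r_powR => //; rewrite lerDr.
Qed.

(** By parts, the integral becomes that of n t^(n-1) (1 - t)^(alpha+1), and (1 - t)^(alpha+1) <= 1 -
    t leaves 1 / (n + 1), the value for alpha = 0. Accordingly [g] enlarges the integrand by the
    excess in this last step, which gives it the explicit primitive [G]. The absolute value keeps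
    the integrand nonnegative on the whole line, as the radial formula requires. *)
Lemma moment_le n :
  (\int[leb]_(t in `]0%R, 1%R[) (`|t| ^+ n * radial_weight t)%:E <= n.+1%:R^-1%:E)%E.
Proof.
pose g t := t ^+ n * radial_weight t +
  n%:R * t ^+ n.-1 * ((1 - t) - (1 - t) `^ (alpha + 1)).
pose G t := t ^+ n * (1 - (1 - t) `^ (alpha + 1)) - n%:R / n.+1%:R * t ^+ n.+1.
apply: (@integral_oo01_le _ g G).
- apply: measurable_funM; last exact: measurable_radial_weight.
  exact: measurable_funX (@normr_measurable R setT).
- move=> t t01; have t0 : 0 <= t by lra.
  rewrite (ger0_norm t0) mulr_ge0 ?exprn_ge0 ?radial_weight_ge0//= lerDl.
  rewrite mulr_ge0 ?mulr_ge0 ?exprn_ge0// subr_ge0 powR_compl_le//; lra.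
- move=> t t01; have t1 : t < 1 by lra.
  pose A (t : R) := t ^+ n * radial_weight t.
  pose B (t : R) := n%:R * t ^+ n.-1 * ((1 - t) - (1 - t) `^ (alpha + 1)).
  rewrite -[g]/(fun t => A t + B t); apply: (@continuousD _ _ _ A B).
    apply: (@continuousM _ _ (fun t : R => t ^+ n)); first exact: exprn_continuous.
    apply: (@continuousM _ _ (fun=> alpha + 1)); first exact: cst_continuous.
    exact: powR_compl_continuous.
  apply: (@continuousM _ _ (fun t : R => n%:R * t ^+ n.-1)).
    apply: (@continuousM _ _ (fun=> n%:R)); first exact: cst_continuous.
    exact: exprn_continuous.
  apply: (@continuousB _ _ _ (fun t : R => 1 - t)); last exact: powR_compl_continuous.
  by apply: continuousB; [exact: cst_continuous | exact: cvg_id].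
- move=> t t01; have t1 : t < 1 by lra.
  have d1 : is_derive t 1 (fun s : R => 1 - (1 - s) `^ (alpha + 1)) ((alpha + 1) * (1 - t) `^ alpha).
    have := is_deriveB (is_derive_cst (1 : R) t 1) (is_derive_powR_compl (alpha + 1) t1).
    by rewrite sub0r opprK addrK.
  have := is_deriveB (is_deriveM (is_derive_expr n t) d1) (is_derive_scale (n%:R / n.+1%:R) (is_derive_monomial n t)).
  rewrite -![_ *: _]/(_ * _); congr is_derive.
  rewrite /g /radial_weight mulrA divfK ?pnatr_eq0//.
  case: (n) => [|k]; first by rewrite /= !mul0r; ring.
  by rewrite /= exprS; ring.
- move=> a b a0 ab b1.
  have n1 : 0 < n.+1%:R :> R by rewrite ltr0n.
  have Gb : G b <= n.+1%:R^-1.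
    have H := @amgm_power n b; have {}H : n.+1%:R * b ^+ n <= 1 + n%:R * b ^+ n.+1.
      by apply: H; lra.
    have : b ^+ n * (1 - (1 - b) `^ (alpha + 1)) <= b ^+ n.
      by rewrite ler_piMr ?exprn_ge0 ?gerBl ?powR_ge0//; lra.
    rewrite /G => H2; rewrite -(ler_pM2l n1) mulfV ?gt_eqF// mulrBr.
    rewrite [n.+1%:R * (n%:R / _ * _)](_ : _ = n%:R * b ^+ n.+1); last first.
      by rewrite mulrA mulrCA mulfV ?mulr1// gt_eqF.
    by have := ler_wpM2l (ltW n1) H2; lra.
  suff Ga : 0 <= G a by rewrite lerBlDr (le_trans Gb)// lerDl.
  rewrite /G subr_ge0.
  have : (1 - a) `^ (alpha + 1) <= 1 - a by apply: powR_compl_le; lra.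
  move=> H; have Ha : a <= 1 - (1 - a) `^ (alpha + 1) by lra.
  apply: le_trans (ler_wpM2l (exprn_ge0 n (ltW a0)) Ha).
  rewrite exprS [leRHS]mulrC ler_piMl ?mulr_ge0 ?exprn_ge0 ?(ltW a0)//.
  by rewrite ler_pdivrMr// mul1r ler_nat.
Qed.

End RadialWeight.

(** * Weighted integrals over the disk *)

Section DiskIntegrals.
Variable R : realType.
Local Notation leb := (@lebesgue_measure R).
Local Notation mu2 := (leb \x leb)%E.
Local Notation T1 := (measurableTypeR R).
Local Notation T2 := (measurableTypeR R * measurableTypeR R)%type.
Local Notation normc := (@Normc.normc R).
Variable alpha : R.
Hypothesis alpha_ge0 : 0 <= alpha.
Local Notation disk := [set u : R * R | normsq u < 1].

(** For 0 <= alpha <= 1 the weight is at most 2 on (0, 1), and 2 (1 - t)^(-1/2) has integral 4. *)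
Lemma half_moment_le : alpha <= 1 ->
  (\int[leb]_(t in `]0%R, 1%R[) ((1 - t) `^ (- (1 / 2)) * radial_weight alpha t)%:E <= 4%:E)%E.
Proof.
move=> alpha1.
apply: (@integral_oo01_le _ _ (fun t => 2 * (1 - t) `^ (- (1 / 2))) (fun t => - 4 * (1 - t) `^ (1 / 2))).
- apply: measurable_funM; last exact: measurable_radial_weight.
  apply: (@measurableT_comp _ _ _ T1 T1 T1 (fun x : R => x `^ (- (1 / 2)))).
    exact: measurable_powR.
  by apply: measurable_funB; [exact: measurable_cst | exact: measurable_id].
- move=> t t01; rewrite mulr_ge0 ?powR_ge0 ?radial_weight_ge0//= mulrC ler_wpM2r ?powR_ge0//.
  have H : (1 - t) `^ alpha <= 1 by apply: (@le_trans _ _ (1 `^ alpha)); [rewrite ge0_ler_powR// ?nnegrE; lra | rewrite powR1].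
  have := powR_ge0 (1 - t) alpha; rewrite /radial_weight; nra.
- move=> t t01; have t1 : t < 1 by lra.
  apply: (@continuousM _ _ (fun=> 2)); first exact: cst_continuous.
  exact: powR_compl_continuous.
- move=> t t01; have t1 : t < 1 by lra.
  have := is_derive_scale (- 4) (is_derive_powR_compl (1 / 2) t1).
  rewrite [1 / 2 - 1](_ : _ = - (1 / 2)); last by lra.
  by congr is_derive; lra.
- move=> a b a0 ab b1; have := powR_ge0 (1 - b) (1 / 2).
  have H : (1 - a) `^ (1 / 2) <= 1 by apply: (@le_trans _ _ (1 `^ (1 / 2))); [rewrite ge0_ler_powR// ?nnegrE; lra | rewrite powR1].
  lra.
Qed.

Lemma power_integral_le :
  (\int[leb]_(t in `]0%R, 1%R[) ((alpha + 1) * t `^ alpha)%:E <= 1%:E)%E.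
Proof.
have dG (t : R) : 0 < t -> is_derive t 1 (fun s : R => s `^ (alpha + 1)) ((alpha + 1) * t `^ alpha).
  by move=> t0; have := is_derive1_powR (alpha + 1) t0; rewrite addrK.
apply: (@integral_oo01_le _ _ (fun t => (alpha + 1) * t `^ alpha) (fun t => t `^ (alpha + 1))).
- by apply: measurable_funM; [exact: measurable_cst | exact: measurable_powR].
- by move=> t t01; rewrite mulr_ge0 ?powR_ge0 ?addr_ge0//=.
- move=> t /andP[t0 _].
  apply: (@continuousM _ _ (fun=> alpha + 1)); first exact: cst_continuous.
  by have [? _] := is_derive1_powR alpha t0; exact/differentiable_continuous/derivable1_diffP.
- by move=> t /andP[t0 _]; exact: dG.
- move=> a b a0 ab b1; have := powR_ge0 a (alpha + 1).
  have H : b `^ (alpha + 1) <= 1.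
    by apply: (@le_trans _ _ (1 `^ (alpha + 1))); [rewrite ge0_ler_powR ?addr_ge0 ?nnegrE//; lra | rewrite powR1].
  lra.
Qed.

Lemma disk_radial_le (phi : R -> R) (C : R) : measurable_fun [set: T1] (phi : T1 -> T1) ->
  (forall t, 0 <= phi t) ->
  (\int[leb]_(t in `]0%R, 1%R[) (phi t)%:E <= C%:E)%E ->
  (\int[mu2]_(u in disk) (phi (normsq u) * pi^-1)%:E <= C%:E)%E.
Proof.
move=> mphi phi0 H; have ip0 : 0 <= pi^-1 :> R by rewrite invr_ge0 pi_ge0.
rewrite (@radial_integral _ (fun t => phi t * pi^-1)); last first.
- by move=> t; rewrite mulr_ge0.
- by apply: measurable_funM => //; exact: measurable_cst.
under eq_integral do rewrite mulrC EFinM.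
rewrite ge0_integralZl ?lee_fin//; last 2 first.
- by apply/measurable_EFinP; exact: measurable_funTS.
- by move=> t _; rewrite lee_fin.
by rewrite muleA -EFinM divff ?mul1e// gt_eqF ?pi_gt0.
Qed.

Lemma measurable_disk : measurable (disk : set T2).
Proof.
have := (@measurable_normsq R) measurableT _ (@measurable_itv R `]-oo, 1[).
by rewrite setTI; congr measurable; apply/seteqP; split => u /=; rewrite in_itv.
Qed.

Lemma disk_poly_le N (d : nat -> R[i]) : (2 < N)%N ->
  (\int[mu2]_(u in disk) (normc (\sum_(n < N) d n * cplx u ^+ n) ^+ 2 *
     (radial_weight alpha (normsq u) * pi^-1))%:E <=
   (\sum_(n < N) normc (d n) ^+ 2 / n.+1%:R)%:E)%E.
Proof.
move=> N2; have ip0 : 0 <= pi^-1 :> R by rewrite invr_ge0 pi_ge0.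
pose w t : R := radial_weight alpha t * pi^-1.
have w0 t : 0 <= w t by rewrite mulr_ge0// radial_weight_ge0.
have mw : measurable_fun [set: T1] (w : T1 -> T1).
  by apply: measurable_funM; [exact: measurable_radial_weight | exact: measurable_cst].
(* Cutting the weight off outside the disk turns the disk integral into a plane integral with a
   radial weight. *)
pose v t : R := if t < 1 then w t else 0.
have v0 t : 0 <= v t by rewrite /v; case: ifP.
have mv : measurable_fun [set: T1] (v : T1 -> T1).
  apply: measurable_fun_if => //; last exact: measurable_funTS.
  - by apply: measurable_fun_ltr; [exact: measurable_id | exact: measurable_cst].
have diskE (F : R * R -> R) : (\int[mu2]_(u in disk) (F u * w (normsq u))%:E =
    \int[mu2]_u (F u * v (normsq u))%:E)%E.
  rewrite integral_mkcond; apply: eq_integral => u _; rewrite /v patchE.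
  case: ifPn => [|]; first by rewrite inE /= => ->.
  by rewrite notin_setE /= => /negP/negbTE ->; rewrite mulr0.
rewrite (diskE (fun u => normc (\sum_(n < N) d n * cplx u ^+ n) ^+ 2)).
rewrite (@plane_parseval _ _ _ v)// -sumEFin; apply: lee_sum => n _.
rewrite [leRHS]EFinM lee_pmul// ?lee_fin ?sqr_ge0//.
  by apply: integral_ge0 => u _; rewrite lee_fin mulr_ge0// exprn_ge0// addr_ge0 ?sqr_ge0.
rewrite -(diskE (fun u => normsq u ^+ n)).
apply: (@le_trans _ _ (\int[mu2]_(u in disk)
    (`|normsq u| ^+ n * radial_weight alpha (normsq u) * pi^-1)%:E)%E).
  rewrite le_eqVlt; apply/orP; left; apply/eqP; apply: eq_integral => u _.
  rewrite mulrA ger0_norm// /normsq addr_ge0 ?sqr_ge0//.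
apply: (@disk_radial_le (fun t => `|t| ^+ n * radial_weight alpha t)); last exact: moment_le.
- apply: measurable_funM; last exact: measurable_radial_weight.
  exact: measurable_funX (@normr_measurable R setT).
- by move=> t; rewrite mulr_ge0 ?exprn_ge0 ?radial_weight_ge0.
Qed.

End DiskIntegrals.

(** * Inequalities for real powers and a lower bound for the Beta function *)

Section PowerInequalities.
Variable R : realType.
Local Notation leb := (@lebesgue_measure R).
Local Notation T1 := (measurableTypeR R).

(** Young's inequality for the product of x^p and 1, with exponent q / p and its conjugate. *)
Lemma powR_le_affine (x p q : R) : 0 <= x -> 0 < p -> p <= q ->
  x `^ p <= p / q * x `^ q + (1 - p / q).
Proof.
move=> x0 p0; rewrite le_eqVlt => /orP[/eqP<-|pq].
  by rewrite divff ?gt_eqF// mul1r subrr addr0.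
have q0 : 0 < q by exact: lt_trans pq.
have r0 : 0 < 1 - p / q by rewrite subr_gt0 ltr_pdivrMr// mul1r.
have H : (q / p)^-1 + (1 - p / q)^-1^-1 = 1 by rewrite invf_div invrK addrC subrK.
have := conjugate_powR (powR_ge0 x p) ler01 (divr_gt0 q0 p0) _ H.
rewrite invr_gt0 => /(_ r0).
rewrite mulr1 powR1 mul1r invrK invf_div -powRrM (_ : p * (q / p) = q).
  by rewrite [x `^ q * _]mulrC.
by rewrite mulrCA divff ?mulr1// gt_eqF.
Qed.

Lemma powR_tangent (x y q : R) : 0 <= x -> 0 < y -> 1 <= q ->
  y `^ q * (1 + q * (x / y - 1)) <= x `^ q.
Proof.
move=> x0 y0 q1; have q0 : 0 < q by exact: lt_le_trans q1.
have xy0 : 0 <= x / y by rewrite divr_ge0// ltW.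
have := powR_le_affine xy0 ltr01 q1; rewrite powRr1// => H.
have {}H : 1 + q * (x / y - 1) <= (x / y) `^ q.
  have := ler_wpM2l (ltW q0) H; rewrite (_ : q * (1 / q * _ + _) = (x / y) `^ q + (q - 1)); last first.
    by set A := powR _ _; field; rewrite gt_eqF.
  lra.
apply: le_trans (ler_wpM2l (powR_ge0 y q) H) _.
by rewrite -powRM ?(ltW y0)// mulrC divfK ?gt_eqF.
Qed.

(** The tangent line of x^q at the mean y = (1 - s) + s x lies below the values at 1 and at x; in
    the weighted sum of the two bounds the linear terms cancel. *)
Lemma powR_convex1 (s x q : R) : 0 <= s <= 1 -> 0 <= x -> 1 <= q ->
  ((1 - s) + s * x) `^ q <= (1 - s) + s * x `^ q.
Proof.
move=> /andP[s0 s1] x0 q1; set y := (1 - s) + s * x.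
have y0 : 0 <= y by rewrite addr_ge0 ?subr_ge0 ?mulr_ge0.
move: y0; rewrite le_eqVlt => /orP[/eqP<-|y0].
  by rewrite powR0 ?gt_eqF ?(lt_le_trans _ q1)// addr_ge0 ?subr_ge0 ?mulr_ge0 ?powR_ge0.
have H1 := powR_tangent ler01 y0 q1; have Hx := powR_tangent x0 y0 q1.
rewrite powR1 in H1.
have s1' : 0 <= 1 - s by rewrite subr_ge0.
have E : ((1 - s) * (1 / y) + s * (x / y)) = 1.
  by rewrite /y; field; rewrite -/y gt_eqF.
have := lerD (ler_wpM2l s1' H1) (ler_wpM2l s0 Hx); rewrite mulr1.
have E2 (Y u v : R) : (1 - s) * (Y * (1 + q * (u - 1))) + s * (Y * (1 + q * (v - 1))) =
    Y * (1 + q * ((1 - s) * u + s * v - 1)) by ring.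
by rewrite E2 E subrr mulr0 addr0 mulr1.
Qed.

Lemma bernoulli_powR (m alpha t : R) : 1 <= m -> 0 <= alpha <= m -> 0 < t < 1 ->
  1 - m * t <= (1 - t) `^ alpha.
Proof.
move=> m1 /andP[a0 am] /andP[t0 t1].
have p : 0 <= 1 - t by lra.
apply: (@le_trans _ _ ((1 - t) `^ m)); last by apply: ger_powR => //; lra.
have m0 : 0 < m by lra.
have := powR_le_affine p ltr01 m1; rewrite powRr1// => H.
have := ler_wpM2l (ltW m0) H; rewrite (_ : m * (1 / m * _ + _) = (1 - t) `^ m + (m - 1)); last first.
  by set A := powR _ _; field; rewrite gt_eqF.
lra.
Qed.

(** Bernoulli's inequality bounds the Beta integrand below by t^(-1/2) (1 - m t), which is
    nonnegative up to 1 / m and has integral 4 / (3 sqrt m) there. The parameter m serves both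
    ranges: m = 1 for alpha <= 1 and m = alpha beyond. *)
Lemma Beta_half_inv_le (m alpha : R) : 1 <= m -> 0 <= alpha <= m ->
  1 / Beta (1 / 2) (alpha + 1) <= Num.sqrt m.
Proof.
move=> m1 am; have m0 : 0 < m by lra.
pose s := Num.sqrt m; rewrite -/s.
have s0 : 0 < s by rewrite sqrtr_gt0.
have sE : s ^+ 2 = m by rewrite sqr_sqrtr// ltW.
pose f (t : R) := t `^ (1 / 2 - 1) * (1 - t) `^ (alpha + 1 - 1).
pose g (t : R) := t `^ (1 / 2 - 1) * (1 - m * t).
pose G (t : R) := 2 * t `^ (1 / 2) - 2 / 3 * m * t `^ (3 / 2).
have f0 t : 0 <= f t by rewrite mulr_ge0 ?powR_ge0.
have mf : measurable_fun [set: T1] (f : T1 -> T1).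
  apply: measurable_funM; first exact: measurable_powR.
  apply: (@measurableT_comp _ _ _ T1 T1 T1 (fun x : R => x `^ (alpha + 1 - 1))).
    exact: measurable_powR.
  by apply: measurable_funB; [exact: measurable_cst | exact: measurable_id].
rewrite /Beta /Rintegral -/f.
set I := (\int[_]_(_ in _) _)%E.
have I0 : (0 <= I)%E by apply: integral_ge0 => t _; rewrite lee_fin; exact: f0.
(* An infinite integral would be read as 0 with inverse 0, and the bound would hold trivially. *)
have [Iy|] := eqVneq I +oo%E; first by rewrite Iy /= invr0 mulr0 ltW.
move=> Iy; suff : ((s^-1)%:E <= I)%E.
  case: I I0 Iy => //= r _ _; rewrite lee_fin => sr.
  by rewrite div1r -[s]invrK lef_pV2 ?posrE ?invr_gt0// (lt_le_trans _ sr)// invr_gt0.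
(* Starting at a = b / 64 avoids the singularity at 0 and costs at most 1 / (4 sqrt m), which 4/3 -
   1/4 > 1 can afford. *)
pose b := m^-1; pose a := b / 64.
have b0 : 0 < b by rewrite invr_gt0.
have b1 : b <= 1 by rewrite invf_le1.
have ab : a < b by rewrite /a; lra.
have a0 : 0 < a by rewrite /a; lra.
have inab t : `[a, b]%classic t -> 0 < t /\ t <= b.
  by rewrite /= in_itv/= => /andP[? ?]; split => //; lra.
have dG (t : R) : 0 < t -> is_derive t 1 G (g t).
  move=> t0; have d1 := is_derive_scale 2 (is_derive1_powR (1 / 2) t0).
  have d2 := is_derive_scale (2 / 3 * m) (is_derive1_powR (3 / 2) t0).
  have := is_deriveB d1 d2; congr is_derive.
  rewrite /g (_ : 3 / 2 - 1 = (1 / 2 - 1) + 1 :> R); last by lra.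
  rewrite (@powRD _ t (1 / 2 - 1) 1) ?(gt_eqF t0) ?implybT// powRr1 ?(ltW t0)//.
  by set A := powR _ _; field.
have cg (t : R) : 0 < t -> {for t, continuous g}.
  move=> t0; apply: (@continuousM _ _ (fun t : R => t `^ (1 / 2 - 1))).
    by have [? _] := is_derive1_powR (1 / 2 - 1) t0; exact/differentiable_continuous/derivable1_diffP.
  apply: continuousB; first exact: cst_continuous.
  by apply: (@continuousM _ _ (fun=> m)); [exact: cst_continuous | exact: cvg_id].
have cG (t : R) : 0 < t -> {for t, continuous G}.
  by move=> /dG[? _]; exact/differentiable_continuous/derivable1_diffP.
have cgw : {within `[a, b], continuous g}.
  by apply: continuous_in_subspaceT => t; rewrite inE => /inab[t0 _]; exact: cg.
have mab : measurable (`[a, b[%classic : set T1) by exact: measurable_itv.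
have mg : measurable_fun (`[a, b]%classic : set T1) (g : T1 -> T1).
  by apply: subspace_continuous_measurable_fun => //; exact: measurable_itv.
have g0 t : `[a, b]%classic t -> 0 <= g t.
  move=> /inab[t0 tb]; rewrite mulr_ge0 ?powR_ge0// subr_ge0.
  by rewrite -(mulfV (_ : m != 0)) ?gt_eqF// ler_pM2l.
have sub : `[a, b[%classic `<=` `]0%R, 1%R[%classic.
  by move=> t; rewrite /= !in_itv/= => /andP[? ?]; apply/andP; split; lra.
have sub2 : `[a, b[%classic `<=` `[a, b]%classic.
  by move=> t; rewrite /= !in_itv/= => /andP[-> /ltW].
apply: (@le_trans _ _ (\int[leb]_(t in `[a, b[) (g t)%:E)%E); last first.
  apply: (@le_trans _ _ (\int[leb]_(t in `[a, b[) (f t)%:E)%E).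
    apply: ge0_le_integral => //.
    - by move=> t /sub2 tab; rewrite lee_fin; exact: g0.
    - by apply/measurable_EFinP; apply: measurable_funS mg => //; exact: measurable_itv.
    - by apply/measurable_EFinP; exact: measurable_funTS.
    - move=> t /sub; rewrite /= in_itv/= => t01.
      by rewrite lee_fin ler_wpM2l ?powR_ge0// addrK bernoulli_powR.
  apply: ge0_subset_integral => //.
  - by apply/measurable_EFinP; exact: measurable_funTS.
  - by move=> t _; rewrite lee_fin.
rewrite integral_itv_bndo_bndc; last first.
  by apply/measurable_EFinP; apply: measurable_funS mg => //; exact: measurable_itv.
rewrite (@continuous_FTC2 _ _ G)//.
- rewrite -EFinB lee_fin.
  have sb : b `^ (1 / 2) = s^-1.
    by rewrite div1r powR12_sqrt ?(ltW b0)// sqrtrV ?(ltW m0).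
  have sa : a `^ (1 / 2) = s^-1 / 8.
    rewrite /a powRM ?(ltW b0)// sb; congr (_ * _).
    rewrite (_ : 64^-1 = 8^-1 ^+ 2); last by lra.
    by rewrite div1r powR12_sqrt ?sqr_ge0// sqrtr_sqr ger0_norm ?invr_ge0.
  have E (x : R) : 0 < x -> x `^ (3 / 2) = x * x `^ (1 / 2).
    move=> x0; rewrite (_ : 3 / 2 = 1 + 1 / 2 :> R); last by lra.
    by rewrite powRD ?gt_eqF ?implybT// powRr1 ?(ltW x0).
  rewrite /G !E// sb sa.
  have Eb : 2 / 3 * m * (b * s^-1) = 2 / 3 * s^-1.
    by rewrite -mulrA [m * _]mulrA mulfV ?mul1r ?gt_eqF.
  have h1 : 0 <= 2 / 3 * m * (a * (s^-1 / 8)).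
    by rewrite !mulr_ge0 ?invr_ge0 ?(ltW a0) ?(ltW m0) ?(ltW s0).
  have si : 0 < s^-1 by rewrite invr_gt0.
  rewrite Eb; lra.
- split.
  + by move=> t; rewrite in_itv/= => /andP[? ?]; case: (dG t) => //; lra.
  + by apply: cvg_at_right_filter; exact: cG.
  + by apply: cvg_at_left_filter; exact: cG.
- by move=> t; rewrite in_itv/= => /andP[? ?]; rewrite derive1E; case: (dG t) => //; lra.
Qed.

End PowerInequalities.

(** * Growth of Bloch functions along rays *)

Section BlochGrowth.
Variable R : realType.
Local Notation normc := (@Normc.normc R).

Variables (f df : R[i] -> R[i]) (rho : R).
Hypothesis rho0 : 0 < rho.
Hypothesis fd : forall z, normc z < 1 -> cderiv f z (df z).
Hypothesis bl : forall z, normc z < 1 -> normc (df z) * (1 - normc z ^+ 2) <= rho.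

(** The ray integral of rho / (1 - x^2) is logarithmic; the power (1 - |z|^2)^(-b) replaces it
    because it combines with powers of the weight. The choice b = 1/2 serves alpha > 1, and b = 1/8
    serves alpha <= 1. *)
Lemma bloch_growth (b : R) (z : R[i]) : 0 < b <= 1 / 2 -> normc z < 1 ->
  normc (f z - f 0) <= rho * (normc z / (2 * b) * (1 - normc z ^+ 2) `^ (- b)).
Proof.
move=> /andP[b0 b12] z1; set r := normc z.
have r0 : 0 <= r by exact: normc_ge0.
have r1 : r < 1 by [].
have y01 (s : R) : 0 <= s <= 1 -> 0 < 1 - (s * r) ^+ 2 <= 1.
  move=> /andP[s0 s1]; have : 0 <= s * r by rewrite mulr_ge0.
  have : s * r < 1 by apply: le_lt_trans r1; rewrite ler_piMl.
  by move=> h1 h0; rewrite subr_gt0 exprn_ilt1//= gerBl sqr_ge0.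
pose K := rho * (r / (2 * b)).
pose phi (s : R) := K * (s * (1 - (s * r) ^+ 2) `^ (- b)).
pose dphi (s : R) := K * ((1 - (s * r) ^+ 2) `^ (- b) +
  s * ((2 * b * (s * r) * r) * (1 - (s * r) ^+ 2) `^ (- b - 1))).
have K0 : 0 <= K by rewrite /K mulr_ge0 ?divr_ge0 ?mulr_ge0 ?(ltW rho0) ?(ltW b0).
have -> : rho * (r / (2 * b) * (1 - r ^+ 2) `^ (- b)) = phi 1 - phi 0.
  by rewrite /phi !mul1r mul0r mulr0 subr0 /K mulrA.
rewrite -[z in f z]add0r; apply: (@mean_value_ineq _ f 0 z (fun s => df (s%:C * z)) phi dphi).
- move=> s s01; rewrite add0r; apply: fd; rewrite Normc.normcM normc_real ger0_norm; last by lra.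
  by apply: le_lt_trans r1; rewrite ler_piMl//; lra.
- move=> s s01; have s01' : 0 <= s <= 1 by lra.
  have /andP[y0 y1] := y01 s s01'.
  have nsz : normc (s%:C * z) = s * r by rewrite Normc.normcM normc_real ger0_norm//; lra.
  have sr1 : s * r < 1 by apply: le_lt_trans r1; rewrite ler_piMl//; lra.
  have := @bl (s%:C * z); rewrite nsz => /(_ sr1) H.
  rewrite (Normc.normcM (df _)) -/r /dphi.
  set y := 1 - (s * r) ^+ 2 in y0 y1 H *; set Q := y `^ (- b).
  have QE : y * y `^ (- b - 1) = Q.
    by rewrite -{1}[y]powRr1 ?(ltW y0)// -powRD ?(gt_eqF y0) ?implybT// addrC subrK.
  have Q1 : 1 <= Q.
    by rewrite -(powRr0 y); apply: ger_powR; rewrite ?y0 ?y1//; lra.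
  rewrite -(ler_pM2l y0); apply: (@le_trans _ _ (rho * r)).
    by rewrite mulrA [y * _]mulrC ler_wpM2r.
  have -> : y * (K * (Q + s * (2 * b * (s * r) * r * y `^ (- b - 1)))) =
      K * (y * Q + 2 * b * (s * r) ^+ 2 * (y * y `^ (- b - 1))).
    by set A := y `^ _; set B := K; ring.
  (* With y = 1 - (s r)^2 the claim becomes 2 b <= (y + 2 b (1 - y)) Q, true since Q >= 1 and 2 b <=
     1. *)
  rewrite QE; have srE : (s * r) ^+ 2 = 1 - y by rewrite /y; ring.
  rewrite srE; set W := y * Q + _.
  have H1 : 2 * b <= W.
    rewrite /W -mulrDl; apply: (@le_trans _ _ (y + 2 * b * (1 - y))); first by nra.
    by rewrite ler_peMr//; nra.
  have -> : K * W = rho * r * (W / (2 * b)) by rewrite /K; set A := _^-1; ring.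
  by rewrite ler_peMr ?mulr_ge0 ?(ltW rho0)// ler_pdivlMr ?mulr_gt0// mul1r.
- move=> s s01; have /andP[y0 y1] := y01 s s01.
  have d1 : is_derive s 1 (fun s : R => 1 - (s * r) ^+ 2) (- (2 * (s * r) * r)).
    have := is_deriveB (is_derive_cst (1 : R) s 1) (is_derive_scale (r ^+ 2) (is_derive_expr 2 s)).
    have -> : cst 1 - (fun s : R => r ^+ 2 * s ^+ 2) = (fun s => 1 - (s * r) ^+ 2).
      by apply/funext => x; rewrite exprMn [_ ^+ 2 * _]mulrC.
    by congr is_derive; rewrite /= expr1; ring.
  have d2 := @is_derive1_comp R (fun x : R => x `^ (- b)) (fun s : R => 1 - (s * r) ^+ 2) s _ _
    (is_derive1_powR (- b) y0) d1.
  have := is_derive_scale K (is_deriveM (is_derive_id s 1) d2).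
  rewrite -![_ *: _]/(_ * _); congr is_derive; rewrite /dphi /= mulr1; ring.
Qed.
End BlochGrowth.

(** * Square integrals under pointwise limits *)

Section BlochSquare.
Variable R : realType.
Local Notation normc := (@Normc.normc R).
Local Notation leb := (@lebesgue_measure R).
Local Notation mu2 := (leb \x leb)%E.
Local Notation T1 := (measurableTypeR R).
Local Notation T2 := (measurableTypeR R * measurableTypeR R)%type.
Local Notation cRe := (@complex.Re R).
Local Notation cIm := (@complex.Im R).
Local Notation disk := [set u : R * R | normsq u < 1].
Variable alpha : R.
Hypothesis alpha_ge0 : 0 <= alpha.

Definition disk_weight (u : R * R) : R := radial_weight alpha (normsq u) * pi^-1.

Lemma disk_weight_ge0 u : 0 <= disk_weight u.
Proof. by rewrite mulr_ge0 ?radial_weight_ge0// invr_ge0 pi_ge0. Qed.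

Lemma measurable_disk_weight : measurable_fun [set: T2] (disk_weight : T2 -> T1).
Proof.
apply: measurable_funM; last exact: measurable_cst.
exact: measurableT_comp (measurable_radial_weight alpha) (@measurable_normsq R).
Qed.

Lemma disk_normc (u : R * R) : disk u -> normc (cplx u) < 1.
Proof. by rewrite /= -normc_cplx expr_lt1 ?normc_ge0. Qed.

Definition cconverges (F : nat -> R[i] -> R[i]) (h : R[i] -> R[i]) := forall z, normc z < 1 ->
  forall e, 0 < e -> exists N, forall n, (N <= n)%N -> normc (F n z - h z) <= e.

Lemma cconverges_cvg F h (u : R * R) : cconverges F h -> disk u ->
  [/\ cRe (F n (cplx u)) @[n --> \oo] --> cRe (h (cplx u)),
      cIm (F n (cplx u)) @[n --> \oo] --> cIm (h (cplx u)) &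
      normc (F n (cplx u)) @[n --> \oo] --> normc (h (cplx u))].
Proof.
move=> Fh /disk_normc Du; split; apply/cvgrPdist_le => e e0;
  have [N HN] := Fh _ Du e e0; exists N => // n /= /HN; apply: le_trans.
- rewrite normcB; apply: le_trans (normc_Re _).
  by case: (h _) (F _ _) => [? ?] [? ?].
- rewrite normcB; apply: le_trans (normc_Im _).
  by case: (h _) (F _ _) => [? ?] [? ?].
- have H1 := normcD_le (F n (cplx u) - h (cplx u)) (h (cplx u)).
  have H2 := normcD_le (h (cplx u) - F n (cplx u)) (F n (cplx u)).
  rewrite !subrK in H1 H2; rewrite normcB in H2; rewrite ler_distlC; apply/andP; split; lra.
Qed.

Lemma cmeasurable_limit F h : cconverges F h ->
  (forall n, cmeasurable disk (F n \o (@cplx R))) -> cmeasurable disk (h \o (@cplx R)).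
Proof.
move=> Fh mF; split.
  apply: (@measurable_fun_cvg _ T2 R disk (fun n => (cRe \o (F n \o @cplx R) : T2 -> T1))).
    by move=> n; have [] := mF n.
  by move=> u Du; have [] := cconverges_cvg Fh Du.
apply: (@measurable_fun_cvg _ T2 R disk (fun n => (cIm \o (F n \o @cplx R) : T2 -> T1))).
  by move=> n; have [] := mF n.
by move=> u Du; have [] := cconverges_cvg Fh Du.
Qed.

(** Fatou's lemma: a uniform bound on the integrals survives pointwise convergence, without any
    domination. *)
Lemma sqr_integral_limit F h (C : R) : cconverges F h ->
  (forall n, cmeasurable disk (F n \o (@cplx R))) ->
  (forall n, \int[mu2]_(u in disk) (normc (F n (cplx u)) ^+ 2 * disk_weight u)%:E <= C%:E)%E ->
  (\int[mu2]_(u in disk) (normc (h (cplx u)) ^+ 2 * disk_weight u)%:E <= C%:E)%E.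
Proof.
move=> Fh mF FC.
pose a n (u : T2) := (normc (F n (cplx u)) ^+ 2 * disk_weight u)%:E.
have ma n : measurable_fun (disk : set T2) (a n).
  apply/measurable_EFinP; apply: measurable_funM; last exact: measurable_funTS measurable_disk_weight.
  exact: cmeasurable_normc_sqr (mF n).
have a0 n (u : T2) : disk u -> (0%R <= a n u)%E.
  by move=> _; rewrite lee_fin mulr_ge0 ?sqr_ge0 ?disk_weight_ge0.
have := fatou [the measure _ _ of mu2] (@measurable_disk R) ma a0.
rewrite (@eq_integral _ _ _ _ _ (fun u => (normc (h (cplx u)) ^+ 2 * disk_weight u)%:E)); last first.
  move=> u; rewrite inE => Du; have [_ _ cv] := cconverges_cvg Fh Du.
  apply: (cvg_limn_einf_sup _).1; rewrite /a.
  apply: cvg_EFin; first exact: nearW.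
  by apply: cvgM; [apply: cvgM | exact: cvg_cst].
move=> H; apply: le_trans H _; rewrite limn_einf_lim; apply: lime_le; first exact: is_cvg_einfs.
apply: nearW => n; apply: le_trans (FC n).
by apply: ereal_inf_lbound; exists n => /=.
Qed.
End BlochSquare.

(** * The square integral of a Bloch function, by dilation *)

Section BlochDilation.
Variable R : realType.
Local Notation normc := (@Normc.normc R).
Local Notation leb := (@lebesgue_measure R).
Local Notation mu2 := (leb \x leb)%E.
Local Notation disk := [set u : R * R | normsq u < 1].
Variable alpha : R.
Hypothesis alpha_ge0 : 0 <= alpha.
Variables (f df : R[i] -> R[i]) (rho : R).
Hypothesis rho0 : 0 < rho.
Hypothesis fd : forall z, normc z < 1 -> cderiv f z (df z).
Hypothesis bl : forall z, normc z < 1 -> normc (df z) * (1 - normc z ^+ 2) <= rho.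

(** For r < 1 the dilate is differentiable with bounded derivative on the closed disk, as Cauchy's
    formula demands, and the Bloch bound [rho] is inherited. *)
Let dilate (r : R) (z : R[i]) := f (r%:C * z) - f 0.

Lemma dilation_square (r : R) : 0 < r < 1 ->
  cmeasurable disk (dilate r \o (@cplx R)) /\
  (\int[mu2]_(u in disk) (normc (dilate r (cplx u)) ^+ 2 * disk_weight alpha u)%:E <=
    ((1 - 1 / 128 * (1 / 256)) * rho ^+ 2)%:E)%E.
Proof.
move=> /andP[r0 r1].
pose g z := f (0 + r%:C * z); pose dg z := df (0 + r%:C * z) * r%:C.
have nr z : normc (0 + r%:C * z) = r * normc z.
  by rewrite add0r Normc.normcM normc_real gtr0_norm.
have nr1 z : normc z <= 1 -> normc (0 + r%:C * z) < 1.
  by move=> z1; rewrite nr; apply: le_lt_trans r1; rewrite ler_piMr// ltW.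
have gd z : normc z <= 1 -> cderiv g z (dg z).
  move=> z1 e e0; have [d d0 Hd] := fd (nr1 z z1) (divr_gt0 e0 r0).
  exists (d / r); first exact: divr_gt0.
  move=> h hd; have := Hd (r%:C * h).
  have -> : normc (r%:C * h) = r * normc h by rewrite Normc.normcM normc_real gtr0_norm.
  have -> : e / r * (r * normc h) = e * normc h by rewrite mulrA divfK// gt_eqF.
  rewrite [r * _]mulrC -ler_pdivlMr// => /(_ hd).
  have -> : 0 + r%:C * z + r%:C * h = 0 + r%:C * (z + h) by ring.
  by have -> : r%:C * h * df (0 + r%:C * z) = h * dg z by rewrite /dg; ring.
have dgb z : normc (dg z) = normc (df (0 + r%:C * z)) * r.
  by rewrite /dg Normc.normcM normc_real gtr0_norm.
have gL z : normc z <= 1 -> normc (dg z) <= rho / (1 - r ^+ 2).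
  move=> z1; have r2 : 0 < 1 - r ^+ 2 by rewrite subr_gt0 exprn_ilt1// ltW.
  have H := bl (nr1 z z1); rewrite dgb ler_pdivlMr//.
  have nd := normc_ge0 (df (0 + r%:C * z)); have nz := normc_ge0 z.
  apply: le_trans H; rewrite nr -mulrA ler_wpM2l//.
  apply: (@le_trans _ _ (1 - r ^+ 2)).
    by rewrite ler_piMl// ltW.
  by rewrite lerB// exprMn ler_piMr ?sqr_ge0// expr_le1.
have gbl z : normc z < 1 -> normc (dg z) * (1 - normc z ^+ 2) <= rho.
  move=> z1; apply: le_trans (bl (nr1 z (ltW z1))); rewrite dgb -mulrA ler_wpM2l ?normc_ge0//.
  have nz := normc_ge0 z.
  have z2 : 0 <= 1 - normc z ^+ 2 by rewrite subr_ge0 expr_le1// ltW.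
  apply: (@le_trans _ _ (1 - normc z ^+ 2)); first by rewrite ler_piMl// ltW.
  by rewrite lerB// nr exprMn ler_piMl ?sqr_ge0// expr_le1// ltW.
have [c [M M0 ps]] := cauchy_power_series gd gL.
have c0 : c 0%N = f 0.
  have := ps 0 1%N; rewrite Normc.normc0 ltr01 expr1 mulr0 big_ord1 expr0 mulr1 => /(_ isT).
  rewrite /g mulr0 addr0 => H; apply/esym/eqP; rewrite -subr_eq0 -normc_eq0.
  by rewrite eq_le H normc_ge0.
(* The constant term is dropped because [dilate] subtracts f 0. Starting from [k.+3] terms meets the
   requirement of more than two nodes in the plane Parseval identity. *)
pose d n := if n is n'.+1 then c n else 0.
pose F k z := \sum_(n < k.+3) d n * z ^+ n.
have FE k z : F k z - dilate r z = - (g z - \sum_(n < k.+3) c n * z ^+ n).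
  rewrite /F /dilate !big_ord_recl /= c0 !mul0r expr0 mulr1 /g add0r.
  by rewrite add0r; ring.
have cvF : cconverges F (dilate r).
  move=> z z1 e e0; pose B := M * (1 - normc z)^-1.
  have B0 : 0 <= B by rewrite mulr_ge0// invr_ge0 subr_ge0 ltW.
  have z01 : 0 <= normc z < 1 by rewrite normc_ge0.
  have e1 : 0 < e / (B + 1) by rewrite divr_gt0// ltr_wpDl.
  have [N _ HN] := exists_expr_le 0 z01 e1.
  exists N => n Nn; rewrite FE normcN; apply: le_trans (ps _ _ z1) _; rewrite -/B.
  have H : normc z ^+ n.+3 <= e / (B + 1).
    by apply: le_trans HN; apply: ler_wiXn2l; rewrite ?normc_ge0 ?ltW// (leq_trans Nn)// -addn3 leq_addr.
  apply: le_trans (ler_wpM2l B0 H) _.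
  by rewrite mulrCA ler_piMr ?(ltW e0)// ler_pdivrMr ?mul1r ?lerDl ?ler01// ltr_wpDl.
have mF n : cmeasurable disk (F n \o (@cplx R)).
  have := @cmeasurable_poly R disk d 1 n.+3; congr cmeasurable.
  by apply/funext => u; apply: eq_bigr => i _; rewrite mul1r.
split; first exact: cmeasurable_limit cvF mF.
apply: (sqr_integral_limit alpha_ge0 cvF mF) => k.
apply: le_trans (disk_poly_le alpha_ge0 d (isT : (2 < k.+3)%N)) _.
rewrite lee_fin big_ord_recl [X in X / _ + _](_ : _ = 0); last by rewrite Normc.normc0 expr0n.
rewrite mul0r add0r.
exact: (bloch_coefficient_sum gd M0 rho0 gbl ps k.+2).
Qed.

(** Dilates converge pointwise to f - f(0) as r -> 1. Measurability of f on the disk comes out of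
    the same limits, from polynomials to dilates to f. *)
Lemma bloch_square :
  cmeasurable disk (f \o (@cplx R)) /\
  (\int[mu2]_(u in disk) (normc (f (cplx u) - f 0) ^+ 2 * disk_weight alpha u)%:E <=
    ((1 - 1 / 128 * (1 / 256)) * rho ^+ 2)%:E)%E.
Proof.
pose r k : R := 1 - k.+2%:R^-1.
have r01 k : 0 < r k < 1.
  by rewrite subr_gt0 gtrBl invr_gt0 ltr0n andbT invf_lt1 ?ltr0n// ltr1n.
have cv : cconverges (fun k => dilate (r k)) (fun z => f z - f 0).
  move=> z z1 e e0; have [d d0 Hd] := fd z1 ltr01.
  pose B := normc (df z) + 1; have B0 : 0 < B by rewrite ltr_wpDl// normc_ge0.
  have m0 : 0 < Num.min d (e / B) by rewrite lt_min d0 divr_gt0.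
  have [N HN] := ltr_add_invr m0; rewrite add0r in HN.
  exists N => n Nn; rewrite /dilate opprB addrA subrK.
  pose h := (- n.+2%:R^-1)%:C * z.
  have nh : normc h <= Num.min d (e / B).
    rewrite Normc.normcM normc_real normrN ger0_norm ?invr_ge0 ?ler0n//.
    apply: (@le_trans _ _ n.+2%:R^-1).
      by rewrite ler_piMr ?invr_ge0 ?ler0n// ltW.
    apply: le_trans (ltW HN); rewrite lef_pV2 ?posrE ?ltr0n// ler_nat.
    exact: leq_trans Nn (leqnSn _).
  have -> : (r n)%:C * z = z + h by rewrite /h /r rmorphB rmorphN; ring.
  move: nh; rewrite le_min => /andP[hd he].
  have H := Hd h hd; rewrite mul1r in H.
  have := normcD_le (f (z + h) - f z - h * df z) (h * df z); rewrite subrK => H2.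
  apply: le_trans H2 _; apply: le_trans (lerD H (lexx _)) _.
  rewrite Normc.normcM -[X in X + _]mulr1 -mulrDr addrC.
  by rewrite -ler_pdivlMr.
have mD k := (dilation_square (r01 k)).1.
split.
  have -> : f \o (@cplx R) = fun u => (f (cplx u) - f 0) + f 0.
    by apply/funext => u; rewrite subrK.
  by apply: cmeasurableD; [exact: cmeasurable_limit cv mD | exact: cmeasurable_cst].
apply: (sqr_integral_limit alpha_ge0 cv mD) => k.
exact: (dilation_square (r01 k)).2.
Qed.
End BlochDilation.

Lemma integral_le_combination d (T : measurableType d) (R : realType)
    (mu : {measure set T -> \bar R}) (D : set T) (F a b : T -> R) (k l A B : R) :
  measurable D -> measurable_fun D F -> measurable_fun D a -> measurable_fun D b ->
  (forall x, D x -> 0 <= F x) -> (forall x, D x -> 0 <= a x) -> (forall x, D x -> 0 <= b x) ->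
  0 <= k -> 0 <= l -> (forall x, D x -> F x <= k * a x + l * b x) ->
  (\int[mu]_(x in D) (a x)%:E <= A%:E)%E -> (\int[mu]_(x in D) (b x)%:E <= B%:E)%E ->
  (\int[mu]_(x in D) (F x)%:E <= (k * A + l * B)%:E)%E.
Proof.
move=> mD mF ma mb F0 a0 b0 k0 l0 Fab aA bB.
have Ea : measurable_fun D (fun x => (a x)%:E) by exact/measurable_EFinP.
have Eb : measurable_fun D (fun x => (b x)%:E) by exact/measurable_EFinP.
have mka : measurable_fun D (fun x => k%:E * (a x)%:E)%E by exact: measurable_funeM.
have mlb : measurable_fun D (fun x => l%:E * (b x)%:E)%E by exact: measurable_funeM.
apply: (@le_trans _ _ (\int[mu]_(x in D) (k%:E * (a x)%:E + l%:E * (b x)%:E))%E).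
  apply: ge0_le_integral => //.
  - exact/measurable_EFinP.
  - exact: emeasurable_funD.
rewrite ge0_integralD//; last 2 first.
- by move=> x Dx; rewrite -EFinM lee_fin mulr_ge0 ?a0.
- by move=> x Dx; rewrite -EFinM lee_fin mulr_ge0 ?b0.
rewrite !ge0_integralZl//.
by rewrite EFinD !EFinM; apply: leeD; apply: lee_wpmul2l; rewrite ?lee_fin.
Qed.

(** * Integrals of powers of X, and the contraction they imply *)

Section BlochContraction.
Variable R : realType.
Local Notation normc := (@Normc.normc R).
Local Notation leb := (@lebesgue_measure R).
Local Notation mu2 := (leb \x leb)%E.
Local Notation T1 := (measurableTypeR R).
Local Notation T2 := (measurableTypeR R * measurableTypeR R)%type.
Local Notation disk := [set u : R * R | normsq u < 1].
Variable alpha : R.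
Hypothesis alpha_ge0 : 0 <= alpha.

Lemma cmeasurable_normc_powR (F : T2 -> R[i]) (q : R) : cmeasurable disk F ->
  measurable_fun (disk : set T2) ((fun u => normc (F u) `^ q) : T2 -> T1).
Proof.
move=> /cmeasurable_normc_sqr mF.
have -> : (fun u => normc (F u) `^ q) = (fun x : R => x `^ (q / 2)) \o (fun u => normc (F u) ^+ 2).
  apply/funext => u /=; rewrite -powR_mulrn ?normc_ge0// -powRrM; congr (_ `^ _).
  by field.
apply: (@measurableT_comp _ _ _ T2 T1 T1 (fun x : R => x `^ (q / 2))) => //.
Qed.

Lemma measurable_disk_mul (F : T2 -> R) : measurable_fun (disk : set T2) (F : T2 -> T1) ->
  measurable_fun (disk : set T2) (fun u => (F u * disk_weight alpha u)%:E).
Proof.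
move=> mF; apply/measurable_EFinP; apply: measurable_funM => //.
exact: measurable_funTS (measurable_disk_weight alpha).
Qed.

Lemma disk_weight_total : (\int[mu2]_(u in disk) (disk_weight alpha u)%:E <= 1%:E)%E.
Proof.
apply: (@disk_radial_le _ (radial_weight alpha)).
- exact: measurable_radial_weight.
- by move=> t; exact: radial_weight_ge0.
- have := moment_le alpha_ge0 0; rewrite invr1; apply: le_trans.
  rewrite le_eqVlt; apply/orP; left; apply/eqP; apply: eq_integral => t _.
  by rewrite expr0 mul1r.
Qed.

Variables (f df : R[i] -> R[i]) (rho : R).
Hypothesis rho0 : 0 < rho.
Hypothesis fd : forall z, normc z < 1 -> cderiv f z (df z).
Hypothesis bl : forall z, normc z < 1 -> normc (df z) * (1 - normc z ^+ 2) <= rho.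

Let X (u : T2) := normc (f (cplx u) - f 0) / rho.

Let mfz : cmeasurable disk (f \o (@cplx R)).
Proof. by have [] := bloch_square alpha_ge0 rho0 fd bl. Qed.

Let mX q : measurable_fun (disk : set T2) ((fun u => X u `^ q) : T2 -> T1).
Proof.
have mF : cmeasurable disk (fun u => (f (cplx u) - f 0) * (rho^-1)%:C).
  apply: cmeasurableM; last exact: cmeasurable_cst.
  by apply: cmeasurableD; [exact: mfz | exact: cmeasurable_cst].
have := cmeasurable_normc_powR q mF; congr measurable_fun.
apply/funext => u; rewrite /X; congr (_ `^ _).
by rewrite Normc.normcM normc_real ger0_norm// invr_ge0 ltW.
Qed.

Let X0 u : 0 <= X u.
Proof. by rewrite divr_ge0 ?normc_ge0// ltW. Qed.

Let growth b u : 0 < b <= 1 / 2 -> disk u ->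
  X u <= normc (cplx u) / (2 * b) * (1 - normsq u) `^ (- b).
Proof.
move=> b0 /disk_normc Du.
have := bloch_growth rho0 fd bl b0 Du.
by rewrite normc_cplx /X ler_pdivrMr// [_ * rho]mulrC.
Qed.

Lemma bloch_power_large : 1 < alpha ->
  (\int[mu2]_(u in disk) (X u `^ (2 * alpha) * disk_weight alpha u)%:E <= 1%:E)%E.
Proof.
move=> a1; pose phi t : R := (alpha + 1) * t `^ alpha.
have mphi : measurable_fun [set: T1] (phi : T1 -> T1).
  by apply: measurable_funM; [exact: measurable_cst | exact: measurable_powR].
have phi0 t : 0 <= phi t by rewrite mulr_ge0 ?powR_ge0 ?addr_ge0.
apply: le_trans (disk_radial_le mphi phi0 (power_integral_le alpha_ge0)).
apply: ge0_le_integral.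
- exact: measurable_disk.
- by move=> u _; rewrite lee_fin mulr_ge0 ?powR_ge0 ?disk_weight_ge0.
- exact: measurable_disk_mul.
- apply/measurable_EFinP; apply: measurable_funM; last exact: measurable_cst.
  apply: measurable_funTS; exact: measurableT_comp mphi (@measurable_normsq R).
- move=> u Du; rewrite lee_fin /disk_weight mulrA ler_wpM2r ?invr_ge0 ?pi_ge0//.
  have := @growth (1 / 2) u _ Du; rewrite lexx divr_gt0// => /(_ isT); rewrite [2 * _](_ : _ = 1); last by field.
  rewrite divr1 => H.
  set t := normsq u in H *; have t0 : 0 <= t by rewrite addr_ge0 ?sqr_ge0.
  have t1 : 0 < 1 - t by rewrite subr_gt0.
  have H2 : X u ^+ 2 <= t * (1 - t)^-1.
    apply: (@le_trans _ _ ((normc (cplx u) * (1 - t) `^ (- (1 / 2))) ^+ 2)).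
      by rewrite lerXn2r ?nnegrE ?X0 ?mulr_ge0 ?normc_ge0 ?powR_ge0.
    rewrite exprMn normc_cplx -/t -[X in _ * X <= _]powR_mulrn ?powR_ge0// -powRrM.
    by rewrite mulNr div1r mulVf// powR_inv1// ltW.
  have -> : X u `^ (2 * alpha) = (X u ^+ 2) `^ alpha by rewrite powRrM powR_mulrn.
  have H3 : (X u ^+ 2) `^ alpha <= t `^ alpha * (1 - t) `^ (- alpha).
    rewrite powRN -(powR_inv1 (powR_ge0 _ _)) -powRrM [alpha * -1]mulrC powRrM powR_inv1 ?(ltW t1)//.
    rewrite -powRM ?invr_ge0 ?(ltW t1)//.
    by rewrite ge0_ler_powR// nnegrE ?sqr_ge0// mulr_ge0 ?invr_ge0 ?(ltW t1).
  apply: le_trans (ler_wpM2r (radial_weight_ge0 alpha_ge0 t) H3) _.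
  rewrite powRN /radial_weight /phi mulrCA; apply: ler_wpM2l; first by rewrite addr_ge0.
  by rewrite divfK// powR_eq0 gt_eqF.
Qed.

Lemma bloch_power_small (e : R) : alpha <= 1 -> 0 < e ->
  e <= 1 / 32 * (1 / 32) * (1 / 128 * (1 / 256)) ->
  (\int[mu2]_(u in disk) (X u `^ (2 + e) * disk_weight alpha u)%:E <= 1%:E)%E.
Proof.
move=> a1 e0 ee; pose phi t : R := (1 - t) `^ (- (1 / 2)) * radial_weight alpha t.
have mphi : measurable_fun [set: T1] (phi : T1 -> T1).
  apply: measurable_funM; last exact: measurable_radial_weight.
  apply: (@measurableT_comp _ _ _ T1 T1 T1 (fun x : R => x `^ (- (1 / 2)))) => //.
  by apply: measurable_funB; [exact: measurable_cst | exact: measurable_id].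
have phi0 t : 0 <= phi t by rewrite mulr_ge0 ?powR_ge0 ?radial_weight_ge0.
have I2 := (bloch_square alpha_ge0 rho0 fd bl).2.
have I4 := disk_radial_le mphi phi0 (half_moment_le alpha_ge0 a1).
(* Weights in X^(2+e) <= (1 - e/2) X^2 + (e/2) X^4, with X^4 <= 256 (1 - t)^(-1/2); [rho ^+ 2]
   appears because [I2] is not normalized. *)
pose k := (1 - e / 2) / rho ^+ 2; pose l := e / 2 * 256.
have e2 : 0 <= 1 - e / 2 by lra.
have k0 : 0 <= k by rewrite divr_ge0 ?sqr_ge0.
have l0 : 0 <= l by rewrite /l; lra.
have mF : cmeasurable disk (fun u => f (cplx u) - f 0).
  by apply: cmeasurableD; [exact: mfz | exact: cmeasurable_cst].
have comb := @integral_le_combination _ T2 R [the measure _ _ of mu2] (disk : set T2)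
  (fun u => X u `^ (2 + e) * disk_weight alpha u)
  (fun u => normc (f (cplx u) - f 0) ^+ 2 * disk_weight alpha u)
  (fun u => phi (normsq u) * pi^-1) k l.
apply: (le_trans (comb _ _ _ _ _ _ _ _ _ k0 l0 _ I2 I4)).
- exact: measurable_disk.
- by apply/measurable_EFinP; exact: measurable_disk_mul.
- by apply/measurable_EFinP; apply: measurable_disk_mul; exact: cmeasurable_normc_sqr.
- apply: measurable_funM; last exact: measurable_cst.
  apply: measurable_funTS; exact: measurableT_comp mphi (@measurable_normsq R).
- by move=> u _; rewrite mulr_ge0 ?powR_ge0 ?disk_weight_ge0.
- by move=> u _; rewrite mulr_ge0 ?sqr_ge0 ?disk_weight_ge0.
- by move=> u _; rewrite mulr_ge0 ?phi0 ?invr_ge0 ?pi_ge0.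
(* With b = 1/8 the fourth power has the integrable exponent -1/2, where b = 1/2 would give -2. *)
- move=> u Du; have := @growth (1 / 8) u _ Du.
  rewrite (_ : (0 < 1 / 8 <= 1 / 2) = true); last by lra.
  move=> /(_ isT); rewrite (_ : 2 * (1 / 8) = 4^-1) ?invrK; last by lra.
  have X2E : X u ^+ 2 = normc (f (cplx u) - f 0) ^+ 2 / rho ^+ 2 by rewrite /X expr_div_n.
  have Xu0 := X0 u; set x := X u in Xu0 X2E *; set t := normsq u => H.
  have t1 : 0 < 1 - t by rewrite subr_gt0.
  have H4 : x ^+ 2 ^+ 2 <= 256 * (1 - t) `^ (- (1 / 2)).
    have {}H : x <= 4 * (1 - t) `^ (- (1 / 8)).
      apply: le_trans H _; rewrite ler_wpM2r ?powR_ge0//.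
      by rewrite ler_piMl// ltW// disk_normc.
    have -> : (1 - t) `^ (- (1 / 2)) = ((1 - t) `^ (- (1 / 8))) ^+ 4.
      by rewrite -powR_mulrn ?powR_ge0// -powRrM; congr (_ `^ _); field.
    have -> : x ^+ 2 ^+ 2 = x ^+ 4 by ring.
    rewrite (_ : 256 = 4 ^+ 4); last by ring.
    by rewrite -exprMn lerXn2r ?nnegrE ?Xu0 ?mulr_ge0 ?powR_ge0.
  have -> : x `^ (2 + e) = x ^+ 2 * x `^ e.
    rewrite powRD; last by rewrite gt_eqF// addr_gt0.
    by rewrite powR_mulrn.
  have He : x `^ e <= e / 2 * x ^+ 2 + (1 - e / 2).
    by rewrite -powR_mulrn//; apply: powR_le_affine => //; lra.
  have x2 := sqr_ge0 x.
  have Hx : x ^+ 2 * x `^ e <= (1 - e / 2) * x ^+ 2 + l * (1 - t) `^ (- (1 / 2)).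
    apply: le_trans (ler_wpM2l x2 He) _.
    have -> : x ^+ 2 * (e / 2 * x ^+ 2 + (1 - e / 2)) =
      (1 - e / 2) * x ^+ 2 + e / 2 * (x ^+ 2 ^+ 2) by ring.
    rewrite lerD2l /l -[leRHS](mulrA (e / 2)); apply: ler_wpM2l => //; lra.
  apply: le_trans (ler_wpM2r (disk_weight_ge0 alpha_ge0 u) Hx) _.
  rewrite le_eqVlt; apply/orP; left; apply/eqP; rewrite X2E /k /phi /disk_weight -/t.
  by set P := _ `^ _; set Q := radial_weight _ _; set n2 := normc _ ^+ 2; set q := pi^-1; field; rewrite gt_eqF.
(* The total is (1 - e/2) (1 - delta) + 512 e with delta = 1/128 * 1/256, and e <= delta / 1024. *)
- rewrite lee_fin /k [X in X + _](_ : _ = (1 - e / 2) * (1 - 1 / 128 * (1 / 256))).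
    by rewrite /l; lra.
  by field; rewrite gt_eqF.
Qed.

Lemma bloch_power_contraction (p q : R) : 1 <= q -> 0 < p -> p <= q ->
  (\int[mu2]_(u in disk) (X u `^ q * disk_weight alpha u)%:E <= 1%:E)%E ->
  (\int[mu2]_(u in disk) (normc (f (cplx u)) `^ p * disk_weight alpha u)%:E <=
    ((normc (f 0) + rho) `^ p)%:E)%E.
Proof.
move=> q1 p0 pq Hq; pose A := normc (f 0); pose T := A + rho.
have A0 : 0 <= A by exact: normc_ge0.
have T0 : 0 < T by rewrite ltr_wpDl.
have q0 : 0 < q by exact: lt_le_trans q1.
pose s := rho / T; have s0 : 0 <= s by rewrite divr_ge0// ltW.
have s1 : s <= 1 by rewrite ler_pdivrMr// mul1r lerDr.
have pq0 : 0 <= p / q by rewrite divr_ge0// ltW.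
have pq1 : p / q <= 1 by rewrite ler_pdivrMr// mul1r.
(* [a] is the coefficient of X^q after the convexity step and the passage from p to q; the
   complementary weight 1 - a goes to the total mass. *)
pose a := p / q * s.
have a0 : 0 <= a by rewrite mulr_ge0.
have a1 : 0 <= 1 - a by rewrite subr_ge0 mulr_ile1.
have comb := @integral_le_combination _ T2 R [the measure _ _ of mu2] (disk : set T2)
  (fun u => normc (f (cplx u)) `^ p * disk_weight alpha u)
  (fun u => X u `^ q * disk_weight alpha u)
  (fun u => disk_weight alpha u) (T `^ p * a) (T `^ p * (1 - a)).
apply: (le_trans (comb _ _ _ _ _ _ _ _ _ _ _ _ Hq disk_weight_total)).
- exact: measurable_disk.
- by apply/measurable_EFinP; apply: measurable_disk_mul; exact: cmeasurable_normc_powR.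
- by apply/measurable_EFinP; exact: measurable_disk_mul.
- exact: measurable_funTS (measurable_disk_weight alpha).
- by move=> u _; rewrite mulr_ge0 ?powR_ge0 ?disk_weight_ge0.
- by move=> u _; rewrite mulr_ge0 ?powR_ge0 ?disk_weight_ge0.
- by move=> u _; exact: disk_weight_ge0.
- by rewrite mulr_ge0 ?powR_ge0.
- by rewrite mulr_ge0 ?powR_ge0.
- move=> u _; rewrite mulrA -mulrDl ler_wpM2r ?disk_weight_ge0//.
  have Xu0 := X0 u; pose Y := (1 - s) + s * X u.
  have Y0 : 0 <= Y by apply: addr_ge0; [rewrite subr_ge0 | exact: mulr_ge0].
  have nY : normc (f (cplx u)) <= T * Y.
    have -> : T * Y = A + normc (f (cplx u) - f 0).
      rewrite /Y /s /X /T; set n := normc (_ - _); field.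
      by rewrite -/T !gt_eqF.
    by have := normcD_le (f (cplx u) - f 0) (f 0); rewrite subrK addrC.
  apply: (@le_trans _ _ (T `^ p * Y `^ p)).
    rewrite -powRM ?(ltW T0)//; apply: ge0_ler_powR => //; first exact: ltW.
      by rewrite nnegrE normc_ge0.
    by rewrite nnegrE mulr_ge0// ltW.
  rewrite -mulrA -mulrDr ler_wpM2l ?powR_ge0//.
  apply: le_trans (powR_le_affine Y0 p0 pq) _.
  have s01 : 0 <= s <= 1 by rewrite s0.
  have H := ler_wpM2l pq0 (powR_convex1 s01 Xu0 q1).
  apply: le_trans (lerD H (lexx _)) _.
  have E (c b x : R) : c * (1 - b + b * x) + (1 - c) = c * b * x + (1 - c * b) by ring.
  by rewrite /a E.
- by rewrite lee_fin !mulr1 -mulrDr addrC subrK mulr1.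
Qed.

End BlochContraction.

(** * The original norms in terms of [normsq] and [disk_weight], and the conclusion *)

Lemma disk_integralE (R : realType) (alpha : R) (g : R[i] -> R) :
  disk_integral alpha g =
  (\int[(@lebesgue_measure R) \x (@lebesgue_measure R)]_(u in [set u : R * R | (normsq u < 1)%R])
     (g (cplx u) * disk_weight alpha u)%:E)%E.
Proof.
rewrite /disk_integral.
have -> : [set u : R * R | unit_disk (u.1 +i* u.2)] = [set u : R * R | normsq u < 1].
  apply/seteqP; split => u; rewrite /= /unit_disk -normc_cplx /= => H.
    by rewrite expr_lt1 ?normc_ge0.
  by rewrite -(@expr_lt1 _ 2) ?normc_ge0.
by apply: eq_integral => u _; rewrite /disk_weight /radial_weight -normc_cplx.
Qed.

Theorem corollary3p5 (R : realType) (alpha : R) (alpha_ge0 : 0 <= alpha) :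
  exists p_alpha : R,
    2 * Num.max 1 (1 / Beta (1 / 2) (alpha + 1)) < p_alpha /\
    forall p : R, 0 < p -> p <= p_alpha ->
    forall f : R[i]^o -> R[i]^o, bloch f ->
      (bergman_norm alpha p f <= bloch_norm f)%E.
Proof.
have [e e0 ee] : exists2 e : R, 0 < e & e <= 1 / 32 * (1 / 32) * (1 / 128 * (1 / 256)).
  by exists (1 / 32 * (1 / 32) * (1 / 128 * (1 / 256))) => //; rewrite !mulr_gt0.
pose q := if alpha <= 1 then 2 + e else 2 * alpha.
have q1 : 1 <= q by rewrite /q; case: (leP alpha 1) => ?; lra.
exists q; split.
  rewrite /q; case: (leP alpha 1) => alpha1.
    have a01 : 0 <= alpha <= 1 by rewrite alpha_ge0.
    have := Beta_half_inv_le (lexx 1) a01; rewrite sqrtr1 => /max_idPl ->.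
    by rewrite mulr1 ltrDl.
  rewrite ltr_pM2l// gt_max alpha1 /=.
  have aa : 0 <= alpha <= alpha by rewrite alpha_ge0 lexx.
  apply: le_lt_trans (Beta_half_inv_le (ltW alpha1) aa) _.
  rewrite -[ltRHS]ger0_norm// -sqrtr_sqr ltr_sqrt ?exprn_gt0//; last by lra.
  by rewrite expr2 ltr_pMr//; lra.
move=> p p0 pq f [fan fS].
have bl0 z : unit_disk z ->
    ((Normc.normc (derive1 f z) * (1 - Normc.normc z ^+ 2))%:E <= bloch_seminorm f)%E.
  by move=> Dz; apply: ereal_sup_ubound; exists z.
have S0 : (0 <= bloch_seminorm f)%E.
  have n0 : Normc.normc (0 : R[i]^o) = 0 by exact: Normc.normc0.
  apply: le_trans (bl0 0 _); last by rewrite /unit_disk /mkset n0 ltr01.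
  by rewrite n0 expr0n subr0 mulr1 lee_fin normc_ge0.
rewrite /bloch_norm.
have [s sE] : exists s : R, bloch_seminorm f = s%:E.
  by case: (bloch_seminorm f) S0 fS => // s _ _; exists s.
rewrite sE in S0 bl0 *; rewrite lee_fin in S0.
(* The slack d makes rho = s + d positive even for constant f, whose seminorm is 0, so that division
   by rho is legitimate. *)
apply/lee_addgt0Pr => d d0.
have rho0 : 0 < s + d by rewrite ltr_wpDl.
have fd z : Normc.normc z < 1 -> cderiv f z (derive1 f z).
  by move=> z1; apply: derivable_cderiv; exact: fan.
have bl z : Normc.normc z < 1 -> Normc.normc (derive1 f z) * (1 - Normc.normc z ^+ 2) <= s + d.
  by move=> z1; have := bl0 z z1; rewrite lee_fin => /le_trans; apply; rewrite lerDl ltW.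
have Hq := fun q1 p0 pq => bloch_power_contraction alpha_ge0 rho0 fd bl q1 p0 pq.
have {}Hq := Hq _ _ q1 p0 pq _.
have A0 : 0 <= Normc.normc (f 0) + (s + d) by rewrite addr_ge0 ?normc_ge0// ltW.
rewrite -!EFinD -addrA [leRHS](_ : _ =
    (((Normc.normc (f 0) + (s + d)) `^ p) `^ p^-1)%:E)%E; last first.
  by rewrite -powRrM divff ?gt_eqF// powRr1.
rewrite /bergman_norm disk_integralE -poweR_EFin.
have I0 : (0 <= \int[(@lebesgue_measure R) \x (@lebesgue_measure R)]_(u in
    [set u : R * R | (normsq u < 1)%R])
    (Normc.normc (f (cplx u)) `^ p * disk_weight alpha u)%:E)%E.
  by apply: integral_ge0 => u _; rewrite lee_fin mulr_ge0 ?powR_ge0 ?disk_weight_ge0.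
apply: gt0_ler_poweR.
- by rewrite invr_ge0 ltW.
- by rewrite in_itv/= I0 leey.
- by rewrite in_itv/= lee_fin powR_ge0 leey.
apply: Hq; rewrite /q; case: (leP alpha 1) => alpha1.
  exact: @bloch_power_small _ _ alpha_ge0 _ _ _ rho0 fd bl e alpha1 e0 ee.
exact: @bloch_power_large _ _ alpha_ge0 _ _ _ rho0 fd bl alpha1.
Qed.
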